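(* Let $(X,c)$ be a network with $\alpha(x):=\sum_{y:y\sim x}\sqrt{c(xy)}<\infty$ for every $x\in X^0$. Let $(v(x))_{x\in X^0}$ be positive numbers with $v(x)\ge\sqrt[4]{m^0(x)}$ for all $x\in X^0$ and $\sum_{x\in X^0}\alpha(x)/v(x)^2<\infty$, and let $w:X^1\to(0,\infty)$ be given by $w(xy,t)=v(x)\sqrt[4]{c(xy)}$ for $t\in(0,\frac12)$ and $w(xy,t)=v(y)\sqrt[4]{c(xy)}$ for $t\in(\frac12,1)$. Let $(\Psi_j)$, $\Psi_j:\lambda\mapsto\Psi_{j,\lambda}$, be a Fourier-type expansion for the continuous Laplacian $L$ with $\mathcal H_+=\mathcal L^2\big(X^1,\frac{w^2}{c}m^1\big)$ and $\mathcal H_-=\mathcal L^2\big(X^1,\frac{c}{w^2}m^1\big)$, and let $\mu$ be the associated spectral measure for $L$. Then for every $j$ and for $\mu$-a.e. $\lambda$ there exist a function $b$ on $X^0$ and a function $a$ on the set $E$ of ordered pairs $xy$ with $x,y\in X^0$, $x\sim y$, such that for $m^1$-a.e. $(xy,t)\in X^1$ $$\Psi_{j,\lambda}(xy,t)=b(x)\cos(\sqrt\lambda\,t)+a(xy)\,\Phi(\sqrt\lambda,t),$$ with $\sum_{y:y\sim x}c(xy)|a(xy)|<\infty$ and $\sum_{y:y\sim x}c(xy)a(xy)=0$ for all $x\in X^0$.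
   Context: Network. $X$ is a countable (finite or infinite, not necessarily locally finite) connected graph without loops and multiple edges, with at least one edge, vertex set $X^0$ and symmetric neighborhood relation $\sim$. Each edge $[x,y]=[y,x]$ carries a conductance $c(xy)=c(yx)>0$. Standing assumption: $m^0(x):=\sum_{y:y\sim x}c(xy)<\infty$ for all $x\in X^0$. $X^1$ is the associated metric graph: each edge is a copy of $[0,1]$, glued at common endpoints; $(xy,t)$ is the point at distance $t\in[0,1]$ from $x$ on the edge $[x,y]$, with $(xy,0)\equiv x$ and $(xy,t)\equiv(yx,1-t)$. For $F:X^1\to\mathbb C$ and $x\sim y$ write $F_{xy}(t):=F(xy,t)$. The measure $m^1$ on $X^1$ equals $c(xy)\,dt$ on the edge $[x,y]$ and vertices have measure zero, so $\|F\|^2_{\mathcal L^2(X^1,m^1)}=\frac12\sum_{x\in X^0}\sum_{y\sim x}c(xy)\|F_{xy}\|^2_{L^2(0,1)}$. The letter $c$ also denotes the function $c(xy,t):=c(xy)$ on $X^1$. $\Phi(z,t)=\sin(zt)/z$ for $z\ne0$, $\Phi(0,t)=t$. Continuous Laplacian. Derivatives are taken in the length parameter, $F'(xy,t):=F_{xy}'(t)$. $\widehat H^2(X^1,m^1)$ is the set of $F\in\mathcal L^2(X^1,m^1)$ with $F_{xy}\in H^2(0,1)$ for all $x\sim y$ and $\frac12\sum_x\sum_{y\sim x}c(xy)\|F_{xy}^{(j)}\|^2_{L^2(0,1)}<\infty$ for $j=1,2$. $L$ is the (non-negative self-adjoint) operator in $\mathcal L^2(X^1,m^1)$ acting as $LF=-F''$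 on those $F\in\widehat H^2(X^1,m^1)$ satisfying, for every $x\in X^0$: $F(xu,0)=F(xv,0)$ for all $u,v\sim x$, and $\sum_{y\sim x}c(xy)F'(xy,0+)=0$. Fourier-type expansions. Let $\mathcal H$ be a separable Hilbert space and $T\ge1$ a self-adjoint operator in $\mathcal H$. $\mathcal H_+$ is $\operatorname{dom}T$ with scalar product $\langle Tf,Tg\rangle$; $\mathcal H_-$ is the completion of $\mathcal H$ for $\langle T^{-1}f,T^{-1}g\rangle$; the scalar product of $\mathcal H$ extends to a sesquilinear pairing $\langle\cdot,\cdot\rangle:\mathcal H_+\times\mathcal H_-\to\mathbb C$. (Here $\mathcal H=\mathcal L^2(X^1,m^1)$, $T$ is multiplication by $w/\sqrt c$, which gives the stated weighted spaces, and $\langle F,\Psi\rangle=\frac12\sum_x\sum_{y\sim x}c(xy)\int_0^1F(xy,t)\overline{\Psi(xy,t)}\,dt$.) Let $H$ be self-adjoint in $\mathcal H$ and $\mu$ a spectral measure for $H$ (a scalar Borel measure with $\mu(\Omega)=0$ iff $1_\Omega(H)=0$). An ordered spectral representation of $H$ is a sequence of sets $M_j\subset\mathbb R$, $M_j\supset M_{j+1}$, $j=1,\dots,N$ ($N$ a positive integer or $\infty$), with a unitary map $U=(U_j):\mathcal H\to\bigoplus_{j=1}^NL^2(M_j,d\mu)$ such that $U\varphi(H)=M_\varphi U$ for every measurable $\varphi$ on $\mathbb R$, $M_\varphi$ being multiplication by $\varphi$. Given such a representation, measurable functions $\varphi_j:M_j\to\mathcal H_-$, $\lambda\mapsto\varphi_{j,\lambda}$,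 realize a Fourier-type expansion for $H$ if: (a) $U_jf(\lambda)=\langle f,\varphi_{j,\lambda}\rangle$ for $\mu$-a.e. $\lambda$ and all $f\in\mathcal H_+$; (b) for every $g=(g_j)\in\bigoplus_jL^2(M_j,d\mu)$, $U^{*}g=\lim_{n\to N,\,R\to\infty}\sum_{j=1}^n\int_{M_j\cap(-R,R)}g_j(\lambda)\varphi_{j,\lambda}\,d\mu(\lambda)$; (c) for every $f\in\mathcal H$, $f=\lim_{n\to N,\,R\to\infty}\sum_{j=1}^n\int_{M_j\cap(-R,R)}(U_jf)(\lambda)\varphi_{j,\lambda}\,d\mu(\lambda)$; (d) for $\mu$-a.e. $\lambda\in M_j$ and any $f\in\mathcal H_+\cap\operatorname{dom}H$ with $Hf\in\mathcal H_+$, $\langle Hf,\varphi_{j,\lambda}\rangle=\lambda\langle f,\varphi_{j,\lambda}\rangle$. *)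

(* Defs.v *)
From HB Require Import structures.
From mathcomp Require Import all_boot all_order all_algebra generic_quotient.
From mathcomp Require Import complex.
From mathcomp Require Import all_classical all_reals all_analysis.
From mathcomp Require showcase.summability.

Set Implicit Arguments.
Unset Strict Implicit.
Unset Printing Implicit Defensive.

Import Order.TTheory GRing.Theory Num.Theory.
Import numFieldNormedType.Exports.

Local Open Scope classical_set_scope.
Local Open Scope ring_scope.
Local Open Scope quotient_scope.
Local Open Scope complex_scope.

Record network (R : realType) := Network {
  vert : countType ;
  adj : rel vert ;
  cond : vert -> vert -> R ;
  adj_sym : forall x y, adj x y = adj y x ;
  adj_irr : forall x, ~~ adj x x ;
  adj_conn : forall x y, exists p, path adj x p /\ last x p = y ;
  adj_ex : exists x y, adj x y ;
  cond_sym : forall x y, adj x y -> cond x y = cond y x ;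
  cond_gt0 : forall x y, adj x y -> 0 < cond x y ;
  cond_sum : forall x, (\esum_(y in [set y | adj x y]) (cond x y)%:E < +oo)%E
}.

Section network_theory.
Context {R : realType} (N : network R).

Definition edge := {e : vert N * vert N | adj e.1 e.2}.
Definition src (e : edge) : vert N := (val e).1.
Definition tgt (e : edge) : vert N := (val e).2.
Definition ec (e : edge) : R := cond (src e) (tgt e).

Lemma rev_subproof (e : edge) : adj (tgt e) (src e).
Proof. by rewrite adj_sym; exact: (valP e). Qed.
Definition rev (e : edge) : edge := exist _ (tgt e, src e) (rev_subproof e).

Lemma revK : involutive rev.
Proof. by move=> e; apply: val_inj => /=; rewrite -surjective_pairing. Qed.

Lemma ec_gt0 e : 0 < ec e.
Proof. exact: cond_gt0 (valP e). Qed.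

Definition m0 (x : vert N) : R :=
  fine (\esum_(y in [set y | adj x y]) (cond x y)%:E)%E.

Definition alpha (x : vert N) : \bar R :=
  (\esum_(y in [set y | adj x y]) (Num.sqrt (cond x y))%:E)%E.

Definition unitI := {t : R | 0 <= t <= 1}.

Lemma zeroI_subproof : 0 <= (0 : R) <= 1.
Proof. by rewrite lexx ler01. Qed.
Definition zeroI : unitI := exist _ 0 zeroI_subproof.

Lemma oppI_subproof (t : unitI) : 0 <= 1 - val t <= 1.
Proof.
by case: t => t /= /andP[t0 t1]; rewrite subr_ge0 t1 lerBlDr lerDl t0.
Qed.
Definition oppI (t : unitI) : unitI := exist _ (1 - val t) (oppI_subproof t).

Lemma oppIK : involutive oppI.
Proof. by move=> t; apply: val_inj => /=; rewrite subKr. Qed.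

Definition prepoint := (edge * unitI)%type.

Definition flip (p : prepoint) : prepoint := (rev p.1, oppI p.2).

Definition endpt (p : prepoint) : option (vert N) :=
  if val p.2 == 0 then Some (src p.1)
  else if val p.2 == 1 then Some (tgt p.1) else None.

Definition glue : rel prepoint := fun p q =>
  [|| p == q, flip p == q | (endpt p != None) && (endpt p == endpt q)].

Lemma flipK : involutive flip.
Proof. by case=> e t; rewrite /flip /= revK oppIK. Qed.

Lemma endpt_flip p : endpt (flip p) = endpt p.
Proof.
case: p => e [t ht]; rewrite /endpt /flip /=.
rewrite subr_eq0 (eq_sym 1 t); have -> : (1 - t == 1) = (t == 0).
  by rewrite -subr_eq0 addrAC subrr add0r oppr_eq0.
by have [->|] := eqVneq t 1; rewrite ?oner_eq0.
Qed.

Lemma glue_refl : reflexive glue.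
Proof. by move=> p; rewrite /glue eqxx. Qed.

Lemma glue_sym : symmetric glue.
Proof.
move=> p q; rewrite /glue (eq_sym p q).
have -> : (flip p == q) = (flip q == p) by apply/eqP/eqP => <-; rewrite flipK.
rewrite (eq_sym (endpt p) (endpt q)).
by have [->|] := eqVneq (endpt q) (endpt p); rewrite ?andbF.
Qed.

Lemma glue_trans : transitive glue.
Proof.
move=> q p r; rewrite /glue => /or3P[/eqP-> //|/eqP<-|/andP[p0 /eqP pq]].
  rewrite flipK endpt_flip => /or3P[/eqP->|/eqP->|/andP[-> ->]];
  by rewrite ?eqxx ?orbT.
move=> /or3P[/eqP<-|/eqP<-|/andP[_ /eqP<-]];
by rewrite ?endpt_flip ?p0 ?pq ?eqxx ?orbT.
Qed.

Canonical glue_equiv := EquivRel glue glue_refl glue_sym glue_trans.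

(* The metric graph X^1: the copies of [0, 1], one for each oriented edge,
   modulo (xy, t) = (yx, 1 - t) and the gluing of endpoints. *)
Definition mgraph := {eq_quot glue}%qT.
HB.instance Definition _ := Choice.on mgraph.

(* [pt e t] is the point (xy, t) for e = xy and t in [0, 1]; outside [0, 1] *)
(* its value is the origin of e. *)
Definition pt (e : edge) (t : R) : mgraph :=
  \pi_({eq_quot glue}%qT) (e, insubd zeroI t).

Lemma mgraph_inhabited : exists p : mgraph, True.
Proof.
by have [x [y xy]] := adj_ex N; exists (pt (exist _ (x, y) xy) 0).
Qed.

HB.instance Definition _ :=
  isPointed.Build mgraph (projT1 (cid mgraph_inhabited)).

(* The Borel sets of the metric graph: there are countably many edges and *)
(* each of them is embedded. *)
Definition mgraph_measurable : set (set mgraph) :=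
  [set A | forall e, measurable (`[0, 1] `&` pt e @^-1` A : set R)].

Lemma mgraph_measurable0 : mgraph_measurable set0.
Proof. by move=> e; rewrite preimage_set0 setI0. Qed.

Lemma mgraph_measurableC A : mgraph_measurable A -> mgraph_measurable (~` A).
Proof.
move=> mA e; rewrite preimage_setC.
have -> : `[0, 1] `&` ~` (pt e @^-1` A) =
    `[0, 1] `\` (`[0, 1] `&` pt e @^-1` A) :> set R.
  by rewrite setDIr setDv set0U setDE.
exact: measurableD.
Qed.

Lemma mgraph_measurable_bigcup (F : (set mgraph)^nat) :
  (forall i, mgraph_measurable (F i)) -> mgraph_measurable (\bigcup_i F i).
Proof.
move=> mF e; rewrite preimage_bigcup setI_bigcupr.
by apply: bigcup_measurable => k _; exact: mF.
Qed.

HB.instance Definition _ := isMeasurable.Build default_measure_display mgraph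
  mgraph_measurable0 mgraph_measurableC mgraph_measurable_bigcup.

(* The factor 1/2 is there because [edge] lists every edge with both *)
(* orientations. *)
Definition m1 (A : set mgraph) : \bar R :=
  (\esum_(e in [set: edge])
     (ec e / 2)%:E * lebesgue_measure (`]0%R, 1%R[ `&` pt e @^-1` A : set R))%E.

Let m1_0 : m1 set0 = 0%E.
Proof.
rewrite /m1 esum1 // => e _.
by rewrite preimage_set0 setI0 measure0 mule0.
Qed.

Let ec2_ge0 (e : edge) (B : set R) :
  (0 <= (ec e / 2)%:E * lebesgue_measure B)%E.
Proof. by rewrite mule_ge0 // lee_fin divr_ge0 // ltW // ec_gt0. Qed.

Let m1_ge0 A : (0 <= m1 A)%E.
Proof. by rewrite /m1 esum_ge0. Qed.

Let measurable_edge e A : measurable A ->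
  measurable (`]0, 1[ `&` pt e @^-1` A : set R).
Proof.
move=> mA.
have -> : `]0, 1[ `&` pt e @^-1` A =
    `]0, 1[ `&` (`[0, 1] `&` pt e @^-1` A) :> set R.
  rewrite setIA; congr (_ `&` _); apply/esym/setIidPl => t.
  exact: subset_itv_oo_cc.
by apply: measurableI => //; exact: mA.
Qed.

Let m1_sigma_additive : semi_sigma_additive m1.
Proof.
move=> F mF tF mUF.
suff -> : m1 (\bigcup_n F n) = (\sum_(i <oo) m1 (F i))%E.
  by apply: is_cvg_nneseries => n _ _; exact: m1_ge0.
rewrite nneseries_esumT // /m1.
have -> : (\esum_(e in [set: edge]) (ec e / 2)%:E *
      lebesgue_measure (`]0%R, 1%R[ `&` pt e @^-1` (\bigcup_n F n) : set R) =
    \esum_(e in [set: edge]) \esum_(k in [set: nat]) (ec e / 2)%:E *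
      lebesgue_measure (`]0%R, 1%R[ `&` pt e @^-1` F k : set R))%E.
  apply: eq_esum => e _.
  rewrite preimage_bigcup setI_bigcupr measure_semi_bigcup; first last.
  - by apply: bigcup_measurable => k _; exact: measurable_edge.
  - move=> i j _ _ [t [[_ Fi] [_ Fj]]].
    by apply: (tF i j) => //; exists (pt e t).
  - by move=> k; exact: measurable_edge.
  rewrite -nneseriesZl; last by [].
  by rewrite nneseries_esumT // => n; exact: ec2_ge0.
rewrite !esum_esum //.
rewrite (reindex_esum ([set: nat] `*`` fun=> [set: edge]) _
  (fun x => (x.2, x.1))) //; split => //=.
- by move=> [i1 i2] [j1 j2] /= _ _ [] -> ->.
- by move=> [i1 i2] _ /=; exists (i2, i1).
Qed.

HB.instance Definition _ :=
  isMeasure.Build _ mgraph R m1 m1_0 m1_ge0 m1_sigma_additive.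

(* The function c on X^1; its values at the vertices, a null set, are those *)
(* of an arbitrarily chosen incident edge. *)
Definition c1 (p : mgraph) : R := ec (repr p).1.

End network_theory.

Arguments m0 {R} N x.
Arguments alpha {R} N x.
Arguments m1 {R} N A.
Arguments c1 {R} N p.

Section complex_functions.
Context {R : realType} {d : measure_display} {T : measurableType d}.
Variable m : {measure set T -> \bar R}.
Implicit Types (D : set T) (f g : T -> R[i]) (rho : T -> R).

Definition cmeasurable D f :=
  measurable_fun D (fun x => complex.Re (f x)) /\
  measurable_fun D (fun x => complex.Im (f x)).

Definition cintegrable D f :=
  m.-integrable D (fun x => (complex.Re (f x))%:E) /\
  m.-integrable D (fun x => (complex.Im (f x))%:E).

Definition cint D f : R[i] :=
  Rintegral m D (fun x => complex.Re (f x)) +i*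
  Rintegral m D (fun x => complex.Im (f x)).

Definition ceq D f g := {ae m, forall x, D x -> f x = g x}.

(* Squared norm of f in L^2(D, rho m). *)
Definition wnorm2 D rho f : \bar R :=
  (\int[m]_(x in D)
     (rho x * (complex.Re (f x) ^+ 2 + complex.Im (f x) ^+ 2))%:E)%E.

Definition L2w D rho f := cmeasurable D f /\ (wnorm2 D rho f < +oo)%E.

Definition norm2 D f := wnorm2 D (cst 1) f.
Definition L2 D f := L2w D (cst 1) f.

(* Linear in the first argument. *)
Definition pairing f g : R[i] := cint setT (fun x => f x * conjc (g x)).

End complex_functions.

(* Elements of L^2(T, m) are represented by functions and an operator in *)
(* L^2(T, m) by its graph H: H f g means that f is in dom H and Hf = g. *)
Section spectral_theory.
Context {R : realType} {d : measure_display} {T : measurableType d}.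
Variable m : {measure set T -> \bar R}.
Local Notation fT := (T -> R[i]).
Local Notation Rmeas := {measure set (measurableTypeR R) -> \bar R}.
Implicit Types (f g h : fT) (Om : set R).

(* A projection-valued measure E on the Borel sets of R, together with the *)
(* measures nu f : Om |-> ||E(Om) f||^2 = <E(Om) f, f>. *)
Record is_pvm (E : set R -> fT -> fT) (nu : fT -> Rmeas) :
    Prop := IsPVM {
  pvm_L2 : forall Om f, measurable Om -> L2 m setT f -> L2 m setT (E Om f) ;
  pvm_linear : forall Om (a : R[i]) f g, measurable Om ->
    L2 m setT f -> L2 m setT g ->
    ceq m setT (E Om (fun x => a * f x + g x))
               (fun x => a * E Om f x + E Om g x) ;
  pvm_selfadjoint : forall Om f g, measurable Om ->
    L2 m setT f -> L2 m setT g -> pairing m (E Om f) g = pairing m f (E Om g) ;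
  pvm_setI : forall Om Om' f, measurable Om -> measurable Om' ->
    L2 m setT f -> ceq m setT (E Om (E Om' f)) (E (Om `&` Om') f) ;
  pvm_setT : forall f, L2 m setT f -> ceq m setT (E setT f) f ;
  pvm_measure : forall Om f, measurable Om -> L2 m setT f ->
    nu f Om = norm2 m setT (E Om f)
}.

(* The integral of phi with respect to the complex measure <E(.) f, h>, *)
(* expressed by polarization. *)
Definition pvm_int (nu : fT -> Rmeas) (phi : R -> R[i])
    f h : R[i] :=
  4^-1 * \sum_(k < 4) 'i%C ^+ k *
    cint (nu (fun x => f x + 'i%C ^+ k * h x)) setT phi.

(* The graph of phi(H), the integral of phi with respect to E: its domain is
   {f | phi in L^2(nu f)}, and <phi(H) f, h> is the integral of phi with
   respect to <E(.) f, h> for all h in this (dense) domain. *)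
Definition fun_calc (nu : fT -> Rmeas) (phi : R -> R[i])
    f g : Prop :=
  [/\ L2 m setT f, L2 m setT g, L2 (nu f) setT phi &
     forall h, L2 m setT h -> L2 (nu h) setT phi ->
       pairing m g h = pvm_int nu phi f h].

(* E is the spectral resolution of H, so that phi(H) is [fun_calc nu phi] and *)
(* 1_Om(H) is E Om; such an E exists iff H is self-adjoint, and is unique. *)
Definition spectral_resolution (H : fT -> fT -> Prop) (E : set R -> fT -> fT)
    (nu : fT -> Rmeas) : Prop :=
  is_pvm E nu /\
  forall f g, H f g <-> fun_calc nu (fun lambda => lambda%:C) f g.

Definition spectral_measure (E : set R -> fT -> fT)
    (mu : Rmeas) : Prop :=
  forall Om, measurable Om ->
    (mu Om = 0%E <-> forall f, L2 m setT f -> ceq m setT (E Om f) (cst 0)).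

(* N is a positive integer or infinity (None); the index j starts from 0. *)
Definition below (N : option nat) (j : nat) : bool :=
  if N is Some n then (j < n)%N else true.

Record is_unitary (mu : Rmeas) (N : option nat)
    (M : nat -> set R) (U : nat -> fT -> R -> R[i]) : Prop := IsUnitary {
  unitary_L2 : forall j f, below N j -> L2 m setT f -> L2 mu (M j) (U j f) ;
  unitary_linear : forall j (a : R[i]) f g, below N j ->
    L2 m setT f -> L2 m setT g ->
    ceq mu (M j) (U j (fun x => a * f x + g x))
                 (fun lambda => a * U j f lambda + U j g lambda) ;
  unitary_isometry : forall f, L2 m setT f ->
    (\sum_(0 <= j <oo | below N j) norm2 mu (M j) (U j f))%E = norm2 m setT f ;
  unitary_surj : forall g : nat -> R -> R[i],
    (forall j, below N j -> L2 mu (M j) (g j)) ->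
    (\sum_(0 <= j <oo | below N j) norm2 mu (M j) (g j) < +oo)%E ->
    exists2 f, L2 m setT f & forall j, below N j -> ceq mu (M j) (U j f) (g j)
}.

Record ordered_spectral_representation (nu : fT -> Rmeas)
    (mu : Rmeas) (N : option nat)
    (M : nat -> set R) (U : nat -> fT -> R -> R[i]) : Prop :=
    OrderedSpectralRepresentation {
  osr_N : N != Some 0%N ;
  osr_measurable : forall j, below N j -> measurable (M j) ;
  osr_decreasing : forall j, below N j.+1 -> M j.+1 `<=` M j ;
  osr_unitary : is_unitary mu N M U ;
  osr_intertwines : forall phi f g, cmeasurable setT phi ->
    L2 m setT f -> L2 m setT g ->
    (fun_calc nu phi f g <->
     forall j, below N j ->
       ceq mu (M j) (U j g) (fun lambda => phi lambda * U j f lambda))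
}.

(* rp and rm are the weights of H_+ = L^2(rp m) and H_- = L^2(rm m). *)
Section fourier.
Variables rp rm : T -> R.
Local Notation Hp := (L2w m setT rp).
Local Notation Hm := (L2w m setT rm).

Definition Hm_open (O : set fT) : Prop :=
  forall h, Hm h -> O h -> exists2 e : R, 0 < e &
    forall h', Hm h' ->
      (wnorm2 m setT rm (fun x => (h' x - h x)%R) < e%:E)%E -> O h'.

(* s is the weak H_- -valued integral of g psi over D; it is the Bochner
   integral whenever the latter exists. *)
Definition Hm_integral (mu : Rmeas) (D : set R)
    (g : R -> R[i]) (psi : R -> fT) (s : fT) : Prop :=
  Hm s /\ forall f, Hp f ->
    let k lambda := pairing m f (fun x => g lambda * psi lambda x) in
    cintegrable mu D k /\ pairing m f s = cint mu D k.

(* F is the limit in L^2(m), as n -> N and r -> oo, of the sum over j < n of *)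
(* the integrals of g_j psi_j over M_j and (-r, r). *)
Definition expands (mu : Rmeas) (N : option nat)
    (M : nat -> set R) (psi : nat -> R -> fT) (g : nat -> R -> R[i]) (F : fT) :
    Prop :=
  forall eps : R, 0 < eps -> exists (n0 : nat) (r0 : R),
    forall (n : nat) (r : R), (n0 <= n)%N -> r0 <= r ->
    exists s : nat -> fT,
      (forall j, (j < n)%N -> below N j ->
         Hm_integral mu (M j `&` `]- r, r[) (g j) (psi j) (s j)) /\
      (let D x := (F x - \sum_(j < n | below N j) s j x)%R in
       cmeasurable setT D /\ (norm2 m setT D < eps%:E)%E).

Record fourier_expansion (H : fT -> fT -> Prop)
    (mu : Rmeas) (N : option nat)
    (M : nat -> set R) (U : nat -> fT -> R -> R[i]) (psi : nat -> R -> fT) :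
    Prop := FourierExpansion {
  fe_Hm : forall j lambda, below N j -> M j lambda -> Hm (psi j lambda) ;
  fe_measurable : forall j (O : set fT), below N j -> Hm_open O ->
    measurable (M j `&` psi j @^-1` O) ;
  fe_transform : forall j f, below N j -> Hp f ->
    ceq mu (M j) (U j f) (fun lambda => pairing m f (psi j lambda)) ;
  (* As U is unitary, U^* = U^-1, so F is U^* g. *)
  fe_inverse : forall (g : nat -> R -> R[i]) (F : fT),
    (forall j, below N j -> L2 mu (M j) (g j)) ->
    (\sum_(0 <= j <oo | below N j) norm2 mu (M j) (g j) < +oo)%E ->
    L2 m setT F -> (forall j, below N j -> ceq mu (M j) (U j F) (g j)) ->
    expands mu N M psi g F ;
  fe_expansion : forall f, L2 m setT f ->
    expands mu N M psi (fun j => U j f) f ;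
  fe_eigen : forall j, below N j ->
    {ae mu, forall lambda, M j lambda ->
      forall f h, Hp f -> Hp h -> H f h ->
        pairing m h (psi j lambda) = lambda%:C * pairing m f (psi j lambda)}
}.

End fourier.
End spectral_theory.

Section laplacian.
Context {R : realType} (N : network R).

(* The family (a e), e in S, is summable with sum s. *)
Definition has_csum (I : choiceType) (S : set I) (a : I -> R[i]) (s : R[i]) :=
  let b (part : R[i] -> R) i : R^o := if i \in S then part (a i) else 0 in
  (summability.partial_sum (b (@complex.Re R)) A @[A --> summability.totally]
     --> (complex.Re s : R^o)) /\
  (summability.partial_sum (b (@complex.Im R)) A @[A --> summability.totally]
     --> (complex.Im s : R^o)).

Definition leb : {measure set (measurableTypeR R) -> \bar R} :=
  @lebesgue_measure R.

(* For integrable u' this says that u is absolutely continuous on [0, 1] with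
   derivative u' almost everywhere. *)
Definition is_primitive (u u' : R -> R[i]) : Prop :=
  forall t, 0 <= t <= 1 -> u t = u 0 + cint leb `[0, t] u'.

(* f is in H^2(0, 1); u0 and u1 are the absolutely continuous representatives *)
(* of f and f', and u2 = f''. *)
Definition sobolev2 (f u0 u1 u2 : R -> R[i]) : Prop :=
  [/\ ceq leb `]0, 1[ f u0, is_primitive u0 u1, is_primitive u1 u2,
      L2 leb `[0, 1] u1 & L2 leb `[0, 1] u2].

(* The graph of the continuous Laplacian: F is in its domain and G = LF. *)
Definition laplacian (F G : mgraph N -> R[i]) : Prop :=
  [/\ L2 (m1 N) setT F, L2 (m1 N) setT G &
  exists u0 u1 u2 : edge N -> R -> R[i],
  [/\ forall e, sobolev2 (F \o pt e) (u0 e) (u1 e) (u2 e),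
      (\esum_(e in [set: edge N])
         ((ec e / 2)%:E * norm2 leb `]0%R, 1%R[ (u1 e)) < +oo)%E /\
      (\esum_(e in [set: edge N])
         ((ec e / 2)%:E * norm2 leb `]0%R, 1%R[ (u2 e)) < +oo)%E,
      forall e e', src e = src e' -> u0 e 0 = u0 e' 0,
      forall x, has_csum [set e | src e = x] (fun e => (ec e)%:C * u1 e 0) 0 &
      forall e, ceq leb `]0, 1[ (G \o pt e) (fun t => - u2 e t)]].

End laplacian.

Definition Phi {R : realType} (z t : R) : R :=
  if z == 0 then t else sin (z * t) / z.

(* Main.v *)
From HB Require Import structures.
From mathcomp Require Import finmap.
From mathcomp Require Import all_boot all_order all_algebra generic_quotient.
From mathcomp Require Import complex.
From mathcomp Require Import all_classical all_reals all_analysis.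
From mathcomp Require Import measurable_realfun.
From mathcomp Require showcase.summability.
From mathcomp Require Import ring lra.
Require Import Defs.

Set Implicit Arguments.
Unset Strict Implicit.
Unset Printing Implicit Defensive.

Import Order.TTheory GRing.Theory Num.Theory.
Import numFieldNormedType.Exports.
Local Open Scope classical_set_scope.
Local Open Scope ring_scope.

(** For almost every lambda the function Psi_lambda is a weak eigenfunction:
    <Lf, Psi> = lambda <f, Psi> for all f in dom L such that f and Lf lie in H_+.
    Everything about the shape of Psi is read off from this identity by
    inserting explicit real test functions f, for which it holds separately for
    the real and the imaginary part P of the conjugate of Psi.

    _Test functions_ (laplacian_lift).  Transplant one profile h on [0, 1] to all
    edges, with a coefficient k(xy) for the copy that starts at x:
    f(xy, t) = k(xy) h(t) + k(yx) h(1 - t).  If h and h' vanish at 1, then f is in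
    dom L as soon as
    - h(0) = 0, or k(xy) depends on x only (continuity at the vertices), and
    - h'(0) = 0, or the c(xy) k(xy) have sum 0 around each vertex (Kirchhoff).
    Prescribe g := h'' + z^2 h, where z^2 = lambda, and recover h by variation of
    constants from h(0) = p and h'(0) = q (osc).  The conditions at 1 become
    int cos(zt) g = -q and int Phi(z,t) g = p, and the weak equation becomes
    sum_(xy) c(xy) k(xy) int_0^1 g(t) P(xy,t) dt = 0 (test_identity).

    _Conclusions._
    - With k supported on one edge and p = q = 0, P is orthogonal on that edge to
      all g that are orthogonal to cos(zt) and Phi(z,t).  Hence
      P(xy,t) = b(xy) cos(zt) + a(xy) Phi(z,t) (edge_form), and then
      int g P = a(xy) p - b(xy) q for general p, q (coef_source).
    - With k = 1 on the edges that start at x, p = 1 and q = 0, the identity is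
      sum_y c(xy) a(xy) = 0 (kirchhoff).
    - With k = 1/c(xy) and k = -1/c(xy') on two edges that start at x, p = 0 and
      q = 1, it is b(xy) = b(xy') (vertex_continuity).
    Only the second choice has infinitely many edges in play at a vertex of
    infinite degree, and this is where the weight enters: g and h are
    supported in [0, 1/3], where w^2/c = v(x)^2 / sqrt(c(xy)), so that f and Lf are
    in H_+ because alpha(x) is finite (star_weight).  The absolute convergence of
    sum_y c(xy) a(xy) comes from pairing g with P in H_+ x H_- (coef_asum).

    _Sign of lambda._  The function cos(sqrt(lambda) t) has the intended meaning for
    lambda >= 0, so mu must not charge ]-oo, 0[.  Since mu is a spectral measure, it
    suffices that E([-s, 0[) = 0 for s > 0.  For g in the range of E([-s, 0[) put
    h := Lg.  There 0 <= s + l <= s, so |s g + h| <= s |g|; expanding the square,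
    |h|^2 + 2 s <h, g> <= 0, while <Lg, g> >= 0.  Thus h = 0, and g = 0 because l does
    not vanish on [-s, 0[ (negative_spectrum_empty).  The inequality <Lg, g> >= 0 is
    an integration by parts whose boundary terms, grouped by vertices, cancel
    (real_form_ge0). *)

(** * Almost everywhere statements and elementary inequalities *)

Section ae.
Context {R : realType} d (T : measurableType d) (mu : {measure set T -> \bar R}).
Implicit Types P Q S U : T -> Prop.

Lemma ae_mono P S : (forall t, P t -> S t) -> {ae mu, forall t, P t} -> {ae mu, forall t, S t}.
Proof. by have FF := ae_filter_ringOfSetsType mu; exact: filterS. Qed.

Lemma ae_mono2 P Q S : (forall t, P t -> Q t -> S t) ->
  {ae mu, forall t, P t} -> {ae mu, forall t, Q t} -> {ae mu, forall t, S t}.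
Proof. by have FF := ae_filter_ringOfSetsType mu; exact: filterS2. Qed.

Lemma ae_mono3 P Q S U : (forall t, P t -> Q t -> S t -> U t) ->
  {ae mu, forall t, P t} -> {ae mu, forall t, Q t} -> {ae mu, forall t, S t} ->
  {ae mu, forall t, U t}.
Proof. by have FF := ae_filter_ringOfSetsType mu; exact: filterS3. Qed.
End ae.

Section preliminaries.
Context {R : realType}.

Lemma am_gm (r x y : R) : 0 < r -> `|x * y| <= r * x ^+ 2 + r^-1 * y ^+ 2.
Proof.
move=> r0.
have h s : s ^+ 2 = 1 -> 0 <= r * x ^+ 2 + r^-1 * y ^+ 2 + 2 * (s * (x * y)).
  move=> s1; have -> : r * x ^+ 2 + r^-1 * y ^+ 2 + 2 * (s * (x * y)) = r * (x + s * (r^-1 * y)) ^+ 2.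
    by rewrite sqrrD !exprMn s1; field; rewrite gt_eqF.
  by rewrite mulr_ge0 ?sqr_ge0// ltW.
have h1 := h 1 (expr1n _ _); have h2 := h (-1) _.
rewrite sqrrN expr1n in h2; have {}h2 := h2 erefl.
by rewrite ler_norml; apply/andP; split; lra.
Qed.

Lemma measurable_funV_gt0 d (T : measurableType d) (f : T -> R) : (forall x, 0 < f x) ->
  measurable_fun setT f -> measurable_fun setT (fun x => (f x)^-1).
Proof.
move=> f0 mf; rewrite (_ : (fun x => _) = (fun x => f x `^ (-1))).
  by apply: (measurableT_comp (measurable_powR (-1))).
by apply/funext => x; rewrite powR_inv1// ltW.
Qed.

End preliminaries.

(** * Iterated integrals over a triangle *)

Section fub.
Context {R : realType}.
Local Notation leb := (@lebesgue_measure R).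
Implicit Types (f g : R -> R).

Lemma Rint_EFin (D : set R) f : measurable D -> leb.-integrable D (EFin \o f) ->
  (\int[leb]_(x in D) (f x)%:E = (\int[leb]_(x in D) f x)%:E)%E.
Proof. by move=> mD h; rewrite /Rintegral fineK// integrable_fin_num. Qed.

Lemma integrable_subT (D : set R) f : measurable D ->
  leb.-integrable setT (EFin \o f) -> leb.-integrable D (EFin \o f).
Proof. by move=> mD; apply: integrableS => //; exact: measurableT. Qed.

(** Fubini's theorem for the product f(x) g(y) cut off by a measurable set:
    the indicator of A is absorbed into the domain of the inner integral, on
    both sides. *)
Lemma Rint_fubini_set f g (A : set (R * R)) : measurable A ->
  leb.-integrable setT (EFin \o f) -> leb.-integrable setT (EFin \o g) ->
  leb.-integrable setT
    (EFin \o (fun x => f x * \int[leb]_(y in [set y | A (x, y)]) g y)) /\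
  \int[leb]_x (f x * \int[leb]_(y in [set y | A (x, y)]) g y) =
  \int[leb]_y (g y * \int[leb]_(x in [set x | A (x, y)]) f x).
Proof.
move=> mA intf intg.
have mf : measurable_fun setT f by apply/measurable_EFinP; exact: measurable_int intf.
have mg : measurable_fun setT g by apply/measurable_EFinP; exact: measurable_int intg.
pose k (z : R * R) := f z.1 * g z.2 * \1_A z.
have mk : measurable_fun setT k.
  apply: measurable_funM; last exact: measurable_indic.
  by apply: measurable_funM; exact: measurableT_comp.
have ik : (leb \x leb)%E.-integrable setT (EFin \o k).
  apply/(@integrable12ltyP _ _ _ _ R leb leb (EFin \o k)).
    exact/measurable_EFinP.
  apply: (@le_lt_trans _ _
    (\int[leb]_x ((\int[leb]_r `|g r|)%:E * `|(f x)%:E|))%E); last first.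
    rewrite integralZl//; last exact: (integrable_abse intf).
    rewrite lte_mul_pinfty// ?lee_fin ?Rintegral_ge0//.
    by move/integrableP : intf => [].
  apply: ge0_le_integral => //.
  - by move=> x _; exact: integral_ge0.
  - apply: (@measurable_fun_fubini_tonelli_F _ _ _ _ R leb (fun z => `|(k z)%:E|)%E).
      by apply/measurable_EFinP; exact: measurableT_comp.
    by move=> z.
  - apply: measurable_funeM.
    by apply/measurable_EFinP; exact: measurableT_comp.
  - move=> x _ /=.
    rewrite muleC -Rint_EFin//; last exact: (integrable_abse intg).
    rewrite -integralZl//; last exact: (integrable_abse intg).
    apply: ge0_le_integral => //.
    + by apply/measurable_EFinP/measurableT_comp => //; exact: measurableT_comp mk _.
    + apply: measurable_funeM.
      by apply/measurable_EFinP; exact: measurableT_comp.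
    + move=> y _; rewrite -EFinM lee_fin -normrM /k [leLHS]normrM ler_piMr// indicE.
      by case: (_ \in _); rewrite ?normr1 ?normr0.
have mS1 x : measurable [set y | A (x, y)].
  rewrite (_ : [set y | A (x, y)] = xsection A x); first exact: measurable_xsection.
  by apply/seteqP; split => y /=; rewrite /xsection /= inE.
have mS2 y : measurable [set x | A (x, y)].
  rewrite (_ : [set x | A (x, y)] = ysection A y); first exact: measurable_ysection.
  by apply/seteqP; split => x /=; rewrite /ysection /= inE.
have FE x : (\int[leb]_y (k (x, y))%:E =
             (f x * \int[leb]_(y in [set y | A (x, y)]) g y)%:E)%E.
  rewrite EFinM -Rint_EFin//; last exact: integrable_subT.
  rewrite [X in (_ = _ * X)%E]integral_mkcond -integralZl//; last first.
    by apply: (@integrable_mkcond _ _ _ leb _ (EFin \o g) (mS1 x)).1; exact: integrable_subT.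
  apply: eq_integral => y _; rewrite restrict_EFin /= -EFinM patchE /k indicE /=.
  have -> : (y \in [set y | A (x, y)]) = ((x, y) \in A) by apply/idP/idP; rewrite !inE.
  by case: (_ \in A); rewrite /= ?mulr1 ?mulr0.
have GE y : (\int[leb]_x (k (x, y))%:E =
             (g y * \int[leb]_(x in [set x | A (x, y)]) f x)%:E)%E.
  rewrite EFinM -Rint_EFin//; last exact: integrable_subT.
  rewrite [X in (_ = _ * X)%E]integral_mkcond -integralZl//; last first.
    by apply: (@integrable_mkcond _ _ _ leb _ (EFin \o f) (mS2 y)).1; exact: integrable_subT.
  apply: eq_integral => x _; rewrite restrict_EFin /= -EFinM patchE /k indicE /=.
  have -> : (x \in [set x | A (x, y)]) = ((x, y) \in A) by apply/idP/idP; rewrite !inE.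
  by case: (_ \in A); rewrite /= ?mulr1 ?mulr0 // mulrC.
split.
  rewrite (_ : EFin \o _ = fubini_F leb (EFin \o k)); last by apply/funext => x; rewrite /fubini_F /= FE.
  exact: integrable_fubini_F.
have := Fubini ik; rewrite /=.
under eq_integral do rewrite FE.
under [X in _ = X -> _]eq_integral do rewrite GE.
by rewrite /Rintegral => ->.
Qed.
(** The half planes y <= x and y > x partition the plane, so that the two
    iterated integrals add up to the product of the integrals; the diagonal
    is negligible. *)
Lemma Rint_diag f g :
  leb.-integrable setT (EFin \o f) -> leb.-integrable setT (EFin \o g) ->
  [/\ leb.-integrable setT
    (EFin \o (fun x => f x * \int[leb]_(y in `]-oo, x]) g y)),
    leb.-integrable setT
    (EFin \o (fun x => g x * \int[leb]_(y in `]-oo, x]) f y)) &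
  \int[leb]_x (f x * \int[leb]_(y in `]-oo, x]) g y) +
  \int[leb]_x (g x * \int[leb]_(y in `]-oo, x]) f y) =
  \int[leb]_x f x * \int[leb]_x g x].
Proof.
move=> intf intg.
have mle : measurable [set z : R * R | z.2 <= z.1].
  rewrite -[X in measurable X]setTI.
  by apply: (@measurable_fun_ler _ _ R setT snd fst _ _ measurableT [set true]).
have mlt : measurable [set z : R * R | z.1 < z.2].
  rewrite -[X in measurable X]setTI.
  by apply: (@measurable_fun_ltr _ _ R setT fst snd _ _ measurableT [set true]).
have le1 x : [set y | [set z : R * R | z.2 <= z.1] (x, y)] = `]-oo, x]%classic.
  by apply/seteqP; split => y /=; rewrite in_itv.
have lt1 x : [set y | [set z : R * R | z.1 < z.2] (x, y)] = `]x, +oo[%classic.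
  by apply/seteqP; split => y /=; rewrite in_itv /= andbT.
have lt2 y : [set x | [set z : R * R | z.1 < z.2] (x, y)] = `]-oo, y[%classic.
  by apply/seteqP; split => x /=; rewrite in_itv.
have [i1 _] := Rint_fubini_set mle intf intg.
have [i2 _] := Rint_fubini_set mle intg intf.
have [i3 e3] := Rint_fubini_set mlt intf intg.
have E1 : (fun x => f x * \int[leb]_(y in [set y | [set z : R * R | z.2 <= z.1] (x, y)]) g y) =
   (fun x => f x * \int[leb]_(y in `]-oo, x]) g y) by apply/funext => x; rewrite le1.
have E2 : (fun x => g x * \int[leb]_(y in [set y | [set z : R * R | z.2 <= z.1] (x, y)]) f y) =
   (fun x => g x * \int[leb]_(y in `]-oo, x]) f y) by apply/funext => x; rewrite le1.
have E3 : (fun x => f x * \int[leb]_(y in [set y | [set z : R * R | z.1 < z.2] (x, y)]) g y) =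
   (fun x => f x * \int[leb]_(y in `]x, +oo[) g y) by apply/funext => x; rewrite lt1.
have E4 : (fun y => g y * \int[leb]_(x in [set x | [set z : R * R | z.1 < z.2] (x, y)]) f x) =
   (fun x => g x * \int[leb]_(y in `]-oo, x]) f y).
  apply/funext => x; rewrite lt2 Rintegral_itv_bndo_bndc//.
  exact: integrable_subT.
rewrite E1 in i1; rewrite E2 in i2; rewrite E3 in i3; rewrite E3 E4 in e3.
split => //; rewrite -e3 -RintegralD//.
rewrite -RintegralZr//; apply: eq_Rintegral => x _.
rewrite -mulrDr; congr (_ * _); rewrite -Rintegral_setU//.
- by rewrite (@itv_setU_setT _ R false x).
- by apply: integrable_subT => //; exact: measurableU.
- apply/disj_set2P; apply/seteqP; split => // y /=; rewrite !in_itv /= andbT => -[yx].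
  by rewrite ltNge yx.
Qed.

(** This is integration by parts for the primitives of f and g that vanish
    at 0, with no continuity assumption on f and g. *)
Lemma Rint_tri (t : R) f g :
  leb.-integrable `[0, t] (EFin \o f) -> leb.-integrable `[0, t] (EFin \o g) ->
  \int[leb]_(x in `[0, t]) (f x * \int[leb]_(y in `[0, x]) g y) +
  \int[leb]_(x in `[0, t]) (g x * \int[leb]_(y in `[0, x]) f y) =
  \int[leb]_(x in `[0, t]) f x * \int[leb]_(x in `[0, t]) g x.
Proof.
move=> intf intg.
have ext (h : R -> R) : leb.-integrable `[0, t] (EFin \o h) ->
    leb.-integrable setT (EFin \o (h \_ `[0, t])).
  by move=> ih; rewrite -restrict_EFin; apply: (@integrable_mkcond _ _ _ leb _ (EFin \o h) _).1.
have cut (h : R -> R) (x : R) : `[0, t]%classic x ->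
    \int[leb]_(y in `]-oo, x]) (h \_ `[0, t]) y = \int[leb]_(y in `[0, x]) h y.
  rewrite /= in_itv /= => /andP[x0 xt]; rewrite -Rintegral_mkcondr; congr Rintegral.
  apply/seteqP; split => y /=; rewrite !in_itv /=.
    by move=> [yx /andP[-> _]].
  by move=> /andP[y0 yx]; rewrite yx y0 (le_trans yx).
have tri (h k : R -> R) : \int[leb]_x ((h \_ `[0, t]) x * \int[leb]_(y in `]-oo, x]) (k \_ `[0, t]) y) =
    \int[leb]_(x in `[0, t]) (h x * \int[leb]_(y in `[0, x]) k y).
  rewrite [RHS]Rintegral_mkcond; apply: eq_Rintegral => x _.
  rewrite patchE [RHS]patchE; case: ifPn => [/set_mem xt|_]; last exact: mul0r.
  by rewrite cut.
have [_ _] := Rint_diag (ext _ intf) (ext _ intg).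
by rewrite !tri -!Rintegral_mkcond.
Qed.

End fub.

(** * Absolutely continuous functions on the unit interval *)

Section prim.
Context {R : realType}.
Local Notation leb := (@lebesgue_measure R).
Implicit Types (u v f g : R -> R).

(** The real counterpart of [is_primitive], together with the integrability
    of u', without which the integrals of u' are junk values. *)
Definition prim u u' := leb.-integrable `[0, 1] (EFin \o u') /\
  forall t, 0 <= t <= 1 -> u t = u 0 + \int[leb]_(s in `[0, t]) u' s.

Lemma integrable_0t f t : 0 <= t <= 1 ->
  leb.-integrable `[0, 1] (EFin \o f) -> leb.-integrable `[0, t] (EFin \o f).
Proof.
move=> /andP[t0 t1]; apply: integrableS => //.
by apply: subset_itvl; rewrite bnd_simp.
Qed.

Lemma prim_continuous u u' : prim u u' -> {within `[0, 1], continuous u}.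
Proof.
move=> [iu uE].
have := @subspace_eq_continuous R `[0, 1] R
  (fun t => u 0 + \int[leb]_(s in `[0, t]) u' s) u; apply.
  by move=> t /set_mem /=; rewrite in_itv /= => /uE.
move=> x; apply: cvgD; first exact: cvg_cst.
exact: (parameterized_integral_continuous ler01 iu).
Qed.

Lemma prim_measurable u u' : prim u u' -> measurable_fun (`[0, 1]%classic : set R) u.
Proof.
by move=> /prim_continuous ?; apply: subspace_continuous_measurable_fun.
Qed.

Lemma prim_bounded u u' : prim u u' -> [bounded u x | x in `[0, 1]].
Proof.
move=> /prim_continuous cu.
have /compact_bounded[M [_ mrt]] := continuous_compact cu (@segment_compact R 0 1).
by exists M; split; rewrite ?num_real // => ? ? ? ?; exact: mrt.
Qed.

Lemma prim_integrableM u u' f : prim u u' ->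
  leb.-integrable `[0, 1] (EFin \o f) ->
  leb.-integrable `[0, 1] (EFin \o (fun t => f t * u t)).
Proof.
move=> pu fi.
have := @integrableMl _ _ _ leb `[0, 1] _ (EFin \o f) u fi (prim_measurable pu) (prim_bounded pu).
exact.
Qed.

Lemma prim_integrable u u' : prim u u' -> leb.-integrable `[0, 1] (EFin \o u).
Proof.
move=> pu; apply: continuous_compact_integrable; first exact: segment_compact.
exact: prim_continuous pu.
Qed.

(** The product rule reduces to [Rint_tri], as u and v differ from the
    integrals of u' and v' by the constants u(0) and v(0). *)
Lemma primM u u' v v' : prim u u' -> prim v v' ->
  prim (fun t => u t * v t) (fun t => u' t * v t + v' t * u t).
Proof.
move=> pu pv; have [iu uE] := pu; have [iv vE] := pv.
have i1 := prim_integrableM pv iu; have i2 := prim_integrableM pu iv.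
split; first by have := integrableD _ i1 i2; exact.
move=> t t01; have st := integrable_0t t01.
rewrite RintegralD//; [|exact: st..].
have := Rint_tri (st _ iu) (st _ iv).
have E w w' c : prim w w' -> leb.-integrable `[0, 1] (EFin \o c) ->
    \int[leb]_(x in `[0, t]) (c x * \int[leb]_(y in `[0, x]) w' y) =
    \int[leb]_(x in `[0, t]) (c x * w x) - w 0 * \int[leb]_(x in `[0, t]) c x.
  move=> pw ic; rewrite -RintegralZl//; last exact: st.
  rewrite -RintegralB//.
  - apply: eq_Rintegral => x /set_mem /=; rewrite in_itv /= => /andP[x0 xt].
    have x01 : 0 <= x <= 1 by rewrite x0 (le_trans xt)//; case/andP: t01.
    by rewrite [w x]pw.2//; ring.
  - exact: st (prim_integrableM pw ic).
  - by apply: st; have := @integrableZl _ _ _ leb `[0, 1] _ (w 0) _ ic; exact.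
rewrite (E v v')// (E u u')//.
have := uE t t01; have := vE t t01.
by move=> -> -> H; rewrite mulrDl !mulrDr -H; ring.
Qed.

Lemma primD u u' v v' : prim u u' -> prim v v' ->
  prim (fun t => u t + v t) (fun t => u' t + v' t).
Proof.
move=> [iu uE] [iv vE]; split; first by have := integrableD _ iu iv; exact.
move=> t t01; rewrite RintegralD//; [|exact: integrable_0t..].
by rewrite uE// vE//; ring.
Qed.

Lemma primZ (c : R) u u' : prim u u' -> prim (fun t => c * u t) (fun t => c * u' t).
Proof.
move=> [iu uE]; split.
  by have := @integrableZl _ _ _ leb `[0, 1] _ c _ iu; exact.
move=> t t01; rewrite RintegralZl//; last exact: integrable_0t.
by rewrite uE//; ring.
Qed.

Lemma primB u u' v v' : prim u u' -> prim v v' ->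
  prim (fun t => u t - v t) (fun t => u' t - v' t).
Proof.
move=> pu pv; have := primD pu (primZ (-1) pv).
by congr prim; apply/funext => t; rewrite mulN1r.
Qed.

Lemma prim_C1 f g : (forall x, is_derive x (1 : R) f (g x)) -> continuous g -> prim f g.
Proof.
move=> df cg; split.
  apply: continuous_compact_integrable; first exact: segment_compact.
  exact: continuous_subspaceT.
move=> t /andP[]; rewrite le_eqVlt => /predU1P[<- _|t0 t1].
  by rewrite set_itv1 Rintegral_set1 addr0.
rewrite /Rintegral (@continuous_FTC2 _ g f)//=.
- by rewrite addrCA subrr addr0.
- exact: continuous_subspaceT.
- split.
  + by move=> x _; have [] := df x.
  + apply: cvg_at_right_filter; apply: differentiable_continuous.
    by apply/derivable1_diffP; have [] := df 0.
  + apply: cvg_at_left_filter; apply: differentiable_continuous.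
    by apply/derivable1_diffP; have [] := df t.
- by move=> x _; rewrite derive1E; have [_ ->] := df x.
Qed.

Lemma ae01_exists (P : R -> Prop) :
  {ae leb, forall t, `[0, 1]%classic t -> P t} -> exists2 t, 0 <= t <= 1 & P t.
Proof.
move=> [A [mA A0 sub]]; apply: contrapT => nP.
have : (leb `[0%R, 1%R] <= leb A)%E.
  apply: le_measure; rewrite ?inE//.
  move=> t t01; apply: sub => /= Pt; apply: nP.
  by exists t; [move: t01; rewrite /= in_itv|exact: Pt].
by rewrite A0 lebesgue_measure_itv /= lte_fin ltr01 oppr0 adde0 lee_fin ler10.
Qed.

(** As u * u is a primitive of 2 u u', which vanishes almost everywhere, it
    is constant, and u vanishes somewhere. *)
Lemma prim_ae0 u u' : prim u u' ->
  {ae leb, forall t, `[0, 1]%classic t -> u t = 0} ->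
  forall t, 0 <= t <= 1 -> u t = 0.
Proof.
move=> pu u0.
(* u^2 is constant. *)
have puu := primM pu pu.
have E t : 0 <= t <= 1 -> u t * u t = u 0 * u 0.
  move=> t01; rewrite puu.2// [X in _ + X](_ : _ = 0) ?addr0//.
  rewrite /Rintegral (_ : (\int[_]_(x in _) _)%E = \int[leb]_(x in `[0%R, t]) (cst 0 x))%E.
    by rewrite integral_cst//= mul0e.
  apply: ae_eq_integral => //.
    by apply: measurable_int; exact: (integrable_0t t01 puu.1).
  have [A [mA A0 sub]] := u0; exists A; split => // x Ax; apply: sub => Px.
  apply: Ax => /= xt; rewrite Px ?mulr0 ?addr0//.
  move: xt; rewrite /= !in_itv /= => /andP[-> xt]; rewrite (le_trans xt)//.
  by case/andP: t01.
have [s s01 us] := ae01_exists u0.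
move=> t t01; have := E _ t01; rewrite -(E _ s01) us mulr0 => /eqP.
by rewrite mulf_eq0 orbb => /eqP.
Qed.

Lemma Rint_sqr_eq0 f : measurable_fun (`[0, 1]%classic : set R) f ->
  leb.-integrable `[0, 1] (EFin \o (fun t => f t * f t)) ->
  \int[leb]_(t in `[0, 1]) (f t * f t) = 0 ->
  {ae leb, forall t, `[0, 1]%classic t -> f t = 0}.
Proof.
move=> mf i0 I0.
have /(ae_eq_integral_abs leb (measurable_itv `[0%R, 1%R])) : (\int[leb]_(t in `[0%R, 1%R]) `|(f t * f t)%:E| = 0)%E.
  under eq_integral do rewrite /= ger0_norm -?expr2 ?sqr_ge0// expr2.
  by rewrite Rint_EFin// I0.
case=> [|A [mA A0 sub]].
  exact: measurable_int i0.
exists A; split => // t At; apply: sub => H; apply: At => /= t01.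
by have := H t01 => -[] /eqP; rewrite mulf_eq0 orbb => /eqP.
Qed.

(** Evaluate at 1 the primitive u u' of u' u' + u'' u: as u = 0, the
    integral of u'^2 is 0. *)
Lemma prim0_deriv u u' u'' : prim u u' -> prim u' u'' ->
  (forall t, 0 <= t <= 1 -> u t = 0) -> forall t, 0 <= t <= 1 -> u' t = 0.
Proof.
move=> pu pu' u0.
apply: prim_ae0 (pu') _; apply: Rint_sqr_eq0.
- exact: prim_measurable pu'.
- exact: (prim_integrable (primM pu' pu')).
- have p := primM pu pu'.
  have := p.2 1; rewrite lexx ler01 => /(_ isT).
  rewrite !u0 ?lexx ?ler01// !mul0r add0r => H; rewrite [RHS]H.
  apply: eq_Rintegral => t /set_mem /=; rewrite in_itv /= => t01.
  by rewrite u0// mulr0 addr0.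
Qed.

(** The reflection x |-> 1 - x maps half-open intervals to half-open
    intervals of the same length, so it preserves Lebesgue measure. *)
Lemma ge0_integral_onem (D : set R) (g : R -> \bar R) : measurable D ->
  measurable_fun D g -> (forall x, 0 <= g x)%E ->
  (\int[leb]_(x in D) g x = \int[leb]_(x in [set x | D (1 - x)%R]) g (1 - x)%R)%E.
Proof.
move=> mD mg g0.
pose phi : measurableTypeR R -> measurableTypeR R := fun x => (1 - (x : R)).
have mphi : measurable_fun setT phi.
  have H : measurable_fun setT (fun x : R => 1 - x) by exact: measurable_funB.
  exact: H.
pose mix := isMeasurableFun.Build _ _ _ _ _ mphi.
pose ph : {mfun (measurableTypeR R) >-> (measurableTypeR R)} := HB.pack phi mix.
have E A : measurable A -> leb A = pushforward leb phi A.
  move=> mA; apply: (@lebesgue_measure_unique R (pushforward leb ph) _ A mA).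
  move=> _ [[a b]] _ <- /=; rewrite /pushforward.
  rewrite (_ : phi @^-1` _ = `[1 - b, 1 - a[%classic); last first.
    apply/seteqP; split => x /=; rewrite /phi !in_itv /=; lra.
  rewrite !lebesgue_measure_itv/= !lte_fin.
  have -> : (1 - b < 1 - a) = (a < b) by apply/idP/idP; lra.
  by case: ifP => // _; rewrite -!EFinD; congr EFin; lra.
rewrite (@eq_measure_integral _ _ _ _ (pushforward leb ph)); last first.
  by move=> A mA _; exact: E.
by rewrite ge0_integral_pushforward.
Qed.

Lemma Rint_onem (D : set R) (f : R -> R) : measurable D -> measurable_fun D f ->
  \int[leb]_(x in D) f x = \int[leb]_(x in [set x | D (1 - x)]) f (1 - x).
Proof.
move=> mD mf; rewrite /Rintegral; congr fine.
rewrite integralE [RHS]integralE; congr (_ - _)%E.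
- etransitivity; first (apply: (ge0_integral_onem (g := ((EFin \o f)^\+)%E)) => //; exact/measurable_funepos/measurable_EFinP).
  by apply: eq_integral => x _; rewrite !funeposE.
- etransitivity; first (apply: (ge0_integral_onem (g := ((EFin \o f)^\-)%E)) => //; exact/measurable_funeneg/measurable_EFinP).
  by apply: eq_integral => x _; rewrite !funenegE.
Qed.

End prim.

(** * Square integrable functions on the unit interval *)

Section sqi.
Context {R : realType}.
Local Notation leb := (@lebesgue_measure R).
Local Notation I01 := (`[0, 1]%classic : set R).
Local Notation intg f := (leb.-integrable I01 (EFin \o f)).
Implicit Types (u v f g : R -> R).

Lemma intgD f g : intg f -> intg g -> intg (fun t => f t + g t).
Proof. by move=> fi gi; have := integrableD _ fi gi; exact. Qed.

Lemma intgZ (c : R) f : intg f -> intg (fun t => c * f t).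
Proof. by move=> fi; have := @integrableZl _ _ _ leb I01 _ c _ fi; exact. Qed.

Lemma intgN f : intg f -> intg (fun t => - f t).
Proof. by move=> fi; have := integrableN fi; exact. Qed.

Lemma onem_I01 : [set x : R | I01 (1 - x)] = I01.
Proof. by apply/seteqP; split => x /=; rewrite !in_itv /=; lra. Qed.

Lemma measurable_onem f : measurable_fun I01 f -> measurable_fun I01 (fun x => f (1 - x)).
Proof.
move=> mf; apply: (@measurable_comp _ _ _ _ _ _ I01 f _ (fun x : R => 1 - x)) => //.
  by move=> _ [x /=] /[!in_itv] /= h <-; lra.
exact: measurable_funB.
Qed.

Lemma measurable_setonem (D : set R) : measurable D -> measurable [set t : R | D (1 - t)].
Proof.
move=> mD; have mphi : measurable_fun setT (fun t : R => 1 - t) by exact: measurable_funB.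
by have := mphi measurableT _ mD; rewrite setTI.
Qed.

Lemma leb_onem (D : set R) : measurable D -> leb [set t : R | D (1 - t)] = leb D.
Proof.
move=> mD; have mD' := measurable_setonem mD.
have := @ge0_integral_onem R D (cst 1%E) mD (measurable_cst _) (fun=> lee01).
by rewrite !integral_cst ?mul1e.
Qed.

Lemma ae_onem (Q : R -> Prop) : {ae leb, forall t, Q t} -> {ae leb, forall t, Q (1 - t)}.
Proof.
move=> [A [mA A0 sub]]; exists [set t : R | A (1 - t)]; split.
- exact: measurable_setonem.
- exact: etrans (leb_onem mA) A0.
- by move=> t /= h; apply: sub => h'; apply: h.
Qed.

Lemma integrable_onem f : intg f -> intg (fun x => f (1 - x)).
Proof.
move=> /integrableP[/measurable_EFinP mf fi]; apply/integrableP; split.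
  by apply/measurable_EFinP; apply: measurable_onem; exact: mf.
have := @ge0_integral_onem R I01 (fun x => `|(f x)%:E|%E) _ _ _.
rewrite onem_I01 => <- //.
by apply/measurable_EFinP; exact: measurableT_comp.
Qed.

Lemma prim_onem u u' : prim u u' -> prim (fun t => u (1 - t)) (fun t => - u' (1 - t)).
Proof.
move=> [iu uE].
have iu' : intg (fun t => - u' (1 - t)).
  exact: intgN (integrable_onem iu).
split => // t t01.
have t01' : 0 <= 1 - t <= 1 by lra.
rewrite subr0 (uE (1 - t)) // (uE 1) ?lexx ?ler01//.
have -> : \int[leb]_(s in `[0, t]) (- u' (1 - s)) = - \int[leb]_(s in `]1 - t, 1]) u' s.
  rewrite [in RHS](@Rint_onem _ `]1 - t, 1]%classic)//; last first.
    have /measurable_EFinP mu' := measurable_int _ iu.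
    apply: (measurable_funS (measurable_itv _) _ mu') => x /=.
    by rewrite !in_itv /=; lra.
  have -> : [set x | `]1 - t, 1]%classic (1 - x)] = `[0, t[%classic.
    by apply/seteqP; split => x /=; rewrite !in_itv /=; lra.
  have iN : leb.-integrable `[0, t] (EFin \o (fun s => u' (1 - s))).
    by apply: integrable_0t => //; exact: integrable_onem.
  rewrite Rintegral_itv_bndo_bndc; last first.
    by apply: integrableS iN => //; apply: subset_itv_co_cc.
  by rewrite -mulN1r -RintegralZl//; apply: eq_Rintegral => s _; rewrite mulN1r.
have := @Rintegral_itvB R u' (BLeft 0) (BRight 1) (1 - t) iu.
rewrite !bnd_simp => <-; [lra|lra..].
Qed.

Definition sqi f := measurable_fun I01 f /\ intg (fun t => f t * f t).

Lemma sqiM f g : sqi f -> sqi g -> intg (fun t => f t * g t).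
Proof.
move=> [mf f2] [mg g2].
have i : intg (fun t => f t * f t + g t * g t) by exact: intgD f2 g2.
apply: le_integrable i => //.
  by apply/measurable_EFinP/measurable_funM.
move=> t _ /=; rewrite lee_fin; apply: le_trans (ler_norm _).
by rewrite ler_norml; nra.
Qed.

Lemma intg_cst (c : R) : intg (cst c).
Proof.
apply: continuous_compact_integrable; first exact: segment_compact.
by apply: continuous_subspaceT => ?; exact: cst_continuous.
Qed.

Lemma sqi_cst (c : R) : sqi (cst c).
Proof. by split => //; exact: (intg_cst (c * c)). Qed.

Lemma sqi_intg f : sqi f -> intg f.
Proof.
move=> sf; have := sqiM sf (sqi_cst 1).
by rewrite (_ : (fun t => f t * cst 1 t) = f)//; apply/funext => t; rewrite /= mulr1.
Qed.

Lemma sqiD f g : sqi f -> sqi g -> sqi (fun t => f t + g t).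
Proof.
move=> sf sg; split; first by apply: measurable_funD; [exact: sf.1|exact: sg.1].
have := sqiM sf sg => fg.
have := intgD (intgD sf.2 sg.2) (intgD fg fg).
by congr (is_true (integrable _ _ _)); apply/funext => t /=; congr EFin; ring.
Qed.

Lemma prim_sqi u u' : prim u u' -> sqi u.
Proof.
move=> pu; split; first exact: prim_measurable pu.
exact: prim_integrable (primM pu pu).
Qed.

Lemma sqiZ (c : R) f : sqi f -> sqi (fun t => c * f t).
Proof.
move=> sf; split; first by apply: measurable_funM => //; exact: sf.1.
have := intgZ (c * c) sf.2.
by congr (is_true (integrable _ _ _)); apply/funext => t /=; congr EFin; ring.
Qed.

Lemma sqiB f g : sqi f -> sqi g -> sqi (fun t => f t - g t).
Proof.
move=> sf /(sqiZ (-1)) sg; have := sqiD sf sg.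
by congr sqi; apply/funext => t; rewrite mulN1r.
Qed.

Lemma sqi_onem f : sqi f -> sqi (fun t => f (1 - t)).
Proof. by move=> [mf f2]; split; [exact: measurable_onem|exact: (integrable_onem f2)]. Qed.

Lemma Rint_onem01 f : measurable_fun I01 f ->
  \int[leb]_(x in I01) f (1 - x) = \int[leb]_(x in I01) f x.
Proof. by move=> mf; rewrite [RHS]Rint_onem// onem_I01. Qed.

Lemma prim_id : prim (@id R) (cst 1).
Proof. by apply: prim_C1 => //; move=> x; exact: cst_continuous. Qed.

Lemma prim_cst (c : R) : prim (cst c) (cst 0).
Proof. by apply: prim_C1 => //; move=> x; exact: cst_continuous. Qed.

(** Integrate the derivative of (1 - t) u(t)^2 from 0 to 1 and use 2 (1 - t)
    u u' >= - u^2 - (1 - t)^2 u'^2. *)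
Lemma trace_bound u u' : prim u u' -> sqi u' ->
  u 0 * u 0 <= 2 * \int[leb]_(t in I01) (u t * u t) + \int[leb]_(t in I01) (u' t * u' t).
Proof.
move=> pu su'.
have su := prim_sqi pu.
have p := primM (primM pu pu) (primB (prim_cst 1) prim_id).
have := p.2 1; rewrite lexx ler01 => /(_ isT); rewrite /= subrr mulr0 subr0 mulr1 => /esym/eqP.
rewrite addr_eq0 => /eqP ->.
rewrite -mulN1r -RintegralZl//; last exact: p.1.
have i2 : intg (fun t => 2 * (u t * u t)).
  exact: intgZ su.2.
rewrite -[X in _ <= X + _]RintegralZl//; last exact: su.2.
rewrite -RintegralD//; last exact: su'.2.
apply: le_Rintegral => //.
- exact: intgZ p.1.
- exact: intgD i2 su'.2.
- move=> t /=; rewrite in_itv /= => /andP[t0 t1].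
  set a := u t; set b := u' t.
  have := sqr_ge0 (a + (1 - t) * b); rewrite expr2 => h1.
  have h2 : 0 <= (b * b) * (t * (2 - t)) by apply: mulr_ge0; [nra|nra].
  nra.
Qed.

End sqi.

(** * The equation y'' + z^2 y = g on the unit interval *)

Section oscillator.
Context {R : realType}.
Local Notation leb := (@lebesgue_measure R).
Local Notation I01 := (`[0, 1]%classic : set R).
Local Notation intg f := (leb.-integrable I01 (EFin \o f)).
Definition cosz (z t : R) := cos (z * t).
Variable z : R.
Local Notation C := (cosz z).
Local Notation S := (Phi z).

Lemma is_derive_lin (x : R) : is_derive x 1 (fun t : R => z * t) z.
Proof.
have := is_deriveM (is_derive_cst z x 1) (is_derive_id x (1 : R)).
by rewrite scaler0 addr0 /GRing.scale /= mulr1; exact.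
Qed.

Lemma is_derive_cosz (x : R) : is_derive x 1 C (- (z ^+ 2 * S x)).
Proof.
have h : is_derive x 1 C (- sin (z * x) * z).
  exact: (is_derive1_comp (is_derive_cos _) (is_derive_lin x)).
apply: is_derive_eq; rewrite /Phi; case: eqP => [->|/eqP z0].
  by rewrite mulr0 expr0n mul0r oppr0.
by field.
Qed.

Lemma is_derive_Phi (x : R) : is_derive x 1 S (C x).
Proof.
rewrite /Phi /cosz; case: eqP => [->|/eqP z0].
  by rewrite mul0r cos0; exact: is_derive_id.
have h : is_derive x 1 (fun t => sin (z * t)) (cos (z * x) * z).
  exact: (is_derive1_comp (is_derive_sin _) (is_derive_lin x)).
have h2 := is_deriveM h (is_derive_cst (z^-1) x 1).
have -> : cos (z * x) = sin (z * x) *: 0 + cst z^-1 x *: (cos (z * x) * z).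
  by rewrite scaler0 add0r /GRing.scale /=; field.
exact: h2.
Qed.

Lemma continuous_cosz : continuous C.
Proof.
move=> x; apply: differentiable_continuous; apply/derivable1_diffP.
by have [] := is_derive_cosz x.
Qed.

Lemma continuous_Phi : continuous S.
Proof.
move=> x; apply: differentiable_continuous; apply/derivable1_diffP.
by have [] := is_derive_Phi x.
Qed.

Lemma prim_Phi : prim S C.
Proof. by apply: prim_C1; [exact: is_derive_Phi|exact: continuous_cosz]. Qed.

Lemma prim_cosz : prim C (fun t => - (z ^+ 2 * S t)).
Proof.
apply: prim_C1; first exact: is_derive_cosz.
by move=> x; apply: cvgN; apply: cvgMr; exact: continuous_Phi.
Qed.

Lemma Phi0 : S 0 = 0.
Proof. by rewrite /Phi mulr0 sin0 mul0r; case: ifP. Qed.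

Lemma cosz0 : C 0 = 1.
Proof. by rewrite /cosz mulr0 cos0. Qed.

Lemma cosz2DPhi2 (t : R) : C t ^+ 2 + z ^+ 2 * S t ^+ 2 = 1.
Proof.
rewrite -(cos2Dsin2 (z * t)) /Phi; congr (_ + _); case: eqP => [->|/eqP z0].
  by rewrite mul0r sin0 !expr0n /= mul0r.
by rewrite -exprMn mulrCA divff// mulr1.
Qed.

(** The solution of y'' + z^2 y = g with y(0) = p and y'(0) = q, by
    variation of constants; [osc1] is its derivative. *)
Definition osc (p q : R) (g : R -> R) t :=
  S t * (q + \int[leb]_(s in `[0, t]) (C s * g s)) +
  C t * (p - \int[leb]_(s in `[0, t]) (S s * g s)).
Definition osc1 (p q : R) (g : R -> R) t :=
  C t * (q + \int[leb]_(s in `[0, t]) (C s * g s)) -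
  z ^+ 2 * S t * (p - \int[leb]_(s in `[0, t]) (S s * g s)).

Lemma prim_osc p q g : sqi g ->
  prim (osc p q g) (osc1 p q g) /\
  prim (osc1 p q g) (fun t => g t - z ^+ 2 * osc p q g t).
Proof.
move=> sg; have ig := sqi_intg sg.
have pr (u u' : R -> R) c : prim u u' -> prim (fun t => c + \int[leb]_(s in `[0, t]) (u s * g s)) (fun t => u t * g t).
  move=> pu; split.
    have := prim_integrableM pu ig; congr (is_true (integrable _ _ _)).
    by apply/funext => t /=; rewrite mulrC.
  by move=> t t01; rewrite set_itv1 Rintegral_set1 addr0.
(* The bracketed factors in [osc] are primitives of cos(zt) g and Phi(z,t) g. *)
have pA := pr _ _ q prim_cosz.
have pB := primZ (-1) (pr _ _ (- p) prim_Phi).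
have := primD (primM prim_Phi pA) (primM prim_cosz pB).
have := primB (primM prim_cosz pA) (primM (primZ (z ^+ 2) prim_Phi) pB).
move=> p1 p0; split.
- congr (prim _ _) : p0; apply/funext => t; rewrite /osc /osc1; ring.
- congr (prim _ _) : p1; apply/funext => t; rewrite /osc /osc1; first ring.
  have := cosz2DPhi2 t; set c := C t; set s := S t => h.
  have hc : c * c = 1 - z ^+ 2 * s ^+ 2 by rewrite -h; ring.
  rewrite (mulrAC c) hc; ring.
Qed.

Lemma osc_init p q g : osc p q g 0 = p.
Proof. by rewrite /osc Phi0 cosz0 set_itv1 !Rintegral_set1; ring. Qed.

Lemma osc1_init p q g : osc1 p q g 0 = q.
Proof. by rewrite /osc1 Phi0 cosz0 set_itv1 !Rintegral_set1; ring. Qed.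

(** By variation of constants the Cauchy data vanish at t exactly when the
    coefficients of both fundamental solutions do. *)
Lemma osc_end p q g t :
  \int[leb]_(s in `[0, t]) (C s * g s) = - q ->
  \int[leb]_(s in `[0, t]) (S s * g s) = p ->
  osc p q g t = 0 /\ osc1 p q g t = 0.
Proof. by rewrite /osc /osc1 => -> ->; split; ring. Qed.

Definition cubic (a b c d : R) (t : R) := a + t * (b + t * (c + t * d)).

Lemma is_derive_cubic a b c d (x : R) :
  is_derive x 1 (cubic a b c d) (cubic b (2 * c) (3 * d) 0 x).
Proof.
have L (u : R -> R) (u' e : R) : is_derive x 1 u u' ->
   is_derive x 1 (fun t => e + t * u t) (x * u' + u x).
  move=> h; have := is_deriveD (is_derive_cst e x 1) (is_deriveM (is_derive_id x (1 : R)) h).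
  by rewrite add0r /GRing.scale /= mulr1.
have h := L _ _ a (L _ _ b (L _ _ c (is_derive_cst d x 1))).
by apply: (@is_derive_eq _ _ _ _ _ _ _ _ h); rewrite /cubic /cst; ring.
Qed.

Lemma continuous_cubic a b c d : continuous (cubic a b c d).
Proof.
move=> x; apply: differentiable_continuous; apply/derivable1_diffP.
by have [] := is_derive_cubic a b c d x.
Qed.

Lemma prim_cubic a b c d : prim (cubic a b c d) (cubic b (2 * c) (3 * d) 0).
Proof. by apply: prim_C1; [exact: is_derive_cubic|exact: continuous_cubic]. Qed.

(** Take g := y'' + z^2 y on [0, 1/3] for the cubic polynomial y with y(0) =
    p, y'(0) = q and y(1/3) = y'(1/3) = 0.  The two integrals are then the
    boundary terms in Green's formula for y against cos(zt) and Phi(z,t). *)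
Lemma source_exists (p q : R) : exists g : R -> R,
  [/\ sqi g, forall t, 3^-1 < t -> g t = 0,
    \int[leb]_(s in I01) (C s * g s) = - q &
    \int[leb]_(s in I01) (S s * g s) = p].
Proof.
(* The cubic Hermite interpolant with a double zero at 1/3. *)
pose c := - 27 * p - 6 * q; pose d := 54 * p + 9 * q.
pose y := cubic p q c d; pose y1 := cubic q (2 * c) (3 * d) 0.
pose y2 := cubic (2 * c) (2 * (3 * d)) (3 * 0) 0.
have py : prim y y1 by exact: prim_cubic.
have py1 : prim y1 y2 by exact: prim_cubic.
pose f t := y2 t + z ^+ 2 * y t.
have pf := primD (prim_cubic (2 * c) (2 * (3 * d)) (3 * 0) 0) (primZ (z ^+ 2) py).
pose g := f \_ `]-oo, 3^-1].
have h2 : 0 <= (3^-1 : R) <= 1 by lra.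
have sf : sqi f by exact: prim_sqi pf.
have E u : \int[leb]_(s in I01) (u s * g s) = \int[leb]_(s in `[0, 3^-1]) (u s * f s).
  have -> : `[0, 3^-1]%classic = I01 `&` `]-oo, 3^-1]%classic :> set R.
    by apply/seteqP; split => x /=; rewrite !in_itv /=; lra.
  rewrite Rintegral_mkcondr; apply: eq_Rintegral => x _.
  by rewrite /g !patchE; case: ifP => // _; rewrite /= mulr0.
have yh : y 3^-1 = 0 by rewrite /y /cubic /c /d; field.
have y1h : y1 3^-1 = 0 by rewrite /y1 /cubic /c /d; field.
have y0 : y 0 = p by rewrite /y /cubic; ring.
have y10 : y1 0 = q by rewrite /y1 /cubic; ring.
exists g; split.
- have mg : measurable_fun I01 g.
    have mc a' b' c' d' := continuous_measurable_fun (@continuous_cubic a' b' c' d').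
    have mf : measurable_fun setT f.
      by apply: measurable_funD; [exact: mc|apply: measurable_funM => //; exact: mc].
    apply: measurable_funTS; apply/(measurable_restrictT f) => //.
    exact: measurable_funTS.
  split => //; apply: le_integrable sf.2 => //.
    by apply/measurable_EFinP; exact: measurable_funM.
  move=> t _ /=; rewrite lee_fin /g !patchE; case: ifP => // _.
  by rewrite /= mulr0 normr0.
- move=> t ht; rewrite /g patchE ifF//; apply/negP => /set_mem /=.
  by rewrite in_itv /= leNgt ht.
- rewrite E.
  have p1 := primD (primM py1 prim_cosz) (primZ (z ^+ 2) (primM py prim_Phi)).
  have := p1.2 _ h2; rewrite yh y1h Phi0 cosz0 y10.
  rewrite (_ : \int[leb]_(s in `[0, 3^-1]) (C s * f s) = \int[leb]_(s in `[0, 3^-1]) (y2 s * C s + - (z ^+ 2 * S s) * y1 s +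
      z ^+ 2 * (y1 s * S s + C s * y s))); last first.
    by apply: eq_Rintegral => s _; rewrite /f; ring.
  move=> h; lra.
- rewrite E.
  have p1 := primB (primM py1 prim_Phi) (primM py prim_cosz).
  have := p1.2 _ h2; rewrite yh y1h Phi0 cosz0 y0.
  rewrite (_ : \int[leb]_(s in `[0, 3^-1]) (S s * f s) = \int[leb]_(s in `[0, 3^-1]) (y2 s * S s + C s * y1 s -
      (y1 s * C s + - (z ^+ 2 * S s) * y s))); last first.
    by apply: eq_Rintegral => s _; rewrite /f; ring.
  move=> h; lra.
Qed.

(** The sources of [source_exists] with data (1, 0) and (0, 1) are dual to
    the two solutions.  Subtracting a combination of them makes any g
    admissible in the hypothesis, which shows that P minus a combination of
    the solutions is orthogonal to every g, hence to itself. *)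
Lemma orthogonal_osc (P : R -> R) : sqi P ->
  (forall g, sqi g -> \int[leb]_(s in I01) (C s * g s) = 0 ->
     \int[leb]_(s in I01) (S s * g s) = 0 -> \int[leb]_(s in I01) (g s * P s) = 0) ->
  exists b a : R, {ae leb, forall t, I01 t -> P t = b * C t + a * S t}.
Proof.
move=> sP H.
have [k [sk _ kC kS]] := source_exists 1 0.
have [l [sl _ lC lS]] := source_exists 0 1.
pose a := \int[leb]_(s in I01) (k s * P s).
pose b := - \int[leb]_(s in I01) (l s * P s).
exists b, a.
have sC := prim_sqi prim_cosz; have sS := prim_sqi prim_Phi.
pose r t := P t - (b * C t + a * S t).
have sr : sqi r by apply: sqiB => //; apply: sqiD; apply: sqiZ.
have lin (u : R -> R) (x y : R) g : sqi u -> sqi g ->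
    \int[leb]_(s in I01) (u s * (g s - (x * k s - y * l s))) =
    \int[leb]_(s in I01) (u s * g s) - (x * \int[leb]_(s in I01) (u s * k s) -
      y * \int[leb]_(s in I01) (u s * l s)).
  move=> su sg.
  have i1 := sqiM su sg; have i2 := sqiM su sk; have i3 := sqiM su sl.
  have i4 : intg (fun t => x * (u t * k t)) by exact: intgZ.
  have i5 : intg (fun t => y * (u t * l t)) by exact: intgZ.
  rewrite -!RintegralZl// -RintegralB//.
  rewrite -RintegralB//; last by exact: intgD i4 (intgN i5).
  by apply: eq_Rintegral => t _; ring.
have R0 g : sqi g -> \int[leb]_(s in I01) (g s * P s) =
    b * \int[leb]_(s in I01) (C s * g s) + a * \int[leb]_(s in I01) (S s * g s).
  move=> sg.
  pose x := \int[leb]_(s in I01) (S s * g s); pose y := \int[leb]_(s in I01) (C s * g s).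
  have sgt : sqi (fun t => g t - (x * k t - y * l t)).
    by apply: sqiB => //; apply: sqiB; apply: sqiZ.
  have := H _ sgt; rewrite !lin// kC kS lC lS oppr0 !mulr0 mulr1.
  rewrite !(add0r, subr0, sub0r, opprK, mulrN1) -/x -/y !subrr => /(_ erefl erefl).
  rewrite (_ : \int[leb]_(s in I01) _ = \int[leb]_(s in I01) (P s * (g s - (x * k s - y * l s)))); last first.
    by apply: eq_Rintegral => t _; rewrite mulrC.
  rewrite lin//.
  have cm u : \int[leb]_(s in I01) (P s * u s) = \int[leb]_(s in I01) (u s * P s).
    by apply: eq_Rintegral => t _; rewrite mulrC.
  rewrite !cm => /eqP; rewrite subr_eq0 => /eqP ->; rewrite /a /b; ring.
have : \int[leb]_(s in I01) (r s * r s) = 0.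
  have i1 := sqiM sr sP; have i2 := sqiM sC sr; have i3 := sqiM sS sr.
  have i4 : intg (fun t => b * (C t * r t)) by exact: intgZ.
  have i5 : intg (fun t => a * (S t * r t)) by exact: intgZ.
  rewrite (_ : \int[leb]_(s in I01) _ = \int[leb]_(s in I01) (r s * P s - (b * (C s * r s) + a * (S s * r s)))); last first.
    by apply: eq_Rintegral => t _; rewrite {2}/r; ring.
  rewrite RintegralB//; last exact: intgD.
  by rewrite RintegralD// !RintegralZl// R0// subrr.
move=> /(Rint_sqr_eq0 sr.1 sr.2) [A [mA A0 sub]]; exists A; split => // t At.
apply: sub => Pt; apply: At => /= /Pt /eqP; rewrite /r subr_eq0 => /eqP -> //.
Qed.

End oscillator.

Section oscillator_support.
Context {R : realType}.
Local Notation leb := (@lebesgue_measure R).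
Local Notation I01 := (`[0, 1]%classic : set R).

(** Where the source has ended, the integrals over [0, t] in [osc] are the
    integrals over [0, 1]. *)
Lemma osc_vanish (z p q : R) g (tau : R) : 0 <= tau -> sqi g ->
  (forall t, tau < t -> t <= 1 -> g t = 0) ->
  \int[leb]_(s in I01) (cosz z s * g s) = - q ->
  \int[leb]_(s in I01) (Phi z s * g s) = p ->
  forall t, tau < t -> t <= 1 -> osc z p q g t = 0 /\ osc1 z p q g t = 0.
Proof.
move=> tau0 sg g0 hC hS t tt t1.
have E u u' : prim u u' -> \int[leb]_(s in I01) (u s * g s) = \int[leb]_(s in `[0, t]) (u s * g s).
  move=> pu; have iu := sqiM (prim_sqi pu) sg.
  have t0 : 0 <= t by rewrite (le_trans tau0)// ltW.
  have := @Rintegral_itvB R (fun s => u s * g s) (BLeft 0) (BRight 1) t iu.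
  rewrite !bnd_simp => /(_ t0 t1) h.
  apply/eqP; rewrite -subr_eq0; apply/eqP; rewrite h.
  rewrite /Rintegral integral0_eq// => s /=; rewrite in_itv /= => /andP[ts s1].
  by rewrite g0 ?mulr0// (lt_trans tt).
by apply: osc_end; [rewrite -(E _ _ (prim_cosz z))|rewrite -(E _ _ (prim_Phi z))].
Qed.

End oscillator_support.

(** * Unordered sums *)

#[local] Existing Instance summability.totally_filter.

Section rsum.
Context {R : realType}.
Implicit Types (I J : choiceType).

(** The real and the imaginary part of [has_csum] are instances of this, by
    conversion. *)
Definition rsum_to I (S : set I) (a : I -> R) (s : R) :=
  summability.partial_sum (fun i => (if i \in S then a i else 0) : R^o) A
    @[A --> summability.totally] --> (s : R^o).

Lemma rsum_unique I (S : set I) a s s' : rsum_to S a s -> rsum_to S a s' -> s = s'.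
Proof.
move=> h h'.
apply: (@cvg_unique _ (@norm_hausdorff R R^o) _ _ _ _ h h').
Qed.

Lemma rsum_eq I (S : set I) a b s : (forall i, S i -> a i = b i) ->
  rsum_to S a s -> rsum_to S b s.
Proof.
move=> ab; rewrite /rsum_to.
rewrite (_ : (fun i => if i \in S then a i else 0) = (fun i => if i \in S then b i else 0))//.
by apply/funext => i; case: ifP => // /set_mem /ab.
Qed.

Lemma rsumD I (S : set I) a b s t : rsum_to S a s -> rsum_to S b t ->
  rsum_to S (fun i => a i + b i) (s + t).
Proof.
move=> ha hb; rewrite /rsum_to.
rewrite (_ : summability.partial_sum _ = (fun A =>
   summability.partial_sum (fun i => (if i \in S then a i else 0) : R^o) A +
   summability.partial_sum (fun i => (if i \in S then b i else 0) : R^o) A)).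
  apply: cvgD; [exact: ha|exact: hb].
apply/funext => A; rewrite /summability.partial_sum -big_split /=.
by apply: eq_bigr => i _; case: ifP => //; rewrite addr0.
Qed.

Lemma rsumZ I (S : set I) c a s : rsum_to S a s -> rsum_to S (fun i => c * a i) (c * s).
Proof.
move=> ha; rewrite /rsum_to.
rewrite (_ : summability.partial_sum _ = (fun A => c *
   summability.partial_sum (fun i => (if i \in S then a i else 0) : R^o) A)).
  apply: cvgMr; exact: ha.
apply/funext => A; rewrite /summability.partial_sum mulr_sumr /=.
by apply: eq_bigr => i _; case: ifP => //; rewrite mulr0.
Qed.

Lemma rsumB I (S : set I) a b s t : rsum_to S a s -> rsum_to S b t ->
  rsum_to S (fun i => a i - b i) (s - t).
Proof.
move=> ha /(@rsumZ _ _ (-1)); rewrite mulN1r => hb.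
by apply: rsum_eq (rsumD ha hb) => i _; rewrite mulN1r.
Qed.

(** The finite partial sums of nonnegative terms increase to their supremum,
    which is the value of esum. *)
Lemma ge0_rsum I (S : set I) (a : I -> R) (s : R) : (forall i, S i -> 0 <= a i) ->
  (\esum_(i in S) (a i)%:E = s%:E)%E -> rsum_to S a s.
Proof.
move=> a0; rewrite esum_mkcond => es.
pose b i := if i \in S then a i else 0.
have b0 i : 0 <= b i by rewrite /b; case: ifP => // /set_mem /a0.
have {}es : (\esum_(i in [set: I]) (b i)%:E = s%:E)%E.
  by rewrite -es; apply: eq_esum => i _; rewrite /b; case: ifP.
have pE (A : {fset I}) : summability.partial_sum (b : I -> R^o) A = \sum_(i <- A) b i.
  by rewrite /summability.partial_sum -(big_seq_fsetE _ _ xpredT b).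
have fE (A : {fset I}) : ((\sum_(i <- A) b i)%:E = \sum_(i \in [set` A]) (b i)%:E)%E.
  by rewrite fsbig_finite//= set_fsetK sumEFin.
have ub (A : {fset I}) : \sum_(i <- A) b i <= s.
  by rewrite -lee_fin -es fE; apply: esum_ge; exists [set` A].
rewrite /rsum_to -/b; apply/cvgrPdist_le => e e0.
have es' : ereal_sup [set (\sum_(i \in A) (b i)%:E)%E | A in fsets [set: I]] = s%:E by exact: es.
have fins : ereal_sup [set (\sum_(i \in A) (b i)%:E)%E | A in fsets [set: I]] \is a fin_num.
  by rewrite es'.
have [x [X [finX _] <-] hX] := ub_ereal_sup_adherent e0 fins.
exists (fset_set X) => // A /= XA.
rewrite [X in `|_ - X|]pE ger0_norm ?subr_ge0// lerBlDr -lerBlDl -lee_fin fE.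
apply: le_trans (_ : _ <= \sum_(i \in X) (b i)%:E)%E _.
  by move/ltW : hX; rewrite es' EFinB.
apply: lee_fsum_nneg_subset => //.
  move=> i; rewrite !inE => Xi; apply: (fsubsetP XA).
  by rewrite in_fset_set// inE.
by move=> i _; rewrite lee_fin.
Qed.

Lemma rsum0 I (S : set I) : rsum_to S (fun=> 0 : R) 0.
Proof. by apply: ge0_rsum => //; exact: esum1. Qed.

Definition asum I (S : set I) (a : I -> R) := (\esum_(i in S) `|a i|%:E < +oo)%E.

(** Expressed through esum, so that reindexing and summation by packets are
    inherited from nonnegative families; meaningful only for absolutely
    summable ones. *)
Definition tsum I (S : set I) (a : I -> R) :=
  fine (\esum_(i in S) (Num.max (a i) 0)%:E)%E - fine (\esum_(i in S) (Num.max (- a i) 0)%:E)%E.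

Lemma asum_le I (S : set I) a b : (forall i, S i -> `|a i| <= `|b i|) -> asum S b -> asum S a.
Proof. by move=> h; apply: le_lt_trans; apply: le_esum => i /h; rewrite lee_fin. Qed.

Lemma esum_asumK I (S : set I) (a : I -> R) : (forall i, S i -> 0 <= a i) ->
  asum S a -> (\esum_(i in S) (a i)%:E = (fine (\esum_(i in S) (a i)%:E))%:E)%E.
Proof.
move=> a0 sa; rewrite fineK// fin_numE; apply/andP; split.
  by rewrite gt_eqF// (lt_le_trans (ltNyr 0))// esum_ge0// => i /a0; rewrite lee_fin.
rewrite lt_eqF//; apply: le_lt_trans sa; apply: le_esum => i _.
by rewrite lee_fin ler_norm.
Qed.

Lemma asum_rsum I (S : set I) a : asum S a -> rsum_to S a (tsum S a).
Proof.
move=> sa.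
have p (b : I -> R) : (forall i, b i <= `|a i|) ->
   rsum_to S (fun i => Num.max (b i) 0) (fine (\esum_(i in S) (Num.max (b i) 0)%:E)%E).
  move=> h; apply: ge0_rsum; first by move=> i _; rewrite le_max lexx orbT.
  apply: esum_asumK => //.
    by move=> i _; rewrite le_max lexx orbT.
  apply: asum_le sa => i _; rewrite ger0_norm ?le_max ?lexx ?orbT//.
  by rewrite ge_max h /=.
apply: (@rsum_eq _ _ (fun i => Num.max (a i) 0 - Num.max (- a i) 0)).
  move=> i _; have [h|h] := leP (a i) 0.
    by rewrite max_l ?oppr_ge0// sub0r opprK.
  by rewrite max_r ?oppr_le0 ?ltW// subr0.
apply: rsumB; apply: p => i; first exact: ler_norm.
by rewrite -normrN ler_norm.
Qed.

Lemma asumD I (S : set I) a b : asum S a -> asum S b -> asum S (fun i => a i + b i).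
Proof.
move=> ha hb; apply: le_lt_trans (lte_add_pinfty ha hb).
rewrite -esumD; try by move=> i _; rewrite lee_fin.
by apply: le_esum => i _; rewrite -EFinD lee_fin ler_normD.
Qed.

Lemma asumZ I (S : set I) c a : asum S a -> asum S (fun i => c * a i).
Proof.
move=> ha; apply: (@le_lt_trans _ _ (`|c|%:E * \esum_(i in S) `|a i|%:E)%E).
  rewrite ge_ereal_sup// => _ [X [finX XS] <-].
  under eq_fsbigr do rewrite normrM EFinM.
  rewrite -ge0_mule_fsumr; last by move=> i; rewrite lee_fin.
  by rewrite lee_wpmul2l ?lee_fin//; apply: esum_ge; exists X.
rewrite lte_mul_pinfty ?lee_fin//.
Qed.

Lemma tsumE I (S : set I) a s : asum S a -> rsum_to S a s -> tsum S a = s.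
Proof. by move=> /asum_rsum h1 h2; exact: rsum_unique h1 h2. Qed.

Lemma tsumD I (S : set I) a b : asum S a -> asum S b ->
  tsum S (fun i => a i + b i) = tsum S a + tsum S b.
Proof.
move=> ha hb; apply: tsumE; first exact: asumD.
by apply: rsumD; exact: asum_rsum.
Qed.

Lemma tsumZ I (S : set I) c a : asum S a -> tsum S (fun i => c * a i) = c * tsum S a.
Proof.
move=> ha; apply: tsumE; first exact: asumZ.
by apply: rsumZ; exact: asum_rsum.
Qed.

Lemma eq_tsum I (S : set I) a b : (forall i, S i -> a i = b i) -> tsum S a = tsum S b.
Proof. by move=> h; rewrite /tsum; congr (fine _ - fine _); apply: eq_esum => i /h ->. Qed.

Lemma tsum_reindex I J (P : set I) (Q : set J) e a : set_bij P Q e ->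
  tsum Q a = tsum P (a \o e).
Proof. by move=> h; rewrite /tsum !(reindex_esum _ _ _ _ h). Qed.

Lemma asum_reindex I J (P : set I) (Q : set J) e a : set_bij P Q e ->
  asum Q a = asum P (a \o e).
Proof. by move=> h; rewrite /asum (reindex_esum _ _ _ _ h). Qed.

Lemma tsum_ge0 I (S : set I) a : (forall i, S i -> 0 <= a i) -> 0 <= tsum S a.
Proof.
move=> a0; rewrite /tsum [X in _ - fine X]esum1 ?subr0.
  by apply: fine_ge0; apply: esum_ge0 => i _; rewrite lee_fin le_max lexx orbT.
by move=> i /a0 ai; rewrite max_r// oppr_le0.
Qed.

Lemma asumS I (S T : set I) a : S `<=` T -> asum T a -> asum S a.
Proof.
move=> ST; apply: le_lt_trans.
rewrite (@esumID _ _ S T) => [|i _]; last by rewrite lee_fin.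
rewrite setIidr// leeDl// esum_ge0// => i _; rewrite lee_fin//.
Qed.

(** Summation by packets, which holds for the positive and the negative
    parts separately because they are summable. *)
Lemma tsum_fibers I J (f : I -> J) a : asum setT a ->
  (forall x, tsum [set i | f i = x] a = 0) -> tsum setT a = 0.
Proof.
move=> sa h; rewrite /tsum.
have fib (b : I -> R) : (forall i, 0 <= b i) -> (\esum_(i in [set: I]) (b i)%:E =
    \esum_(x in [set: J]) \esum_(i in [set i | f i = x]) (b i)%:E)%E.
  move=> b0.
  rewrite esum_esum; last by move=> x i _ _; rewrite lee_fin.
  have bij : set_bij [set: I] ([set: J] `*`` (fun x => [set i | f i = x])) (fun i => (f i, i)).
    split => [i _ //|i j _ _ [] //|[x i] [_ /= <-]].
    by exists i.
  by rewrite (reindex_esum _ _ _ _ bij).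
have m0 (r : R) : 0 <= Num.max r 0 by rewrite le_max lexx orbT.
rewrite !fib//; apply/eqP; rewrite subr_eq0; apply/eqP; congr fine.
apply: eq_esum => x _.
have sx : asum [set i | f i = x] a by exact: asumS sa.
have /eqP := h x; rewrite /tsum subr_eq0 => /eqP e.
rewrite esum_asumK//; last first.
  apply: asum_le sx => i _; rewrite ger0_norm// ge_max ler_norm /=//.
rewrite e -esum_asumK//.
apply: asum_le sx => i _; rewrite ger0_norm// ge_max normr_ge0 andbT.
by rewrite -normrN ler_norm.
Qed.

Lemma tsum_single (I : choiceType) (a : I -> R) i : (forall j, j != i -> a j = 0) ->
  asum [set: I] a /\ tsum [set: I] a = a i.
Proof.
move=> a0.
have E (b : R -> R) : (forall j, 0 <= b (a j)) -> b 0 = 0 -> (\esum_(j in [set: I]) (b (a j))%:E = (b (a i))%:E)%E.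
  move=> b0 b00; rewrite -(@esum_set1 R I i (fun j => (b (a j))%:E)); last by rewrite lee_fin.
  rewrite [RHS]esum_mkcond; apply: eq_esum => j _; case: ifPn => //.
  by rewrite notin_setE /= => /eqP /a0 ->; rewrite b00.
split; first by rewrite /asum (E (fun x => `|x|)) ?normr0// ltry.
rewrite /tsum (E (fun x => Num.max x 0)); first last.
- by rewrite maxxx.
- by move=> j; rewrite le_max lexx orbT.
rewrite (E (fun x => Num.max (- x) 0)); first last.
- by rewrite oppr0 maxxx.
- by move=> j; rewrite le_max lexx orbT.
rewrite /=; have [h|h] := leP (a i) 0.
  by rewrite max_l ?oppr_ge0// sub0r opprK.
by rewrite max_r ?oppr_le0 ?ltW// subr0.
Qed.

Lemma rsum_mkcond (I : choiceType) (S : set I) (a : I -> R) s :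
  rsum_to [set: I] (fun i => if i \in S then a i else 0) s -> rsum_to S a s.
Proof.
rewrite /rsum_to => h.
have E : (fun i => (if i \in S then a i else 0) : R^o) =
   (fun i => if i \in [set: I] then if i \in S then a i else 0 else 0).
  by apply/funext => i; rewrite in_setT.
by rewrite E; exact: h.
Qed.

Lemma rsum_single (I : choiceType) (S : set I) i :
  rsum_to S (fun j => (j == i)%:R : R) (i \in S)%:R.
Proof.
have [|a1 t1] := @tsum_single _ (fun j => if j \in S then (j == i)%:R else 0) i.
  by move=> j /negbTE ->; case: ifP.
apply: rsum_mkcond; have := asum_rsum a1; rewrite t1 eqxx.
by case: (i \in S).
Qed.

End rsum.

(** * Measure and integration on the metric graph *)

Section graph.
Context {R : realType} (N : network R).
Local Notation leb := (@lebesgue_measure R).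
Local Notation I01 := (`[0, 1]%classic : set R).
Local Notation edge := (edge N).

Lemma val_insubI (t : R) : 0 <= t <= 1 -> val (insubd (@zeroI R) t) = t.
Proof. by move=> t01; rewrite val_insubd t01. Qed.

Lemma pt_glue (e e' : edge) (t t' : R) :
  pt e t = pt e' t' <-> glue (e, insubd (@zeroI R) t) (e', insubd (@zeroI R) t').
Proof. by rewrite /pt; split => [/eqmodP|h]; last exact/eqmodP. Qed.

Lemma pt_rev (e : edge) (t : R) : 0 <= t <= 1 -> pt (rev e) (1 - t) = pt e t.
Proof.
move=> t01; apply/pt_glue; rewrite glue_sym /glue; apply/orP; right; apply/orP; left.
apply/eqP; rewrite /flip /=; congr (_, _); apply: val_inj => /=.
by rewrite !val_insubI//; lra.
Qed.

(** Points in the open edges have exactly the two names (xy, t) and (yx, 1 -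
    t); at the vertices there are more, which is why the statements below
    avoid t = 0 and t = 1. *)
Lemma pt_inj (e e' : edge) (t t' : R) : 0 < t < 1 -> 0 <= t' <= 1 ->
  pt e t = pt e' t' -> (e' = e /\ t' = t) \/ (e' = rev e /\ t' = 1 - t).
Proof.
move=> t01 t01' /pt_glue.
have t01c : 0 <= t <= 1 by lra.
rewrite /glue /endpt /= val_insubI//.
have -> : (t == 0) = false by apply/negbTE; lra.
have -> : (t == 1) = false by apply/negbTE; lra.
rewrite eqxx orbF => /orP[] /eqP[].
  by move=> -> /(congr1 val); rewrite !val_insubI// => ->; left.
rewrite /flip /= => -> /(congr1 val) /=; rewrite !val_insubI// => <-; by right.
Qed.

Lemma pt_repr (p : mgraph N) : p = pt (repr p).1 (val (repr p).2).
Proof.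
rewrite /pt valKd -[LHS]reprK; congr (\pi_(_) _)%qT.
by case: (repr p).
Qed.

Lemma repr_pt (e : edge) (t : R) : 0 < t < 1 ->
  ((repr (pt e t)).1 = e /\ val (repr (pt e t)).2 = t) \/
  ((repr (pt e t)).1 = rev e /\ val (repr (pt e t)).2 = 1 - t).
Proof.
move=> t01; apply: (pt_inj t01 (proj2_sig (repr (pt e t)).2)).
exact: pt_repr.
Qed.

Lemma ec_rev (e : edge) : ec (rev e) = ec e.
Proof. by rewrite /ec cond_sym//; exact: valP (rev e). Qed.

Lemma c1_pt (e : edge) (t : R) : 0 < t < 1 -> c1 N (pt e t) = ec e.
Proof. by move=> t01; rewrite /c1; case: (repr_pt e t01) => -[-> _]; rewrite ?ec_rev. Qed.

(** Evaluating F at a chosen name of p is meaningful for F with F(yx, 1 - t)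
    = F(xy, t); the values at the vertices are arbitrary, as these form a
    null set. *)
Definition lift T (F : edge -> R -> T) (p : mgraph N) : T := F (repr p).1 (val (repr p).2).

Lemma lift_pt T (F : edge -> R -> T) (e : edge) (t : R) :
  (forall e t, 0 < t < 1 -> F (rev e) (1 - t) = F e t) -> 0 < t < 1 ->
  lift F (pt e t) = F e t.
Proof.
by move=> sF t01; rewrite /lift; case: (repr_pt e t01) => -[-> ->]; rewrite ?sF.
Qed.

Lemma pt_out (e : edge) (t : R) : ~~ (0 <= t <= 1) -> pt e t = pt e 0.
Proof.
move=> h; rewrite /pt; congr (\pi_(_) (_, _))%qT; apply: val_inj.
by rewrite !val_insubd (negbTE h) lexx ler01.
Qed.

Lemma measurable_pt (e : edge) : measurable_fun setT (fun t : R => pt e t).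
Proof.
move=> _ A mA; rewrite setTI.
have -> : pt e @^-1` A = (`[0, 1] `&` pt e @^-1` A) `|` (~` `[0, 1]%classic `&` [set t : R | A (pt e 0)]).
  apply/seteqP; split => t /=; rewrite in_itv /=.
    by case/boolP: (0 <= t <= 1) => h; [left|right; split => //; rewrite -(pt_out _ h)].
  by case=> -[] // /negP h; rewrite (pt_out _ h).
apply: measurableU; first exact: mA.
have [H|H] := pselect (A (pt e 0)).
  rewrite (_ : [set _ : R | _] = setT) ?setIT; last by apply/seteqP; split.
  exact: measurableC.
by rewrite (_ : [set _ : R | _] = set0) ?setI0//; apply/seteqP; split.
Qed.

Lemma measurable_oo_cc d' (T' : measurableType d') (f : R -> T') :
  measurable_fun (`]0, 1[%classic : set R) f -> measurable_fun I01 f.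
Proof.
move=> mf; have -> : I01 = ([set 0] `|` `]0, 1[%classic) `|` [set 1].
  apply/seteqP; split => x /=; rewrite !in_itv /=.
    move=> /andP[]; rewrite !le_eqVlt => /predU1P[<-|x0] /predU1P[x1|x1].
    - by left; left.
    - by left; left.
    - by right.
    - by left; right; rewrite x0 x1.
  by move=> [[->|]|->]; lra.
apply/measurable_funU => //; first exact: measurableU.
split; last exact: measurable_fun_set1.
by apply/measurable_funU => //; split => //; exact: measurable_fun_set1.
Qed.

(** Each edge meets the vertices in two points only, so that any values
    there are measurable. *)
Lemma measurable_graph d' (T' : measurableType d') (f : mgraph N -> T') :
  (forall e : edge, measurable_fun (`]0, 1[%classic : set R) (fun t => f (pt e t))) ->
  measurable_fun setT f.
Proof.
move=> mf _ A mA; rewrite setTI.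
suff : mgraph_measurable (f @^-1` A) by [].
move=> e; exact: (@measurable_oo_cc _ _ _ (mf e) (measurable_itv _) A mA).
Qed.

Lemma measurable_edge d' (T' : measurableType d') (f : mgraph N -> T') (e : edge) (D : set R) :
  measurable D -> measurable_fun setT f -> measurable_fun D (fun t => f (pt e t)).
Proof.
move=> mD mf; apply: measurable_funTS; apply: measurableT_comp => //.
exact: measurable_pt.
Qed.

Lemma leb_oo_cc (B : set R) : measurable B -> leb (`]0, 1[ `&` B) = leb (`[0, 1] `&` B).
Proof.
move=> mB; have := @integral_itv_bndoo R 0 1 (fun x => (\1_B x)%:E) true false.
move=> h; rewrite ![_ `&` B]setIC -!integral_indic// h//.
exact/measurable_EFinP/measurable_indic.
Qed.

Lemma esum_count (T : countType) (h : T -> \bar R) : (forall x, 0 <= h x)%E ->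
  (\sum_(n <oo) (if pickle_inv n is Some e then h e else 0) = \esum_(e in [set: T]) h e)%E.
Proof.
move=> h0; rewrite nneseries_esumT; last by move=> n; case: pickle_inv.
have -> : (\esum_(e in [set: T]) h e = \esum_(n in pickle @` [set: T]) (if pickle_inv n is Some e then h e else 0))%E.
  rewrite esum_image; last by move=> x y _ _; exact: (pcan_inj pickleK_inv).
  by apply: eq_esum => e _; rewrite pickleK_inv.
rewrite [RHS]esum_mkcond; apply: eq_esum => n _.
case: ifPn => //; rewrite notin_setE => hn; case: (pickle_inv _) (@pickle_invK T n) => //= x xn.
by exfalso; apply: hn; exists x.
Qed.

(** [pt e] on the copy of R that carries the measures, where pushforwards
    are formed. *)
Definition edge_pt (e : edge) : measurableTypeR R -> mgraph N := pt e.
Lemma measurable_edge_pt e : measurable_fun setT (edge_pt e).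
Proof. exact: measurable_pt. Qed.
HB.instance Definition _ e := isMeasurableFun.Build _ _ _ _ (edge_pt e) (measurable_edge_pt e).

Lemma ec2_ge0 (e : edge) : 0 <= ec e / 2.
Proof. by rewrite divr_ge0// ltW// ec_gt0. Qed.

Definition edge_push (e : edge) : {measure set (mgraph N) -> \bar R} :=
  measure_function_pushforward__canonical__measure_function_Measure
    (uniform_prob (@ltr01 R)) (measurable_edge_pt e).

Definition edge_measure (e : edge) : {measure set (mgraph N) -> \bar R} :=
  mscale (NngNum (ec2_ge0 e))
    (edge_push e).

Lemma edge_measureE (e : edge) (A : set (mgraph N)) : measurable A ->
  edge_measure e A = ((ec e / 2)%:E * leb (`]0%R, 1%R[ `&` pt e @^-1` A : set R))%E.
Proof.
move=> mA.
have mB : measurable (pt e @^-1` A : set R).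
  by rewrite -[X in measurable X]setTI; exact: (measurable_pt e measurableT mA).
rewrite leb_oo_cc//.
rewrite /edge_measure /mscale /=; congr (_ * _)%E.
rewrite [LHS](_ : _ = uniform_prob (@ltr01 R) (pt e @^-1` A `&` setT)); last by rewrite setIT.
rewrite -integral_indic// integral_uniform//.
- by rewrite subr0 invr1 mul1e integral_indic//= setIC.
- exact/measurable_EFinP/measurable_indic.
Qed.

Lemma ge0_integral_edge_measure (e : edge) (f : mgraph N -> \bar R) :
  measurable_fun setT f -> (forall p, 0 <= f p)%E ->
  (\int[edge_measure e]_p f p = (ec e / 2)%:E * \int[leb]_(t in I01) f (pt e t))%E.
Proof.
move=> mf f0; rewrite /edge_measure ge0_integral_mscale//=; congr (_ * _)%E.
transitivity (\int[uniform_prob (@ltr01 R)]_(x in edge_pt e @^-1` setT) (f \o edge_pt e) x)%E.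
  exact: (ge0_integral_pushforward (measurable_edge_pt e)).
rewrite integral_uniform//; first by rewrite subr0 invr1 mul1e.
  by apply: measurableT_comp => //; exact: measurable_edge_pt.
by move=> x; exact: f0.
Qed.

(** The measure m1 is the countable sum of the images of the measures (c/2)
    dt under the oriented edges. *)
Lemma ge0_integral_m1 (f : mgraph N -> \bar R) :
  measurable_fun setT f -> (forall p, 0 <= f p)%E ->
  (\int[m1 N]_p f p =
   \esum_(e in [set: edge]) ((ec e / 2)%:E * \int[leb]_(t in I01) f (pt e t)))%E.
Proof.
move=> mf f0.
pose m_ n : {measure set (mgraph N) -> \bar R} :=
  if pickle_inv n is Some e then edge_measure e else mzero.
rewrite (@eq_measure_integral _ _ _ setT (mseries m_ 0)); last first.
  move=> A mA _; rewrite /mseries /=.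
  transitivity (\esum_(e in [set: edge]) (edge_measure e A))%E.
    by apply: eq_esum => e _; rewrite edge_measureE.
  rewrite -esum_count//; apply: eq_eseriesr => n _.
  by rewrite /m_; case: (pickle_inv n).
rewrite ge0_integral_measure_series//.
rewrite -esum_count; last first.
  by move=> e; apply: mule_ge0; [rewrite lee_fin ec2_ge0|exact: integral_ge0].
apply: eq_eseriesr => n _; rewrite /m_; case: (pickle_inv n) => [e|].
  exact: ge0_integral_edge_measure.
by rewrite integral_measure_zero.
Qed.

Lemma eq_int_oo (f g : R -> \bar R) :
  measurable_fun I01 f -> measurable_fun I01 g ->
  (forall t, 0 < t < 1 -> f t = g t) ->
  (\int[leb]_(t in I01) f t = \int[leb]_(t in I01) g t)%E.
Proof.
move=> mf mg fg.
have moo (h : R -> \bar R) : measurable_fun I01 h -> measurable_fun (`]0, 1[%classic : set R) h.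
  by apply: measurable_funS => //; exact: subset_itv_oo_cc.
rewrite (integral_itv_bndoo _ _ (moo _ mf)) (integral_itv_bndoo _ _ (moo _ mg)).
by apply: eq_integral => t /set_mem /=; rewrite in_itv /= => /fg.
Qed.

Lemma eq_Rint_oo (f g : R -> R) :
  measurable_fun I01 f -> measurable_fun I01 g ->
  (forall t, 0 < t < 1 -> f t = g t) ->
  \int[leb]_(t in I01) f t = \int[leb]_(t in I01) g t.
Proof.
move=> mf mg fg; rewrite /Rintegral; congr fine; apply: eq_int_oo.
- exact/measurable_EFinP.
- exact/measurable_EFinP.
- by move=> t /fg ->.
Qed.

Lemma le_int_oo (f g : R -> \bar R) :
  measurable_fun I01 f -> measurable_fun I01 g ->
  (forall t : R, (0 < t < 1)%R -> 0 <= f t)%E ->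
  (forall t : R, (0 < t < 1)%R -> f t <= g t)%E ->
  (\int[leb]_(t in I01) f t <= \int[leb]_(t in I01) g t)%E.
Proof.
move=> mf mg f0 fg.
have moo (h : R -> \bar R) : measurable_fun I01 h -> measurable_fun (`]0, 1[%classic : set R) h.
  by apply: measurable_funS => //; exact: subset_itv_oo_cc.
rewrite (integral_itv_bndoo _ _ (moo _ mf)) (integral_itv_bndoo _ _ (moo _ mg)).
by apply: ge0_le_integral => //; exact: moo.
Qed.

Lemma m1_integrable_abs (F : mgraph N -> R) : measurable_fun setT F ->
  ((m1 N).-integrable setT (EFin \o F) <->
   (\esum_(e in [set: edge]) ((ec e / 2)%:E * \int[leb]_(t in I01) `|F (pt e t)|%:E) < +oo)%E).
Proof.
move=> mF.
have E : (\int[m1 N]_p `|(EFin \o F) p| =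
   \esum_(e in [set: edge]) ((ec e / 2)%:E * \int[leb]_(t in I01) `|F (pt e t)|%:E))%E.
  rewrite ge0_integral_m1//.
  by apply/measurable_EFinP; exact: measurableT_comp.
split => [/integrableP[_]|]; first by rewrite E.
by move=> h; apply/integrableP; split; [exact/measurable_EFinP|rewrite E].
Qed.

Lemma esum_lty_term (I : choiceType) (S : set I) (a : I -> \bar R) i : S i ->
  (forall j, 0 <= a j)%E -> (\esum_(j in S) a j < +oo)%E -> (a i < +oo)%E.
Proof.
move=> Si a0; apply: le_lt_trans; rewrite -(@esum_set1 R I i a)//.
rewrite (@esumID R I [set i] S)// (_ : S `&` [set i] = [set i]).
  by rewrite leeDl// esum_ge0.
by apply/seteqP; split => j /=; [case|move=> ->].
Qed.

(** The formula of [ge0_integral_m1] for the positive and the negative part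
    of F. *)
Lemma m1_integral (F : mgraph N -> R) : (m1 N).-integrable setT (EFin \o F) ->
  [/\ forall e : edge, leb.-integrable I01 (EFin \o (fun t => F (pt e t))),
     asum [set: edge] (fun e => ec e / 2 * \int[leb]_(t in I01) `|F (pt e t)|) &
     \int[m1 N]_p F p = tsum [set: edge] (fun e => ec e / 2 * \int[leb]_(t in I01) F (pt e t))].
Proof.
move=> iF.
have mF : measurable_fun setT F by apply/measurable_EFinP; exact: measurable_int iF.
have := (m1_integrable_abs mF).1 iF => sF.
have ie (e : edge) : leb.-integrable I01 (EFin \o (fun t => F (pt e t))).
  apply/integrableP; split.
    by apply/measurable_EFinP; exact: measurable_edge.
  have a0 (j : edge) : (0 <= (ec j / 2)%:E * \int[leb]_(t in I01) `|F (pt j t)|%:E)%E.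
    by apply: mule_ge0; [rewrite lee_fin ec2_ge0|exact: integral_ge0].
  have := esum_lty_term (i := e) I a0 sF.
  have c0 : 0 < ec e / 2 by rewrite divr_gt0// ec_gt0.
  move=> h; rewrite ltey; apply/eqP => Iy; move: h.
  have -> : (\int[leb]_(t in I01) `|F (pt e t)|%:E = +oo)%E by exact: Iy.
  by rewrite mulry gtr0_sg// mul1e ltxx.
have ia (e : edge) : leb.-integrable I01 (EFin \o (fun t => `|F (pt e t)|)).
  exact: (integrable_abse (ie e)).
have sabs : asum [set: edge] (fun e => ec e / 2 * \int[leb]_(t in I01) `|F (pt e t)|).
  rewrite /asum; apply: le_lt_trans sF; apply: le_esum => e _.
  rewrite ger0_norm; last by rewrite mulr_ge0 ?ec2_ge0// Rintegral_ge0.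
  by rewrite EFinM -Rint_EFin//.
split => //; apply/esym/tsumE.
  apply: asum_le sabs => e _; rewrite !normrM ler_wpM2l//.
  apply: le_trans (le_normr_Rintegral _ (ie e)) _ => //.
  by rewrite ler_norm.
have P (G : mgraph N -> R) : measurable_fun setT G -> (forall p, 0 <= G p) -> (forall p, G p <= `|F p|) ->
    (forall e : edge, leb.-integrable I01 (EFin \o (fun t => G (pt e t)))) /\
    rsum_to [set: edge] (fun e => ec e / 2 * \int[leb]_(t in I01) G (pt e t)) (\int[m1 N]_p G p).
  move=> mG G0 GF.
  have iG : (m1 N).-integrable setT (EFin \o G).
    apply: le_integrable iF => //; first exact/measurable_EFinP.
    by move=> p _ /=; rewrite lee_fin ger0_norm.
  have iGe (e : edge) : leb.-integrable I01 (EFin \o (fun t => G (pt e t))).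
    apply: le_integrable (ie e) => //.
      by apply/measurable_EFinP; exact: measurable_edge.
    by move=> t _ /=; rewrite lee_fin ger0_norm.
  split => //; apply: ge0_rsum.
    by move=> e _; rewrite mulr_ge0 ?ec2_ge0// Rintegral_ge0.
  rewrite -[RHS]/((fine _)%:E) fineK; last exact: integrable_fin_num.
  rewrite ge0_integral_m1//; last exact/measurable_EFinP.
  by apply: eq_esum => e _; rewrite EFinM -Rint_EFin.
pose Gp p := Num.max (F p) 0; pose Gm p := Num.max (- F p) 0.
have mp : measurable_fun setT Gp by exact: measurable_maxr.
have mm : measurable_fun setT Gm.
  by apply: measurable_maxr => //; exact: measurableT_comp.
have FE p : F p = Gp p - Gm p.
  rewrite /Gp /Gm; have [h|h] := leP (F p) 0.
    by rewrite max_l ?oppr_ge0// sub0r opprK.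
  by rewrite max_r ?oppr_le0 ?ltW// subr0.
have [] := P _ mp.
- by move=> p; rewrite le_max lexx orbT.
- by move=> p; rewrite ge_max ler_norm /=.
have [] := P _ mm.
- by move=> p; rewrite le_max lexx orbT.
- by move=> p; rewrite ge_max normr_ge0 andbT -normrN ler_norm.
move=> im rm ip rp.
rewrite (_ : \int[m1 N]_p F p = \int[m1 N]_p Gp p - \int[m1 N]_p Gm p); last first.
  rewrite -RintegralB//; first by apply: eq_Rintegral => p _; rewrite FE.
    apply: le_integrable iF => //; first exact/measurable_EFinP.
    by move=> p _ /=; rewrite lee_fin ger0_norm ?le_max ?lexx ?orbT// ge_max ler_norm /=.
  apply: le_integrable iF => //; first exact/measurable_EFinP.
  by move=> p _ /=; rewrite lee_fin ger0_norm ?le_max ?lexx ?orbT// ge_max normr_ge0 andbT -normrN ler_norm.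
apply: rsum_eq (rsumB rp rm) => e _.
rewrite -mulrBr -RintegralB//; congr (_ * _).
by apply: eq_Rintegral => t _; rewrite FE.
Qed.

Lemma ae_cc (Q : R -> Prop) : {ae leb, forall t, `]0, 1[%classic t -> Q t} ->
  {ae leb, forall t, I01 t -> Q t}.
Proof.
move=> h; have n01 (x : R) : {ae leb, forall t, t <> x}.
  exists [set x]; split => //; first exact: lebesgue_measure_set1.
  by move=> t /= ht; apply: contrapT => /ht.
have h0 := n01 0; have h1 := n01 1.
move: h h0 h1; apply: ae_mono3 => t h t0 t1 /=.
rewrite in_itv /= => /andP[a b]; apply: h; rewrite /= in_itv /=.
by apply/andP; split; rewrite lt_neqAle ?a ?b andbT; apply/eqP => // ?; apply: t0.
Qed.

(** The points (e, t) at which Q fails, together with the vertices, form a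
    null set; each inner point has two names, so the exceptional set on e
    also contains the reflection of the one on rev e. *)
Lemma ae_m1 (Q : edge -> R -> Prop) :
  (forall e, {ae leb, forall t, I01 t -> Q e t}) ->
  {ae m1 N, forall p : mgraph N, forall (e : edge) t, 0 <= t <= 1 -> p = pt e t -> Q e t}.
Proof.
move=> H.
have /choice[Z HZ] : forall e, exists Z : set R, [/\ measurable Z, leb Z = 0%E &
    forall t, I01 t -> ~ Z t -> Q e t].
  move=> e; have [A [mA A0 sub]] := H e.
  exists A; split => // t t01 nA; apply: contrapT => nQ; apply: nA; apply: sub => /=.
  by move/(_ t01).
(* The exceptional parameters on e: the endpoints, the null set of e, and the
   reflection of the null set of rev e. *)
pose W (e : edge) : set R := ([set 0] `|` [set 1]) `|` ((I01 `&` Z e) `|` [set t | (I01 `&` Z (rev e)) (1 - t)]).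
pose B : set (mgraph N) := [set p | exists (e : edge) (t : R), [/\ 0 <= t <= 1, p = pt e t & W e t]].
have mW e : measurable (W e).
  have [m1 _ _] := HZ e; have [m2 _ _] := HZ (rev e).
  apply: measurableU; first exact: measurableU.
  apply: measurableU; first exact: measurableI.
  by apply: (measurable_setonem (D := I01 `&` _)); exact: measurableI.
have W0 e : leb (W e) = 0%E.
  have [m1 z1 _] := HZ e; have [m2 z2 _] := HZ (rev e).
  have n1 : leb (I01 `&` Z e) = 0%E.
    by apply: subset_measure0 z1 => //; first [exact: subIsetr|exact: measurableI].
  have n2 : leb (I01 `&` Z (rev e)) = 0%E.
    by apply: subset_measure0 z2 => //; first [exact: subIsetr|exact: measurableI].
  have n3 := leb_onem (measurableI I01 _ (measurable_itv _) m2).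
  have mr := measurable_setonem (measurableI I01 _ (measurable_itv _) m2).
  have s0 : leb [set 0%R] = 0%E by exact: lebesgue_measure_set1.
  have s1 : leb [set 1%R] = 0%E by exact: lebesgue_measure_set1.
  have m12 : measurable (I01 `&` Z e) by exact: measurableI.
  have n3' := etrans n3 n2.
  have nU (A1 A2 : set R) : measurable A1 -> measurable A2 -> leb A1 = 0%E ->
      leb A2 = 0%E -> leb (A1 `|` A2) = 0%E.
    by move=> q1 q2 q3 q4; exact: null_set_setU.
  by apply: (nU _ _ _ _ (nU _ _ _ _ s0 s1) (nU _ _ _ _ n1 n3')) => //; exact: measurableU.
have revK' (e : edge) : rev (rev e) = e by exact: revK.
have BE (e : edge) : I01 `&` pt e @^-1` B = I01 `&` W e.
  apply/seteqP; split => t /=; rewrite in_itv /= => -[t01]; last first.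
    by move=> Wt; split => //; exists e, t.
  move=> [e' [t' [t01' /esym E Wt']]]; split => //.
  have [/andP[t0 t1]|] := boolP (0 < t < 1); last first.
    move=> h; left; have : t = 0 \/ t = 1 by lra.
    by [].
  have tt : 0 < t < 1 by rewrite t0.
  have [[e'E t'E]|[e'E t'E]] := pt_inj tt t01' (esym E); first by rewrite -e'E -t'E.
  move: Wt'; rewrite e'E t'E => -[[/=|/=]|[]].
  - lra.
  - lra.
  - by move=> h; right; right.
  - by rewrite /= revK' => h; right; left; move: h; rewrite subKr.
exists B; split.
- suff : mgraph_measurable B by [].
  by move=> e; rewrite BE; exact: measurableI.
- rewrite /m1 esum1// => e _.
  have -> : `]0, 1[ `&` pt e @^-1` B = `]0, 1[%classic `&` W e :> set R.
    have s01 : `]0, 1[%classic = `]0, 1[%classic `&` I01 :> set R.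
      by apply/esym/setIidPl; exact: subset_itv_oo_cc.
    by rewrite s01 -!setIA BE.
  rewrite [X in (_ * X)%E](_ : _ = 0%E) ?mule0//.
  have mI : measurable (`]0, 1[%classic `&` W e : set R) by apply: measurableI => //; exact: mW.
  by apply: subset_measure0 (W0 e); first [exact: subIsetr|exact: mI|exact: mW].
- move=> p nQ; apply: contrapT => nB; apply: nQ => e t t01 pE.
  have [_ _ h] := HZ e; apply: h; first by rewrite /= in_itv.
  move=> Zt; apply: nB; exists e, t; split => //.
  by right; left; split => //; rewrite /= in_itv.
Qed.

End graph.

(** * Functions in the domain of the Laplacian *)

Section test_functions.
Context {R : realType} (N : network R).
Local Notation leb := (@lebesgue_measure R).
Local Notation I01 := (`[0, 1]%classic : set R).
Local Notation edge := (edge N).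

Lemma rev_bij : set_bij [set: edge] [set: edge] (@rev R N).
Proof.
split=> // [e e' _ _ /(congr1 (@rev R N))|e _]; first by rewrite !revK.
by exists (rev e) => //; rewrite revK.
Qed.

Lemma ge0_int01_onem (g : R -> \bar R) : measurable_fun I01 g -> (forall t, 0 <= g t)%E ->
  (\int[leb]_(t in I01) g (1 - t)%R = \int[leb]_(t in I01) g t)%E.
Proof. by move=> mg g0; rewrite [RHS]ge0_integral_onem// onem_I01. Qed.

(** Up to the factor 2, this bounds the squared norm of the symmetrized test
    function in L^2(rho m1), see [wsum_sym]. *)
Definition wsum (rho : mgraph N -> R) (k : edge -> R) (phi : R -> R) :=
  (\esum_(e in [set: edge])
    ((ec e)%:E * \int[leb]_(t in I01) (rho (pt e t) * (k e * phi t) ^+ 2)%:E))%E.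

(** By (x + s y)^2 <= 2 x^2 + 2 y^2 and the symmetry of the sum under
    reversal of the edges; s is 1 for the test function and -1 for its
    derivative. *)
Lemma wsum_sym (rho : mgraph N -> R) (k : edge -> R) (phi : R -> R) (s : R) : (forall p, 0 <= rho p) -> measurable_fun setT rho ->
  measurable_fun I01 phi -> s ^+ 2 = 1 -> (wsum rho k phi < +oo)%E ->
  (\esum_(e in [set: edge]) ((ec e / 2)%:E * \int[leb]_(t in I01)
     (rho (pt e t) * (k e * phi t + s * (k (rev e) * phi (1 - t))) ^+ 2)%:E) < +oo)%E.
Proof.
move=> rho0 mrho mphi s1 ws.
have mr (e : edge) : measurable_fun I01 (fun t => rho (pt e t)) by exact: measurable_edge.
have mphi' := measurable_onem mphi.
pose A e t : R := rho (pt e t) * (k e * phi t) ^+ 2.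
pose B e t : R := rho (pt e t) * (k (rev e) * phi (1 - t)) ^+ 2.
have mA e : measurable_fun I01 (A e).
  by apply: measurable_funM => //; apply: measurable_funX; exact: measurable_funM.
have mB e : measurable_fun I01 (B e).
  by apply: measurable_funM => //; apply: measurable_funX; exact: measurable_funM.
have mG e : measurable_fun I01 (fun t => rho (pt e t) * (k e * phi t + s * (k (rev e) * phi (1 - t))) ^+ 2).
  apply: measurable_funM => //; apply: measurable_funX.
  by apply: measurable_funD; apply: measurable_funM => //; exact: measurable_funM.
have A0 e t : 0 <= A e t by rewrite mulr_ge0 ?sqr_ge0.
have B0 e t : 0 <= B e t by rewrite mulr_ge0 ?sqr_ge0.
have IB e : (\int[leb]_(t in I01) (B e t)%:E = \int[leb]_(t in I01) (A (rev e) t)%:E)%E.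
  rewrite -(ge0_int01_onem (g := fun t => (A (rev e) t)%:E))//; last first.
  - by move=> t; rewrite lee_fin.
  - by apply/measurable_EFinP; exact: mA.
  apply: eq_integral => t /set_mem /=; rewrite in_itv /= => t01.
  by rewrite /A /B pt_rev.
have c0 (e : edge) : (0 <= (ec e)%:E)%E by rewrite lee_fin ltW// ec_gt0.
apply: (@le_lt_trans _ _ (\esum_(e in [set: edge])
    ((ec e)%:E * \int[leb]_(t in I01) (A e t)%:E + (ec e)%:E * \int[leb]_(t in I01) (A (rev e) t)%:E))%E).
  apply: le_esum => e _; rewrite -IB -ge0_muleDr; last 2 first.
  - by apply: integral_ge0 => t _; rewrite lee_fin.
  - by apply: integral_ge0 => t _; rewrite lee_fin.
  rewrite -ge0_integralD//; last 4 first.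
  - by move=> t _; rewrite lee_fin.
  - by apply/measurable_EFinP; exact: mA.
  - by move=> t _; rewrite lee_fin.
  - by apply/measurable_EFinP; exact: mB.
  rewrite EFinM -muleA lee_wpmul2l//.
  rewrite -ge0_integralZl//; last 2 first.
  - by apply/measurable_EFinP; exact: mG.
  - by move=> t _; rewrite lee_fin mulr_ge0 ?sqr_ge0.
  apply: ge0_le_integral => //.
  - by move=> t _; rewrite -EFinM lee_fin; apply: mulr_ge0; [lra|rewrite mulr_ge0 ?sqr_ge0].
  - by apply: measurable_funeM; apply/measurable_EFinP; exact: mG.
  - by apply: emeasurable_funD; apply/measurable_EFinP; [exact: mA|exact: mB].
  - move=> t _; rewrite -EFinM -EFinD lee_fin /A /B.
    set x := k e * _; set y := k _ * _; set r := rho _.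
    have r0 : 0 <= r by exact: rho0.
    rewrite -mulrDr mulrCA ler_wpM2l//.
    have h := sqr_ge0 (x - s * y).
    have e1 : (s * y) ^+ 2 = y ^+ 2 by rewrite exprMn s1 mul1r.
    rewrite sqrrD e1; rewrite sqrrB e1 in h; lra.
rewrite esumD; last 2 first.
- by move=> e _; apply: mule_ge0 => //; apply: integral_ge0 => t _; rewrite lee_fin.
- by move=> e _; apply: mule_ge0 => //; apply: integral_ge0 => t _; rewrite lee_fin.
apply: lte_add_pinfty => //.
rewrite (_ : esum _ _ = wsum rho k phi)//.
rewrite /wsum [RHS](reindex_esum _ _ _ _ rev_bij); apply: eq_esum => e _.
by rewrite ec_rev.
Qed.

(** For s = 1, the transplantation of the profile phi to the edge e from
    both of its ends; for s = -1, the derivative of the transplantation of a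
    primitive of phi. *)
Definition sym_ext (s : R) (k : edge -> R) (phi : R -> R) (e : edge) (t : R) :=
  k e * phi t + s * (k (rev e) * phi (1 - t)).

Lemma sym_ext_rev k phi (e : edge) t :
  sym_ext 1 k phi (rev e) (1 - t) = sym_ext 1 k phi e t.
Proof. by rewrite /sym_ext revK subKr !mul1r addrC. Qed.

Lemma lift_sym_ext k phi (e : edge) t : 0 < t < 1 ->
  lift (sym_ext 1 k phi) (pt e t) = sym_ext 1 k phi e t.
Proof. by apply: lift_pt => *; exact: sym_ext_rev. Qed.

Lemma measurable_sym_ext s k phi e : measurable_fun I01 phi ->
  measurable_fun I01 (sym_ext s k phi e).
Proof.
move=> mphi; apply: measurable_funD; apply: measurable_funM => //.
by apply: measurable_funM => //; exact: measurable_onem.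
Qed.

Lemma measurable_lift k phi : measurable_fun I01 phi ->
  measurable_fun setT (lift (sym_ext 1 k phi)).
Proof.
move=> mphi; apply: measurable_graph => e.
have h : measurable_fun (`]0, 1[%classic : set R) (sym_ext 1 k phi e).
  by apply: measurable_funS (measurable_sym_ext 1 k e mphi) => //; exact: subset_itv_oo_cc.
apply: eq_measurable_fun h => t /set_mem /=; rewrite in_itv /= => t01.
by rewrite lift_sym_ext.
Qed.

Lemma wnorm2_real d (T : measurableType d) (m : {measure set T -> \bar R}) D (rho f : T -> R) :
  wnorm2 m D rho (fun x => (f x)%:C%C) = (\int[m]_(x in D) (rho x * f x ^+ 2)%:E)%E.
Proof. by apply: eq_integral => x _; rewrite /= expr0n /= addr0. Qed.

Lemma cmeasurable_real d (T : measurableType d) D (f : T -> R) :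
  measurable_fun D f -> cmeasurable D (fun x => (f x)%:C%C).
Proof. by move=> mf; split => //; exact: measurable_cst. Qed.

Lemma L2w_lift (rho : mgraph N -> R) k phi : (forall p, 0 <= rho p) ->
  measurable_fun setT rho -> measurable_fun I01 phi -> (wsum rho k phi < +oo)%E ->
  L2w (m1 N) setT rho (fun p => (lift (sym_ext 1 k phi) p)%:C%C).
Proof.
move=> rho0 mrho mphi ws; have ml := measurable_lift k mphi; split.
  exact: cmeasurable_real.
rewrite wnorm2_real ge0_integral_m1; first last.
- by move=> p; rewrite lee_fin mulr_ge0 ?sqr_ge0.
- by apply/measurable_EFinP; apply: measurable_funM => //; exact: measurable_funX.
apply: le_lt_trans (wsum_sym (s := 1) rho0 mrho mphi _ ws); last by rewrite expr1n.
apply: le_esum => e _; rewrite le_eqVlt; apply/orP; left; apply/eqP; congr (_ * _)%E.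
apply: eq_int_oo.
- apply/measurable_EFinP; apply: measurable_funM; first exact: measurable_edge.
  by apply: measurable_funX; exact: measurable_edge.
- apply/measurable_EFinP; apply: measurable_funM; first exact: measurable_edge.
  by apply: measurable_funX; exact: (measurable_sym_ext 1 k e mphi).
- by move=> t t01; rewrite lift_sym_ext.
Qed.

Lemma cint_real d (T : measurableType d) (m : {measure set T -> \bar R}) D (f : T -> R) :
  cint m D (fun x => (f x)%:C%C) = (\int[m]_(x in D) f x)%:C%C.
Proof.
rewrite /cint /=; congr (_ +i* _)%C.
by rewrite /Rintegral integral0_eq.
Qed.

Lemma cint_leb D (f : R -> R) :
  cint (@Defs.leb R) D (fun x => (f x)%:C%C) = (\int[leb]_(x in D) f x)%:C%C.
Proof. exact: cint_real. Qed.

Lemma prim_is_primitive (u u' : R -> R) : prim u u' ->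
  is_primitive (fun t => (u t)%:C%C) (fun t => (u' t)%:C%C).
Proof. by move=> pu t t01; rewrite cint_leb pu.2// rmorphD. Qed.

Lemma sqi_L2 (f : R -> R) : sqi f -> L2 (@Defs.leb R) `[0, 1]%classic (fun t => (f t)%:C%C).
Proof.
move=> [mf f2]; split; first exact: cmeasurable_real.
rewrite wnorm2_real.
move/integrableP : f2 => [_]; congr (is_true (_ < _)%E).
by apply: eq_integral => t _; rewrite /= mul1r -expr2 ger0_norm// sqr_ge0.
Qed.

Lemma has_csum_real (I : choiceType) (S : set I) (a : I -> R) :
  rsum_to S a 0 -> has_csum S (fun i => (a i)%:C%C) 0.
Proof.
move=> h; split; first exact: h.
exact: (rsum0 S).
Qed.

(** Since h and h' vanish at 1, the value at the vertex x along e is k(e)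
    h(0) and the outgoing derivative is k(e) h'(0); the two alternatives are
    the continuity and the Kirchhoff condition for these values. *)
Lemma laplacian_lift (h h1 h2 : R -> R) k : prim h h1 -> prim h1 h2 -> sqi h2 ->
  h 1 = 0 -> h1 1 = 0 ->
  h 0 = 0 \/ (forall e e', src e = src e' -> k e = k e') ->
  h1 0 = 0 \/ (forall x, rsum_to [set e | src e = x] (fun e => ec e * k e) 0) ->
  (wsum (cst 1%R) k h < +oo)%E -> (wsum (cst 1%R) k h1 < +oo)%E ->
  (wsum (cst 1%R) k h2 < +oo)%E ->
  @laplacian R N (fun p => (lift (sym_ext 1 k h) p)%:C%C)
    (fun p => (lift (sym_ext 1 k (fun t => - h2 t)) p)%:C%C).
Proof.
move=> ph ph1 sh2 h_1 h1_1 cV cK w0 w1 w2.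
have mh := prim_measurable ph; have mh1 := prim_measurable ph1; have mh2 := sh2.1.
have sh := prim_sqi ph; have sh1 := prim_sqi ph1.
have sext (s : R) (e : edge) (u : R -> R) : sqi u -> sqi (sym_ext s k u e).
  by move=> su; apply: sqiD; [exact: sqiZ|apply: sqiZ; apply: sqiZ; exact: sqi_onem].
split.
- exact: (L2w_lift (rho := cst 1)).
- apply: (L2w_lift (rho := cst 1)) => //; first exact: measurableT_comp.
  rewrite (_ : wsum _ _ _ = wsum (cst 1%R) k h2)//.
  by apply: eq_esum => e _; congr (_ * _)%E; apply: eq_integral => t _; rewrite mulrN sqrrN.
exists (fun e t => (sym_ext 1 k h e t)%:C%C), (fun e t => (sym_ext (-1) k h1 e t)%:C%C),
  (fun e t => (sym_ext 1 k h2 e t)%:C%C); split.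
- move=> e; split.
  + by apply: aeW => t /=; rewrite in_itv /= => t01; rewrite lift_sym_ext.
  + apply: prim_is_primitive.
    have := primD (primZ (k e) ph) (primZ 1 (primZ (k (rev e)) (prim_onem ph))).
    by congr prim; apply/funext => t; rewrite /sym_ext; ring.
  + apply: prim_is_primitive.
    have := primD (primZ (k e) ph1) (primZ (-1) (primZ (k (rev e)) (prim_onem ph1))).
    by congr prim; apply/funext => t; rewrite /sym_ext; ring.
  + exact/sqi_L2/sext.
  + exact/sqi_L2/sext.
- have E (s : R) (u : R -> R) : measurable_fun I01 u -> s ^+ 2 = 1 -> (wsum (cst 1%R) k u < +oo)%E ->
    (\esum_(e in [set: edge]) ((ec e / 2)%:E *
       norm2 (@Defs.leb R) `]0%R, 1%R[%classic (fun t => (sym_ext s k u e t)%:C%C)) < +oo)%E.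
    move=> mu s1 ws; have := wsum_sym (fun=> ler01) (measurable_cst _) mu s1 ws.
    apply: le_lt_trans; apply: le_esum => e _; apply: lee_wpmul2l.
      by rewrite lee_fin ec2_ge0.
    rewrite /norm2 wnorm2_real; apply: ge0_subset_integral => //.
    + by apply/measurable_EFinP; apply: measurable_funM => //; apply: measurable_funX; exact: (measurable_sym_ext s k e mu).
    + by move=> t _; rewrite lee_fin mulr_ge0 ?sqr_ge0.
    + exact: subset_itv_oo_cc.
  split; apply: E => //; first by rewrite sqrrN expr1n.
  by rewrite expr1n.
- move=> e e' ee'; rewrite /sym_ext subr0 h_1 !(mulr0, addr0).
  by case: cV => [->|/(_ _ _ ee') ->//]; rewrite !mulr0.
- move=> x; rewrite (_ : (fun e => _) = (fun e : edge => (ec e * (k e * h1 0))%:C%C)).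
    apply: has_csum_real; case: cK => [->|/(_ x) H].
      have := @rsum0 R _ [set e : edge | src e = x].
      by apply: rsum_eq => e _; rewrite !mulr0.
    have := rsumZ (c := h1 0) H; rewrite mulr0; apply: rsum_eq => e _; ring.
  apply/funext => e; rewrite /sym_ext subr0 h1_1 !(mulr0, addr0).
  by rewrite -rmorphM.
- move=> e; apply: aeW => t /=; rewrite in_itv /= => t01; rewrite lift_sym_ext//.
  rewrite -rmorphN; congr (_%:C)%C; rewrite /sym_ext; ring.
Qed.

End test_functions.

(** * Weak eigenfunctions *)

Section weak.
Context {R : realType} (N : network R).
Local Notation leb := (@lebesgue_measure R).
Local Notation I01 := (`[0, 1]%classic : set R).
Local Notation edge := (edge N).

Lemma sqi_int_fin (f : R -> R) : sqi f ->
  (\int[leb]_(t in I01) (f t ^+ 2)%:E = (\int[leb]_(t in I01) (f t * f t))%:E)%E.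
Proof.
by move=> sf; rewrite -Rint_EFin//; exact: sf.2.
Qed.

Section weighted_sums.
Variables (r : mgraph N -> R) (r0 : forall p, 0 <= r p) (mr : measurable_fun setT r).

Lemma wsum_term (e : edge) (B T : R) (k : edge -> R) (phi : R -> R) :
  (forall t, 0 < t -> t < 1 -> t <= T -> r (pt e t) <= B) -> 0 <= B -> sqi phi ->
  (forall t, T < t -> t <= 1 -> phi t = 0) ->
  (\int[leb]_(t in I01) (r (pt e t) * (k e * phi t) ^+ 2)%:E <=
   (B * k e ^+ 2 * \int[leb]_(t in I01) (phi t * phi t))%:E)%E.
Proof.
move=> hB B0 sphi phi0; have mphi := sphi.1.
rewrite EFinM -sqi_int_fin// -ge0_integralZl//; last 3 first.
- by apply/measurable_EFinP; exact: measurable_funX.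
- by move=> t _; rewrite lee_fin sqr_ge0.
- by rewrite lee_fin mulr_ge0 ?sqr_ge0.
apply: le_int_oo.
- apply/measurable_EFinP; apply: measurable_funM; first exact: measurable_edge.
  by apply: measurable_funX; exact: measurable_funM.
- by apply: measurable_funeM; apply/measurable_EFinP; exact: measurable_funX.
- by move=> t _; rewrite lee_fin mulr_ge0 ?sqr_ge0.
- move=> t /andP[t0 t1]; rewrite -EFinM lee_fin exprMn.
  have [tT|Tt] := leP t T; last by rewrite phi0 ?(ltW t1)// expr0n /= !mulr0.
  rewrite -[leRHS]mulrA; apply: ler_wpM2r; last exact: hB.
  by apply: mulr_ge0; exact: sqr_ge0.
Qed.

Lemma wsum_fin (k : edge -> R) (S : seq edge) (phi : R -> R) :
  (forall e : edge, exists B : R, forall t, 0 < t < 1 -> r (pt e t) <= B) ->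
  (forall e, e \notin S -> k e = 0) -> sqi phi -> (wsum r k phi < +oo)%E.
Proof.
move=> rbd k0 sphi.
pose F (e : edge) := ((ec e)%:E * \int[leb]_(t in I01) (r (pt e t) * (k e * phi t) ^+ 2)%:E)%E.
have F0 e : (0 <= F e)%E.
  apply: mule_ge0; first by rewrite lee_fin ltW// ec_gt0.
  by apply: integral_ge0 => t _; rewrite lee_fin mulr_ge0 ?sqr_ge0.
have fS : finite_set [set` S] by exact: finite_seq.
have -> : wsum r k phi = (\esum_(e in [set` S]) F e)%E.
  rewrite [RHS]esum_mkcond; apply: eq_esum => e _; case: ifPn => // eS.
  have ke : k e = 0 by apply: k0; apply/negP => h; move/negP: eS; apply; rewrite inE.
  rewrite integral0_eq ?mule0// => t _.
  by rewrite ke mul0r expr0n mulr0.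
rewrite esum_fset// fsbig_finite//=; apply: lte_sum_pinfty => e _.
have [B hB] := rbd e.
rewrite /F lte_mul_pinfty ?lee_fin ?(ltW (ec_gt0 e))//.
apply: le_lt_trans (@wsum_term e `|B| 1 k phi _ _ sphi _) _.
- by move=> t t0 t1 _; rewrite (le_trans (hB _ _)) ?ler_norm// t0.
- by [].
- by move=> t t1 /(lt_le_trans t1); rewrite ltxx.
- exact: ltry.
Qed.

(** As phi is supported in [0, T], only the bound W on the weight near x
    matters, and the sum over the edges at x is dominated by the sum of c W. *)
Lemma wsum_star (x : vert N) (T : R) (W : edge -> R) (k : edge -> R) (phi : R -> R) :
  0 < T < 1 ->
  (forall (e : edge) t, 0 < t -> t <= T -> r (pt e t) <= W e) ->
  (forall e, src e != x -> k e = 0) -> (forall e, `|k e| <= 1) ->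
  (\esum_(e in [set e : edge | src e = x]) (ec e * W e)%:E < +oo)%E ->
  sqi phi -> (forall t, T < t -> t <= 1 -> phi t = 0) ->
  (wsum r k phi < +oo)%E.
Proof.
move=> T01 rW k0 k1 sW sphi phi0.
have /andP[T0 T1] := T01.
have W0 e : 0 <= W e by apply: le_trans (r0 (pt e T)) (rW _ _ _ _).
have c0 (e : edge) : 0 <= ec e by rewrite ltW// ec_gt0.
have I0 : 0 <= \int[leb]_(t in I01) (phi t * phi t).
  by apply: Rintegral_ge0 => t _; rewrite -expr2 sqr_ge0.
have aW : asum [set e : edge | src e = x] (fun e => ec e * W e).
  rewrite /asum; congr (is_true (_ < _)%E) : sW; apply: eq_esum => e _.
  by rewrite ger0_norm// mulr_ge0.
have := asumZ (\int[leb]_(t in I01) (phi t * phi t)) aW.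
apply: le_lt_trans; rewrite [leRHS]esum_mkcond; apply: le_esum => e _.
case: ifPn => [_|].
  apply: (@le_trans _ _ ((ec e)%:E * (W e * k e ^+ 2 * \int[leb]_(t in I01) (phi t * phi t))%:E)%E).
    apply: lee_wpmul2l; first by rewrite lee_fin.
    by apply: (wsum_term (T := T)) => // t t0 _; exact: rW.
  rewrite -EFinM lee_fin ger0_norm; last by rewrite mulr_ge0// mulr_ge0.
  have k2 : k e ^+ 2 <= 1 by rewrite -[_ ^+ 2]ger0_norm ?sqr_ge0// normrX expr_le1.
  move: (\int[leb]_(t in I01) (phi t * phi t)) I0 => I I0.
  rewrite (_ : _ * (_ * _) = I * (ec e * W e) * k e ^+ 2); last by ring.
  by apply: ler_piMr => //; apply: mulr_ge0 => //; exact: mulr_ge0.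
rewrite notin_setE /= => /eqP ex; rewrite integral0_eq ?mule0// => t _.
by rewrite k0// mul0r expr0n mulr0.
Qed.

End weighted_sums.

Section eigen.
Variables (rho : mgraph N -> R) (rho_gt0 : forall p, 0 < rho p)
  (mrho : measurable_fun setT rho)
  (rho_bd : forall e : edge, exists B : R, forall t, 0 < t < 1 -> rho (pt e t) <= B).
Variables (z : R) (P : mgraph N -> R) (mP : measurable_fun setT P)
  (P_L2 : (\int[m1 N]_p ((rho p)^-1 * P p ^+ 2)%:E < +oo)%E).
Hypothesis P_eigen : forall f h : mgraph N -> R,
  L2w (m1 N) setT rho (fun p => (f p)%:C%C) -> L2w (m1 N) setT rho (fun p => (h p)%:C%C) ->
  @laplacian R N (fun p => (f p)%:C%C) (fun p => (h p)%:C%C) ->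
  \int[m1 N]_p (h p * P p) = z ^+ 2 * \int[m1 N]_p (f p * P p).

Let Pe (e : edge) (t : R) := P (pt e t).

Let mPe e : measurable_fun I01 (Pe e).
Proof. exact: measurable_edge. Qed.

Let mrhoi : measurable_fun setT (fun p => (rho p)^-1).
Proof. exact: measurable_funV_gt0. Qed.

Lemma weighted_edge_P : (\esum_(e in [set: edge])
  ((ec e / 2)%:E * \int[leb]_(t in I01) ((rho (pt e t))^-1 * Pe e t ^+ 2)%:E) < +oo)%E.
Proof.
rewrite -(ge0_integral_m1 (f := fun p => ((rho p)^-1 * P p ^+ 2)%:E))//.
- by apply/measurable_EFinP; apply: measurable_funM => //; exact: measurable_funX.
- by move=> p; rewrite lee_fin mulr_ge0 ?sqr_ge0// invr_ge0 ltW.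
Qed.

(** On a single edge the weight is bounded above, so the weighted norm
    controls the unweighted one. *)
Lemma sqi_edge_P e : sqi (Pe e).
Proof.
split; first exact: mPe.
have [B hB] := rho_bd e.
have B0 : 0 < B by apply: lt_le_trans (rho_gt0 (pt e 2^-1)) (hB _ _); lra.
have a0 (j : edge) : (0 <= (ec j / 2)%:E * \int[leb]_(t in I01) ((rho (pt j t))^-1 * Pe j t ^+ 2)%:E)%E.
  apply: mule_ge0; [by rewrite lee_fin ec2_ge0|apply: integral_ge0 => t _].
  by rewrite lee_fin mulr_ge0 ?sqr_ge0// invr_ge0 ltW.
have := esum_lty_term (i := e) I a0 weighted_edge_P.
have c0 : 0 < ec e / 2 by rewrite divr_gt0// ec_gt0.
have mrPe : measurable_fun I01 (fun t => (rho (pt e t))^-1 * Pe e t ^+ 2).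
  apply: measurable_funM; first exact: (measurable_edge e _ mrhoi).
  by apply: measurable_funX; exact: mPe.
have h1 : (\int[leb]_(t in I01) `|(Pe e t * Pe e t)%:E| <=
   B%:E * \int[leb]_(t in I01) ((rho (pt e t))^-1 * Pe e t ^+ 2)%:E)%E.
  rewrite -ge0_integralZl//; last 3 first.
  - exact/measurable_EFinP.
  - by move=> t _; rewrite lee_fin mulr_ge0 ?sqr_ge0// invr_ge0 ltW.
  - by rewrite lee_fin ltW.
  apply: le_int_oo => //.
  - by apply/measurable_EFinP; apply: measurableT_comp => //; apply: measurable_funM; exact: mPe.
  - by apply: measurable_funeM; exact/measurable_EFinP.
  - move=> t t01; rewrite -EFinM lee_fin -expr2 ger0_norm ?sqr_ge0// mulrA ler_peMl ?sqr_ge0//.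
    by rewrite ler_pdivlMr// mul1r hB.
move=> fin; apply/integrableP; split.
  by apply/measurable_EFinP; apply: measurable_funM; exact: mPe.
apply: le_lt_trans h1 _; rewrite lte_mul_pinfty ?lee_fin ?(ltW B0)//.
rewrite ltey; apply/eqP => Iy; move: fin.
by rewrite Iy mulry gtr0_sg// mul1e ltxx.
Qed.

Definition coef (phi : R -> R) (e : edge) := \int[leb]_(t in I01) (phi t * Pe e t).

(** The part of the test function that comes from the other end of e is,
    after reflection, the part that belongs to rev e. *)
Lemma edge_pairing k phi e : sqi phi ->
  \int[leb]_(t in I01) (lift (sym_ext 1 k phi) (pt e t) * P (pt e t)) =
  k e * coef phi e + k (rev e) * coef phi (rev e).
Proof.
move=> sphi; have mphi := sphi.1.
have sr := sqi_onem sphi.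
have i1 := sqiM sphi (sqi_edge_P e); have i2 := sqiM sr (sqi_edge_P e).
rewrite (_ : coef phi (rev e) = \int[leb]_(t in I01) (phi (1 - t) * Pe e t)); last first.
  rewrite /coef -(Rint_onem01 (f := fun t => phi t * Pe (rev e) t)).
    apply: eq_Rintegral => t /set_mem /=; rewrite in_itv /= => t01.
    by rewrite /Pe pt_rev.
  by apply: measurable_funM => //; exact: mPe.
rewrite -!RintegralZl// -RintegralD//; last 2 first.
- exact: intgZ i1.
- exact: intgZ i2.
apply: eq_Rint_oo.
- apply: measurable_funM; last exact: mPe.
  by apply: measurable_edge => //; exact: measurable_lift.
- by apply: measurable_funD; apply: measurable_funM => //; apply: measurable_funM;
    rewrite ?(measurable_onem mphi)//; first [exact: mPe|exact: measurable_onem].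
- by move=> t t01; rewrite lift_sym_ext// /sym_ext /Pe; ring.
Qed.

Lemma integrable_pairing (f : mgraph N -> R) :
  L2w (m1 N) setT rho (fun p => (f p)%:C%C) ->
  (m1 N).-integrable setT (EFin \o (fun p => f p * P p)).
Proof.
move=> [[mf _]]; rewrite wnorm2_real => ff.
have mf' : measurable_fun setT f by exact: mf.
apply/integrableP; split; first by apply/measurable_EFinP; exact: measurable_funM.
have mA : measurable_fun setT (fun p => rho p * f p ^+ 2).
  by apply: measurable_funM => //; exact: measurable_funX.
have mB : measurable_fun setT (fun p => (rho p)^-1 * P p ^+ 2).
  by apply: measurable_funM => //; exact: measurable_funX.
apply: le_lt_trans (lte_add_pinfty ff P_L2).
rewrite -ge0_integralD//; last 4 first.
- by move=> p _; rewrite lee_fin mulr_ge0 ?sqr_ge0// ltW.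
- exact/measurable_EFinP.
- by move=> p _; rewrite lee_fin mulr_ge0 ?sqr_ge0// invr_ge0 ltW.
- exact/measurable_EFinP.
apply: ge0_le_integral => //.
- by apply/measurable_EFinP; apply: measurableT_comp => //; exact: measurable_funM.
- by apply: emeasurable_funD; exact/measurable_EFinP.
- by move=> p _; rewrite -EFinD lee_fin; exact: am_gm.
Qed.

(** From |u v| <= rho u^2 + v^2 / rho, the weighted form of the inequality
    between the means, on each edge. *)
Lemma coef_asum k g : sqi g -> (wsum rho k g < +oo)%E ->
  asum [set: edge] (fun e => ec e * (k e * coef g e)).
Proof.
move=> sg wg.
have c0 (e : edge) : (0 <= (ec e)%:E)%E by rewrite lee_fin ltW// ec_gt0.
pose A e t := rho (pt e t) * (k e * g t) ^+ 2.
pose B e t := (rho (pt e t))^-1 * Pe e t ^+ 2.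
have A0 e t : 0 <= A e t by rewrite mulr_ge0 ?sqr_ge0// ltW.
have B0 e t : 0 <= B e t by rewrite mulr_ge0 ?sqr_ge0// invr_ge0 ltW.
have mA e : measurable_fun I01 (A e).
  apply: measurable_funM; first exact: measurable_edge.
  by apply: measurable_funX; apply: measurable_funM => //; exact: sg.1.
have mB e : measurable_fun I01 (B e).
  apply: measurable_funM; first exact: (measurable_edge e _ mrhoi).
  by apply: measurable_funX; exact: mPe.
have IA0 e : (0 <= \int[leb]_(t in I01) (A e t)%:E)%E.
  by apply: integral_ge0 => t _; rewrite lee_fin.
have IB0 e : (0 <= \int[leb]_(t in I01) (B e t)%:E)%E.
  by apply: integral_ge0 => t _; rewrite lee_fin.
rewrite /asum.
apply: (@le_lt_trans _ _ (\esum_(e in [set: edge]) ((ec e)%:E * \int[leb]_(t in I01) (A e t)%:E +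
   ((ec e / 2)%:E * \int[leb]_(t in I01) (B e t)%:E + (ec e / 2)%:E * \int[leb]_(t in I01) (B e t)%:E)))%E).
  apply: le_esum => e _; rewrite normrM EFinM ger0_norm; last by rewrite ltW// ec_gt0.
  have -> : ((ec e / 2)%:E * \int[leb]_(t in I01) (B e t)%:E + (ec e / 2)%:E * \int[leb]_(t in I01) (B e t)%:E =
     (ec e)%:E * \int[leb]_(t in I01) (B e t)%:E)%E.
    rewrite -ge0_muleDl ?lee_fin ?ec2_ge0// -EFinD; congr (_%:E * _)%E; lra.
  rewrite -ge0_muleDr// lee_wpmul2l// -ge0_integralD//; last 4 first.
  - by move=> t _; rewrite lee_fin.
  - by apply/measurable_EFinP; exact: mA.
  - by move=> t _; rewrite lee_fin.
  - by apply/measurable_EFinP; exact: mB.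
  have i1 := intgZ (k e) (sqiM sg (sqi_edge_P e)).
  rewrite /coef -RintegralZl//; last exact: sqiM sg (sqi_edge_P e).
  rewrite EFin_normr_Rintegral//.
  apply: le_trans (le_abse_integral _ _ _) _ => //; first exact: measurable_int i1.
  apply: ge0_le_integral => //.
  - by apply: measurableT_comp => //; exact: measurable_int i1.
  - by apply: emeasurable_funD; apply/measurable_EFinP; [exact: mA|exact: mB].
  - by move=> t _; rewrite /= lee_fin mulrA; exact: am_gm.
have hB : (\esum_(e in [set: edge]) ((ec e / 2)%:E * \int[leb]_(t in I01) (B e t)%:E) < +oo)%E by exact: weighted_edge_P.
have p1 e : (0 <= (ec e)%:E * \int[leb]_(t in I01) (A e t)%:E)%E by exact: mule_ge0.
have p2 (e : edge) : (0 <= (ec e / 2)%:E * \int[leb]_(t in I01) (B e t)%:E)%E.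
  by apply: mule_ge0 => //; rewrite lee_fin ec2_ge0.
rewrite esumD//; last by move=> e _; exact: adde_ge0.
by apply: lte_add_pinfty => //; rewrite esumD//; exact: lte_add_pinfty.
Qed.

(** Insert the transplanted solution of h'' + z^2 h = g into the weak
    equation: the terms z^2 h on both sides cancel, and reversal of the
    edges identifies the two halves of the remaining sum. *)
Lemma test_identity (tau : R) k (p q : R) g : 0 <= tau <= 1 -> sqi g ->
  (forall t, tau < t -> t <= 1 -> g t = 0) ->
  \int[leb]_(s in I01) (cosz z s * g s) = - q ->
  \int[leb]_(s in I01) (Phi z s * g s) = p ->
  p = 0 \/ (forall e e', src e = src e' -> k e = k e') ->
  q = 0 \/ (forall x, rsum_to [set e | src e = x] (fun e => ec e * k e) 0) ->
  (forall phi, sqi phi -> (forall t, tau < t -> t <= 1 -> phi t = 0) ->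
     (wsum (cst 1%R) k phi < +oo)%E /\ (wsum rho k phi < +oo)%E) ->
  asum [set: edge] (fun e => ec e * (k e * coef g e)) /\
  tsum [set: edge] (fun e => ec e * (k e * coef g e)) = 0.
Proof.
move=> /andP[tau0 tau1] sg g0 gC gS cV cK wk.
have [ph ph1] := prim_osc z p q sg.
set h := osc z p q g in ph ph1; set h1 := osc1 z p q g in ph ph1.
set h2 := (fun t => _) in ph1.
have van := osc_vanish tau0 sg g0 gC gS.
have [h_1 h1_1] := osc_end gC gS.
have sh := prim_sqi ph; have sh1 := prim_sqi ph1.
have sh2 : sqi h2 by apply: sqiB => //; exact: sqiZ.
have [w0 r0] := wk h sh (fun t a b => (van t a b).1).
have [w1 r1] := wk h1 sh1 (fun t a b => (van t a b).2).
have v2 t : tau < t -> t <= 1 -> h2 t = 0.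
  by move=> a b; rewrite /h2 /h g0// (van t a b).1 mulr0 subr0.
have [w2 r2] := wk h2 sh2 v2.
have [_ w3'] := wk g sg g0.
have sh2' : sqi (fun t => - h2 t).
  by have := sqiZ (-1) sh2; congr sqi; apply/funext => t; rewrite mulN1r.
have r2' : (wsum rho k (fun t => (- h2 t)%R) < +oo)%E.
  have [_] := wk _ sh2' (fun t a b => etrans (congr1 -%R (v2 t a b)) (oppr0 _)).
  exact.
have rho0 x : 0 <= rho x by rewrite ltW.
have L := @laplacian_lift R N h h1 h2 k ph ph1 sh2 h_1 h1_1 _ _ w0 w1 w2.
have Lf := L2w_lift rho0 mrho sh.1 r0.
have Lh := L2w_lift rho0 mrho sh2'.1 r2'.
have cV' : h 0 = 0 \/ (forall e e', src e = src e' -> k e = k e').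
  by case: cV => [p0|]; [left; rewrite /h osc_init|right].
have cK' : h1 0 = 0 \/ (forall x, rsum_to [set e | src e = x] (fun e => ec e * k e) 0).
  by case: cK => [q0|]; [left; rewrite /h1 osc1_init|right].
have := P_eigen Lf Lh (L cV' cK').
have sumE u : sqi u -> L2w (m1 N) setT rho (fun p => (lift (sym_ext 1 k u) p)%:C%C) ->
   asum [set: edge] (fun e => ec e / 2 * (k e * coef u e + k (rev e) * coef u (rev e))) /\
   \int[m1 N]_p (lift (sym_ext 1 k u) p * P p) =
   tsum [set: edge] (fun e => ec e / 2 * (k e * coef u e + k (rev e) * coef u (rev e))).
  move=> su Lu; have [iu a1 ->] := m1_integral (integrable_pairing Lu).
  split; last by apply: eq_tsum => e _; rewrite edge_pairing.
  apply: asum_le a1 => e _; rewrite !normrM ler_wpM2l//.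
  rewrite -edge_pairing//.
  apply: le_trans (le_normr_Rintegral _ (iu e)) _ => //.
  by rewrite ler_norm.
have [af ->] := sumE _ sh Lf; have [ah ->] := sumE _ sh2' Lh.
have tau_asum := coef_asum sg w3'.
pose T e := ec e * (k e * coef g e).
have aT : asum [set: edge] T by [].
have aTr : asum [set: edge] (T \o @rev R N) by rewrite -(asum_reindex T (rev_bij N)).
have tTr : tsum [set: edge] (T \o @rev R N) = tsum [set: edge] T by rewrite -(tsum_reindex T (rev_bij N)).
(* - h'' = z^2 h - g *)
have cE e : coef (fun t => - h2 t) e = z ^+ 2 * coef h e - coef g e.
  have i1 := sqiM sg (sqi_edge_P e); have i2 := sqiM sh (sqi_edge_P e).
  rewrite /coef -RintegralZl// -RintegralB//; last exact: intgZ i2.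
  by apply: eq_Rintegral => t _; rewrite /h2; ring.
rewrite (_ : (fun e => ec e / 2 * (k e * coef (fun t => - h2 t) e + k (rev e) * coef (fun t => - h2 t) (rev e))) =
  (fun e => z ^+ 2 * (ec e / 2 * (k e * coef h e + k (rev e) * coef h (rev e))) +
     (- 2^-1) * (T e + (T \o @rev R N) e))); last first.
  by apply/funext => e; rewrite !cE /T /= ec_rev; field.
rewrite tsumD; [|exact: asumZ|by apply: asumZ; exact: asumD].
rewrite !tsumZ//; last exact: asumD.
rewrite tsumD// tTr => h0; split => //; rewrite -/T; lra.
Qed.

Variable (W : edge -> R).
Hypothesis rhoW : forall (e : edge) t, 0 < t -> t <= 3^-1 -> rho (pt e t) <= W e.
Hypothesis star_c : forall x, (\esum_(e in [set e : edge | src e = x]) (ec e)%:E < +oo)%E.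
Hypothesis star_W : forall x, (\esum_(e in [set e : edge | src e = x]) (ec e * W e)%:E < +oo)%E.

Let rho0 p : 0 <= rho p. Proof. exact: ltW. Qed.
Let wk_fin (S : seq edge) k : (forall e, e \notin S -> k e = 0) ->
  forall phi, sqi phi ->
     (wsum (cst 1%R) k phi < +oo)%E /\ (wsum rho k phi < +oo)%E.
Proof.
move=> kS phi sphi; split; last exact: (wsum_fin rho0 mrho rho_bd kS sphi).
apply: (wsum_fin (r := cst 1) _ _ _ kS sphi) => //.
by move=> e; exists 1.
Qed.

(** With k the indicator of one edge and zero Cauchy data there is no
    condition at the vertices. *)
Lemma edge_form (e : edge) : exists ba : R * R,
  {ae leb, forall t, I01 t -> P (pt e t) = ba.1 * cosz z t + ba.2 * Phi z t}.
Proof.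
have [|b [a H]] := @orthogonal_osc R z (fun t => P (pt e t)) (sqi_edge_P e).
  move=> g sg gC gS.
  pose k (e' : edge) : R := (e' == e)%:R.
  have kS e' : e' \notin [:: e] -> k e' = 0 by rewrite inE /k => /negbTE ->.
  (* The cut-off tau = 1 imposes no condition on the support. *)
  have [||||||_ h] := @test_identity 1 k 0 0 g _ sg _ _ gS.
  - by rewrite ler01 lexx.
  - by move=> t t1 /(lt_le_trans t1); rewrite ltxx.
  - by rewrite oppr0.
  - by left.
  - by left.
  - by move=> phi sphi _; exact: wk_fin kS phi sphi.
  have [e' ee'|_ h'] := @tsum_single R _ (fun e' => ec e' * (k e' * coef g e')) e.
    by rewrite kS ?inE// mul0r mulr0.
  move: h; rewrite h' /k eqxx mul1r => /eqP; rewrite mulf_eq0 gt_eqF ?ec_gt0//= => /eqP.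
  exact.
by exists (b, a).
Qed.

(** For P of the form found in [edge_form], pairing with a source returns
    its Cauchy data. *)
Lemma coef_source (e : edge) (ba : R * R) (p q : R) g : sqi g ->
  {ae leb, forall t, I01 t -> P (pt e t) = ba.1 * cosz z t + ba.2 * Phi z t} ->
  \int[leb]_(s in I01) (cosz z s * g s) = - q ->
  \int[leb]_(s in I01) (Phi z s * g s) = p ->
  coef g e = ba.2 * p - ba.1 * q.
Proof.
move=> sg ae gC gS.
have sP := sqi_edge_P e.
have i1 := sqiM (prim_sqi (prim_cosz z)) sg; have i2 := sqiM (prim_sqi (prim_Phi z)) sg.
transitivity (\int[leb]_(s in I01) (ba.1 * (cosz z s * g s) + ba.2 * (Phi z s * g s))); last first.
  by rewrite RintegralD ?RintegralZl ?gC ?gS//; [ring|exact: intgZ|exact: intgZ].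
rewrite /coef /Rintegral; congr fine; apply: ae_eq_integral => //.
- exact: measurable_int (sqiM sg sP).
- exact: measurable_int (intgD (intgZ ba.1 i1) (intgZ ba.2 i2)).
- case: ae => A [mA A0 sub]; exists A; split => // t h; apply: sub => h'; apply: h => /= t01.
  by rewrite /Pe h'//; congr EFin; ring.
Qed.

(** With k the indicator of the edges that start at x, p = 1 and q = 0,
    [test_identity] is the assertion itself. *)
Lemma kirchhoff (ba : edge -> R * R) :
  (forall e, {ae leb, forall t, I01 t -> P (pt e t) = (ba e).1 * cosz z t + (ba e).2 * Phi z t}) ->
  forall x, asum [set e : edge | src e = x] (fun e => ec e * (ba e).2) /\
    rsum_to [set e : edge | src e = x] (fun e => ec e * (ba e).2) 0.
Proof.
move=> baE x; have [g [sg g0 gC gS]] := @source_exists R z 1 0.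
pose k (e : edge) : R := (src e == x)%:R.
have k0 e : src e != x -> k e = 0 by rewrite /k => /negbTE ->.
have k1 e : `|k e| <= 1 by rewrite /k; case: eqP; rewrite ?normr1 ?normr0.
have g0' t : 3^-1 < t -> t <= 1 -> g t = 0 by move=> + _; exact: g0.
have T01 : 0 < (3^-1 : R) < 1 by lra.
have [||||a1 t1] := @test_identity 3^-1 k 1 0 g _ sg g0' gC gS.
- by lra.
- by right => e e' ee'; rewrite /k ee'.
- by left.
- move=> phi sphi phi0; split.
    apply: (@wsum_star (cst 1) (fun=> ler01) (measurable_cst _) x 3^-1 (cst 1) k phi) => //.
    by under eq_esum do rewrite mulr1.
  exact: (@wsum_star rho rho0 mrho x 3^-1 W k phi).
have E : (fun e => ec e * (k e * coef g e)) =
    (fun e : edge => if e \in [set e : edge | src e = x] then ec e * (ba e).2 else 0).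
  apply/funext => e; rewrite (coef_source sg (baE e) gC gS) mulr0 subr0 mulr1 /k.
  case: ifPn => [/set_mem /= ->|]; first by rewrite eqxx mul1r.
  by rewrite notin_setE /= => /eqP/negbTE ->; rewrite mul0r mulr0.
rewrite E in a1 t1; split.
  move: a1; rewrite /asum [in X in _ -> X]esum_mkcond; congr (is_true (_ < _)%E).
  by apply: eq_esum => e _; case: ifP => //; rewrite normr0.
by apply: rsum_mkcond; have := asum_rsum a1; rewrite t1; exact.
Qed.

(** With k = 1/c on e, k = -1/c on e', p = 0 and q = 1; the division by c
    makes k satisfy the Kirchhoff condition, and [test_identity] reads b(e')
    - b(e) = 0. *)
Lemma vertex_continuity (ba : edge -> R * R) :
  (forall e, {ae leb, forall t, I01 t -> P (pt e t) = (ba e).1 * cosz z t + (ba e).2 * Phi z t}) ->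
  forall e e', src e = src e' -> (ba e).1 = (ba e').1.
Proof.
move=> baE e e' ee'; have [g [sg g0 gC gS]] := @source_exists R z 0 1.
pose k (f : edge) : R := ((f == e)%:R - (f == e')%:R) / ec f.
have kS f : f \notin [:: e; e'] -> k f = 0.
  by rewrite !inE negb_or /k => /andP[/negbTE -> /negbTE ->]; rewrite subrr mul0r.
have c0 (f : edge) : ec f != 0 by rewrite gt_eqF// ec_gt0.
have ck f : ec f * k f = (f == e)%:R - (f == e')%:R by rewrite /k mulrC divfK.
have [|||||_ tE] := @test_identity 1 k 0 1 g _ sg _ gC gS.
- by rewrite ler01 lexx.
- by move=> t t1 /(lt_le_trans t1); rewrite ltxx.
- by left.
- right => x; apply: (@rsum_eq _ _ _ (fun f : edge => (f == e)%:R - (f == e')%:R)).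
    by move=> f _; rewrite ck.
  have := rsumB (@rsum_single R _ [set f : edge | src f = x] e) (@rsum_single R _ [set f : edge | src f = x] e').
  rewrite (_ : (e' \in _) = (e \in [set f : edge | src f = x])) ?subrr//.
  by apply/idP/idP; rewrite !inE /= ee'.
- by move=> phi sphi _; exact: wk_fin kS phi sphi.
move: tE.
have single (i : edge) (y : R) := @tsum_single R _ (fun f => (f == i)%:R * y) i.
have [f /negbTE ->|a1 t1] := single e (- (ba e).1); first by rewrite mul0r.
have [f /negbTE ->|a2 t2] := single e' ((ba e').1); first by rewrite mul0r.
rewrite (_ : (fun f => _) = (fun f => (f == e)%:R * - (ba e).1 + (f == e')%:R * (ba e').1)); last first.
  apply/funext => f; rewrite mulrA ck (coef_source sg (baE f) gC gS) mulr0 sub0r mulr1.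
  rewrite mulrBl; congr (_ + _); first by case: eqP => [->//|_]; rewrite !mul0r.
  by case: eqP => [->|_]; rewrite ?mul0r ?oppr0// mul1r mul1r opprK.
rewrite tsumD// t1 t2 !eqxx !mul1r => /eqP; rewrite addrC subr_eq0 => /eqP ->//.
Qed.

End eigen.
End weak.

(** * The Hilbert space of square integrable complex functions *)

Section complex_L2.
Context {R : realType} {d : measure_display} {T : measurableType d}.
Variable m : {measure set T -> \bar R}.
Implicit Types (u v : T -> R) (f g h : T -> R[i]).
Local Notation Re := (@complex.Re R).
Local Notation Im := (@complex.Im R).

Definition sq_integrable u := measurable_fun setT u /\ m.-integrable setT (EFin \o (fun t => u t * u t)).

Lemma integrableRD u v : m.-integrable setT (EFin \o u) -> m.-integrable setT (EFin \o v) ->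
  m.-integrable setT (EFin \o (fun t => u t + v t)).
Proof. by move=> fi gi; have := integrableD _ fi gi; exact. Qed.

Lemma integrableRZ (c : R) u : m.-integrable setT (EFin \o u) ->
  m.-integrable setT (EFin \o (fun t => c * u t)).
Proof. by move=> fi; have := @integrableZl _ _ _ m setT _ c _ fi; exact. Qed.

Lemma RintD u v : m.-integrable setT (EFin \o u) -> m.-integrable setT (EFin \o v) ->
  \int[m]_x (u x + v x) = \int[m]_x u x + \int[m]_x v x.
Proof. by move=> fi gi; rewrite RintegralD. Qed.

Lemma RintZ (c : R) u : m.-integrable setT (EFin \o u) ->
  \int[m]_x (c * u x) = c * \int[m]_x u x.
Proof. by move=> fi; rewrite RintegralZl. Qed.

Lemma sq_integrableM u v : sq_integrable u -> sq_integrable v -> m.-integrable setT (EFin \o (fun t => u t * v t)).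
Proof.
move=> [mu u2] [mv v2]; apply: le_integrable (integrableRD u2 v2) => //.
  by apply/measurable_EFinP; exact: measurable_funM.
move=> t _ /=; rewrite lee_fin; apply: le_trans (ler_norm _).
by have := am_gm (u t) (v t) (@ltr01 R); rewrite invr1 !mul1r !expr2.
Qed.

Lemma L2_parts f : L2 m setT f <-> sq_integrable (Re \o f) /\ sq_integrable (Im \o f).
Proof.
split.
- move=> [[mr mi]]; rewrite /wnorm2 => fin.
  have part (u : T -> R) : measurable_fun setT u -> (forall x, u x ^+ 2 <= Re (f x) ^+ 2 + Im (f x) ^+ 2) -> sq_integrable u.
    move=> mu ule; split => //; apply/integrableP; split.
      by apply/measurable_EFinP; exact: measurable_funM.
    apply: le_lt_trans fin; apply: ge0_le_integral => //.
    + by apply/measurable_EFinP; apply: measurableT_comp => //; exact: measurable_funM.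
    + apply/measurable_EFinP; apply: measurable_funM => //.
      by apply: measurable_funD; exact: measurable_funX.
    + by move=> x _; rewrite /= lee_fin mul1r -expr2 ger0_norm ?sqr_ge0.
  split; apply: part => // x; rewrite ?lerDl ?lerDr sqr_ge0//.
- move=> [[mr r2] [mi i2]]; split; first by split.
  have := integrable_lty measurableT (integrableRD r2 i2); apply: le_lt_trans.
  rewrite le_eqVlt; apply/orP; left; apply/eqP; apply: eq_integral => x _.
  by rewrite /= mul1r !expr2.
Qed.

Definition rnorm2 f := \int[m]_x (Re (f x) * Re (f x)) + \int[m]_x (Im (f x) * Im (f x)).

Lemma norm2_fin f : L2 m setT f -> norm2 m setT f = (rnorm2 f)%:E.
Proof.
move=> /L2_parts [[mr r2] [mi i2]]; rewrite /rnorm2 -RintD// /Rintegral fineK.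
  by apply: eq_integral => x _; rewrite /= mul1r !expr2.
by apply: integrable_fin_num => //; exact: integrableRD.
Qed.

Lemma L2_lin (a : R[i]) f g : L2 m setT f -> L2 m setT g ->
  L2 m setT (fun x => a * f x + g x).
Proof.
have lin (c e : R) u v w : sq_integrable u -> sq_integrable v -> sq_integrable w -> sq_integrable (fun t => c * u t + e * v t + w t).
  move=> su sv sw; split.
    by apply: measurable_funD; [apply: measurable_funD; apply: measurable_funM => //; [exact: su.1|exact: sv.1]|exact: sw.1].
  have H := integrableRD (integrableRD (integrableRD (integrableRZ (c * c) su.2) (integrableRZ (e * e) sv.2)) (integrableRD (integrableRZ (2 * c * e) (sq_integrableM su sv)) (integrableRZ (2 * c) (sq_integrableM su sw))))
     (integrableRD (integrableRZ (2 * e) (sq_integrableM sv sw)) sw.2).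
  by congr (is_true (integrable _ _ _)) : H; apply/funext => t /=; congr EFin; ring.
move=> /L2_parts [fr fi] /L2_parts [gr gi]; apply/L2_parts; split.
- have := lin (Re a) (- Im a) _ _ _ fr fi gr; congr sq_integrable; apply/funext => x /=.
  by case: a (f x) (g x) => [a1 a2] [f1 f2] [g1 g2] /=; ring.
- have := lin (Im a) (Re a) _ _ _ fr fi gi; congr sq_integrable; apply/funext => x /=.
  by case: a (f x) (g x) => [a1 a2] [f1 f2] [g1 g2] /=; ring.
Qed.

Lemma ae_norm2 f g : L2 m setT f -> L2 m setT g -> ceq m setT f g ->
  norm2 m setT f = norm2 m setT g.
Proof.
move=> [[mfr mfi] _] [[mgr mgi] _] fg.
have ms h : measurable_fun setT (fun x => Re (h x)) -> measurable_fun setT (fun x => Im (h x)) ->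
    measurable_fun setT (fun x => (cst 1 x * (Re (h x) ^+ 2 + Im (h x) ^+ 2))%:E).
  move=> mr mi; apply/measurable_EFinP; apply: measurable_funM => //.
  by apply: measurable_funD; exact: measurable_funX.
apply: ge0_ae_eq_integral => //.
- exact: ms.
- exact: ms.
- by move=> x _; rewrite lee_fin mul1r addr_ge0 ?sqr_ge0.
- by move=> x _; rewrite lee_fin mul1r addr_ge0 ?sqr_ge0.
- by apply: ae_mono fg => x h _; rewrite h.
Qed.

Lemma norm2_eq0 f : L2 m setT f -> norm2 m setT f = 0%E -> ceq m setT f (cst 0).
Proof.
move=> [[mr mi] _] n0.
have mE : measurable_fun setT (fun x => (cst 1 x * (Re (f x) ^+ 2 + Im (f x) ^+ 2))%:E).
  apply/measurable_EFinP; apply: measurable_funM => //.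
  by apply: measurable_funD; exact: measurable_funX.
have : (\int[m]_(x in setT) `|(cst 1 x * (Re (f x) ^+ 2 + Im (f x) ^+ 2))%:E| = 0)%E.
  rewrite -n0; apply: eq_integral => x _.
  by rewrite /= ger0_norm// mul1r addr_ge0 ?sqr_ge0.
move=> /(ae_eq_integral_abs m measurableT mE); apply: ae_mono => x h _.
have := h I => -[] /=; rewrite mul1r => /eqP.
rewrite paddr_eq0 ?sqr_ge0// !sqrf_eq0 => /andP[/eqP a /eqP b].
by case: (f x) a b => a b /= -> ->.
Qed.

Lemma norm2_ge0 D f : (0 <= norm2 m D f)%E.
Proof. by apply: integral_ge0 => x _; rewrite lee_fin mul1r addr_ge0 ?sqr_ge0. Qed.

Lemma pairingE f g : L2 m setT f -> L2 m setT g -> pairing m f g =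
  ((\int[m]_x (Re (f x) * Re (g x)) + \int[m]_x (Im (f x) * Im (g x))) +i*
   (\int[m]_x (Im (f x) * Re (g x)) - \int[m]_x (Re (f x) * Im (g x))))%C.
Proof.
move=> /L2_parts [fr fi] /L2_parts [gr gi].
rewrite /pairing /cint -RintD; [|exact: sq_integrableM|exact: sq_integrableM].
rewrite -mulN1r -(RintZ (-1) (sq_integrableM fr gi)).
rewrite -(RintD (sq_integrableM fi gr) (integrableRZ (-1) (sq_integrableM fr gi))).
congr (_ +i* _)%C; apply: eq_Rintegral => x _ /=; case: (f x) (g x) => [a b] [c e] /=; ring.
Qed.

Lemma sq_expand (c e : R) u v w : sq_integrable u -> sq_integrable v -> sq_integrable w ->
  \int[m]_x ((u x + (c * v x + e * w x)) * (u x + (c * v x + e * w x))) =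
  \int[m]_x (u x * u x) + c ^+ 2 * \int[m]_x (v x * v x) + e ^+ 2 * \int[m]_x (w x * w x) +
  2 * c * \int[m]_x (u x * v x) + 2 * e * \int[m]_x (u x * w x) +
  2 * c * e * \int[m]_x (v x * w x).
Proof.
move=> su sv sw.
have iu := su.2; have iv := integrableRZ (c ^+ 2) sv.2; have iw := integrableRZ (e ^+ 2) sw.2.
have iuv := integrableRZ (2 * c) (sq_integrableM su sv); have iuw := integrableRZ (2 * e) (sq_integrableM su sw).
have ivw := integrableRZ (2 * c * e) (sq_integrableM sv sw).
rewrite -(RintZ (c ^+ 2) sv.2) -(RintZ (e ^+ 2) sw.2) -(RintZ (2 * c) (sq_integrableM su sv)).
rewrite -(RintZ (2 * e) (sq_integrableM su sw)) -(RintZ (2 * c * e) (sq_integrableM sv sw)).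
rewrite -RintD// -RintD//; last exact: integrableRD.
rewrite -RintD//; last by do 2 apply: integrableRD => //.
rewrite -RintD//; last by do 3 apply: integrableRD => //.
rewrite -RintD//; last by do 4 apply: integrableRD => //.
by apply: eq_Rintegral => x _; ring.
Qed.

(** With a = e1 + i e2 this is the expansion of |f + a h|^2, in real
    coordinates. *)
Lemma rnorm2_lin (e1 e2 : R) f h g : L2 m setT f -> L2 m setT h ->
  (forall x, Re (g x) = Re (f x) + (e1 * Re (h x) + (- e2) * Im (h x))) ->
  (forall x, Im (g x) = Im (f x) + (e1 * Im (h x) + e2 * Re (h x))) ->
  rnorm2 g = rnorm2 f + (e1 ^+ 2 + e2 ^+ 2) * rnorm2 h +
    2 * e1 * (\int[m]_x (Re (f x) * Re (h x)) + \int[m]_x (Im (f x) * Im (h x))) +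
    2 * e2 * (\int[m]_x (Im (f x) * Re (h x)) - \int[m]_x (Re (f x) * Im (h x))).
Proof.
move=> /L2_parts [fr fi] /L2_parts [hr hi] gr gi; rewrite {1}/rnorm2.
under eq_Rintegral do rewrite gr.
under [X in _ + X]eq_Rintegral do rewrite gi.
rewrite (sq_expand e1 (- e2) fr hr hi) (sq_expand e1 e2 fi hi hr) /rnorm2 /=.
have -> : \int[m]_x (Im (h x) * Re (h x)) = \int[m]_x (Re (h x) * Im (h x)).
  by apply: eq_Rintegral => x _; rewrite mulrC.
ring.
Qed.

Lemma polarization f h (n : nat -> R) : L2 m setT f -> L2 m setT h ->
  (forall k, (k < 4)%N -> n k = rnorm2 (fun x => f x + 'i%C ^+ k * h x)) ->
  pairing m f h = 4^-1 * \sum_(k < 4) 'i%C ^+ k * (n k)%:C%C.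
Proof.
move=> Lf Lh nE; rewrite pairingE//.
have n0 : n 0%N = _ := etrans (nE 0%N isT) (@rnorm2_lin 1 0 f h _ Lf Lh _ _).
have n1 : n 1%N = _ := etrans (nE 1%N isT) (@rnorm2_lin 0 1 f h _ Lf Lh _ _).
have n2' : n 2%N = _ := etrans (nE 2%N isT) (@rnorm2_lin (-1) 0 f h _ Lf Lh _ _).
have n3 : n 3%N = _ := etrans (nE 3%N isT) (@rnorm2_lin 0 (-1) f h _ Lf Lh _ _).
rewrite !big_ord_recl big_ord0 /= /bump /= !add1n.
set X := _ + _; set Y := _ - _.
have h4 : (4 : R[i]) != 0 by rewrite pnatr_eq0.
apply: (mulfI h4); rewrite mulrA mulfV// mul1r.
have -> : (4 : R[i]) = (4 : R)%:C%C by rewrite rmorph_nat.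
rewrite n0; [|move=> x; rewrite expr0 mul1r; case: (f x) (h x) => [a b] [c e] /=; ring..].
rewrite n1; [|move=> x; rewrite expr1; case: (f x) (h x) => [a b] [c e] /=; ring..].
have i2 : 'i%C ^+ 2 = -1 :> R[i] by rewrite sqr_i.
rewrite n2'; [|move=> x; rewrite i2; case: (f x) (h x) => [a b] [c e] /=; ring..].
have i3 : 'i%C ^+ 3 = - 'i%C :> R[i] by rewrite exprS i2 mulrN1.
rewrite n3; [|move=> x; rewrite i3; case: (f x) (h x) => [a b] [c e] /=; ring..].
rewrite expr0 expr1 i2 i3 -/X -/Y.
apply/eqP; rewrite eq_complex /=; apply/andP; split; apply/eqP; ring.
Qed.

End complex_L2.

(** * Nonnegativity of the Laplacian *)

Section nonneg.
Context {R : realType} (N : network R).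
Local Notation leb := (@lebesgue_measure R).
Local Notation I01 := (`[0, 1]%classic : set R).
Local Notation edge := (edge N).

Section real_part.
Variables (f g : mgraph N -> R) (mf : measurable_fun setT f) (mg : measurable_fun setT g).
Hypothesis f2 : (\int[m1 N]_p (f p ^+ 2)%:E < +oo)%E.
Hypothesis g2 : (\int[m1 N]_p (g p ^+ 2)%:E < +oo)%E.
Variables u0 u1 u2 : edge -> R -> R.
Hypothesis fu0 : forall e, {ae leb, forall t, `]0, 1[%classic t -> f (pt e t) = u0 e t}.
Hypothesis gu2 : forall e, {ae leb, forall t, `]0, 1[%classic t -> g (pt e t) = - u2 e t}.
Hypothesis p01 : forall e, prim (u0 e) (u1 e).
Hypothesis p12 : forall e, prim (u1 e) (u2 e).
Hypothesis su2 : forall e, sqi (u2 e).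
Hypothesis s1 : (\esum_(e in [set: edge]) (ec e / 2 * \int[leb]_(t in I01) (u1 e t * u1 e t))%:E < +oo)%E.
Hypothesis s2 : (\esum_(e in [set: edge]) (ec e / 2 * \int[leb]_(t in I01) (u2 e t * u2 e t))%:E < +oo)%E.
Hypothesis cont : forall e e', src e = src e' -> u0 e 0 = u0 e' 0.
Hypothesis kirch : forall x, rsum_to [set e | src e = x] (fun e => ec e * u1 e 0) 0.

(** The representatives of f on e and on rev e are reflections of each
    other, and they agree everywhere by continuity. *)
Lemma trace_rev e : u0 e 1 = u0 (rev e) 0 /\ u1 e 1 = - u1 (rev e) 0.
Proof.
have p0 := primB (prim_onem (p01 (rev e))) (p01 e).
have pd := primZ (-1) (primD (prim_onem (p12 (rev e))) (primZ (-1) (p12 e))).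
have pd' : prim (fun t => - u1 (rev e) (1 - t) - u1 e t) (fun t => u2 (rev e) (1 - t) - u2 e t).
  have := primB (primZ (-1) (prim_onem (p12 (rev e)))) (p12 e).
  by congr prim; apply/funext => t; ring.
(* The two representatives agree almost everywhere, hence everywhere, and then
   so do their derivatives. *)
have D0 : {ae leb, forall t, I01 t -> u0 (rev e) (1 - t) - u0 e t = 0}.
  apply: ae_cc; have := ae_onem (fu0 (rev e)); have := fu0 e.
  apply: ae_mono2 => t h h' t01; rewrite -h//.
  have t01' : `]0, 1[%classic (1 - t) by move: t01; rewrite /= !in_itv /=; lra.
  rewrite -h'// pt_rev ?subrr//.
  by move: t01; rewrite /= in_itv /=; lra.
have Dz := prim_ae0 p0 D0.
have dz := prim0_deriv p0 pd' Dz.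
have h01 : 0 <= (1 : R) <= 1 by rewrite ler01 lexx.
have := Dz 1 h01; have := dz 1 h01; rewrite subrr => a b; split; lra.
Qed.

Let su0 e : sqi (u0 e). Proof. exact: prim_sqi (p01 e). Qed.
Let su1 e : sqi (u1 e). Proof. exact: prim_sqi (p12 e). Qed.

Lemma asum_u0 : asum [set: edge] (fun e => ec e / 2 * \int[leb]_(t in I01) (u0 e t * u0 e t)).
Proof.
move: f2; rewrite ge0_integral_m1; first last.
- by move=> p; rewrite lee_fin sqr_ge0.
- by apply/measurable_EFinP; exact: measurable_funX.
apply: le_lt_trans; apply: le_esum => e _.
rewrite ger0_norm; last first.
  by rewrite mulr_ge0 ?ec2_ge0// Rintegral_ge0// => t _; rewrite -expr2 sqr_ge0.
rewrite EFinM -Rint_EFin//; last exact: (su0 e).2.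
rewrite le_eqVlt; apply/orP; left; apply/eqP; congr (_ * _)%E.
apply: ae_eq_integral => //.
- exact: measurable_int (su0 e).2.
- by apply/measurable_EFinP; apply: measurable_funX; exact: measurable_edge.
- have := ae_cc (fu0 e); apply: ae_mono => t h /h ->.
  by rewrite expr2.
Qed.

Let beta (e : edge) := ec e * (u1 e 0 * u0 e 0).

Lemma asum_ge0E (a : edge -> R) : (forall e, 0 <= a e) ->
  (\esum_(e in [set: edge]) (a e)%:E < +oo)%E -> asum [set: edge] a.
Proof.
by move=> a0; rewrite /asum; under [in X in _ -> X]eq_esum do rewrite ger0_norm//.
Qed.

Let I2 (u : R -> R) := \int[leb]_(t in I01) (u t * u t).
Let I2_ge0 u : 0 <= I2 u.
Proof. by rewrite /I2 Rintegral_ge0// => t _; rewrite -expr2 sqr_ge0. Qed.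

(** [trace_bound] for u and u' bounds each boundary term by the integrals of
    u^2, u'^2 and u''^2 over the edge. *)
Lemma asum_beta : asum [set: edge] beta.
Proof.
have a1 : asum [set: edge] (fun e => ec e / 2 * I2 (u1 e)).
  by apply: asum_ge0E => // e; rewrite mulr_ge0 ?ec2_ge0.
have a2 : asum [set: edge] (fun e => ec e / 2 * I2 (u2 e)).
  by apply: asum_ge0E => // e; rewrite mulr_ge0 ?ec2_ge0.
have a3 := asumD (asumD (asumZ 3 a1) a2) (asumZ 2 asum_u0).
apply: asum_le a3 => e _.
have t1 := trace_bound (p01 e) (su1 e); have t2 := trace_bound (p12 e) (su2 e).
rewrite -/(I2 _) -/(I2 _) in t1; rewrite -/(I2 _) -/(I2 _) in t2.
have c0 := ec_gt0 e.
rewrite -/(I2 _) (_ : _ + _ = ec e / 2 * (3 * I2 (u1 e) + I2 (u2 e) + 2 * I2 (u0 e))); last by field.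
rewrite [leRHS]ger0_norm; last by rewrite mulr_ge0 ?ec2_ge0// !addr_ge0// mulr_ge0.
rewrite /beta normrM gtr0_norm// -mulrA; apply: ler_wpM2l; first exact: ltW.
(* |x y| <= (x^2 + y^2) / 2 with x = u'(0) and y = u(0). *)
move: (I2 (u1 e)) (I2 (u2 e)) (I2 (u0 e)) t1 t2 => a b c t1 t2.
move: (u1 e 0) (u0 e 0) t1 t2 => x y t1 t2.
have h1 := sqr_ge0 (x - y); have h2 := sqr_ge0 (x + y).
rewrite sqrrB !expr2 in h1; rewrite sqrrD !expr2 in h2.
by case: (leP 0 (x * y)) => h; [rewrite ger0_norm//|rewrite ltr0_norm//]; lra.
Qed.

(** On the edges that start at x the factor u(0) is constant, and the
    derivatives sum to 0 with the weights c. *)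
Lemma tsum_beta : tsum [set: edge] beta = 0.
Proof.
apply: (tsum_fibers (f := @src R N)) asum_beta _ => x.
apply: tsumE; first by apply: asumS asum_beta.
have [[e0 xe0]|nx] := pselect (exists e0 : edge, src e0 = x); last first.
  apply: rsum_eq (kirch x) => e /= ex.
  by exfalso; apply: nx; exists e.
have := rsumZ (c := u0 e0 0) (kirch x); rewrite mulr0; apply: rsum_eq => e /= ex.
by rewrite /beta (cont (e := e) (e' := e0)) ?xe0//; ring.
Qed.

(** Integrate by parts on each edge.  By [trace_rev] the boundary terms are
    beta(e) and beta(rev e), and the beta(e) have sum 0. *)
Lemma real_form_ge0 : 0 <= \int[m1 N]_p (g p * f p).
Proof.
have iF : (m1 N).-integrable setT (EFin \o (fun p => g p * f p)).
  apply/integrableP; split; first by apply/measurable_EFinP; exact: measurable_funM.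
  have mF2 : measurable_fun setT (fun p => (f p ^+ 2)%:E) by apply/measurable_EFinP; exact: measurable_funX.
  have mG2 : measurable_fun setT (fun p => (g p ^+ 2)%:E) by apply/measurable_EFinP; exact: measurable_funX.
  apply: le_lt_trans (lte_add_pinfty g2 f2).
  rewrite -ge0_integralD//; last 2 first.
  - by move=> p _; rewrite lee_fin sqr_ge0.
  - by move=> p _; rewrite lee_fin sqr_ge0.
  apply: ge0_le_integral => //.
  - by apply/measurable_EFinP; apply: measurableT_comp => //; exact: measurable_funM.
  - exact: emeasurable_funD.
  - move=> p _; rewrite -EFinD lee_fin.
    by have := am_gm (g p) (f p) (@ltr01 R); rewrite invr1 !mul1r.
have [ie aF ->] := m1_integral iF.
have a1 : asum [set: edge] (fun e => ec e / 2 * I2 (u1 e)).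
  by apply: asum_ge0E => // e; rewrite mulr_ge0 ?ec2_ge0.
have ab := asum_beta.
have aTr : asum [set: edge] (beta \o @rev R N) by rewrite -(asum_reindex beta (rev_bij N)).
have tTr : tsum [set: edge] (beta \o @rev R N) = 0 by rewrite -(tsum_reindex beta (rev_bij N)) tsum_beta.
have E e : ec e / 2 * \int[leb]_(t in I01) (g (pt e t) * f (pt e t)) =
    ec e / 2 * I2 (u1 e) + 2^-1 * (beta e + (beta \o @rev R N) e).
  have -> : \int[leb]_(t in I01) (g (pt e t) * f (pt e t)) = - \int[leb]_(t in I01) (u2 e t * u0 e t).
    have i1 := sqiM (su2 e) (su0 e).
    rewrite -mulN1r -RintegralZl// /Rintegral; congr fine; apply: ae_eq_integral => //.
    - exact: measurable_int (ie e).
    - exact: measurable_int (intgZ (-1) i1).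
    - have := ae_cc (fu0 e); have := ae_cc (gu2 e).
      by apply: ae_mono2 => t h h' t01; rewrite h// h'//; congr EFin; ring.
  have p := primM (p12 e) (p01 e).
  have := p.2 1; rewrite lexx ler01 => /(_ isT).
  have [-> ->] := trace_rev e.
  rewrite RintegralD//; [|exact: sqiM|exact: sqiM].
  rewrite -/(I2 (u1 e)) /beta /= ec_rev.
  move: (\int[leb]_(t in I01) (u2 e t * u0 e t)) => J h.
  have -> : J = - u1 (rev e) 0 * u0 (rev e) 0 - u1 e 0 * u0 e 0 - I2 (u1 e) by lra.
  by field.
rewrite (eq_tsum (b := fun e => ec e / 2 * I2 (u1 e) + 2^-1 * (beta e + (beta \o @rev R N) e))) //.
rewrite tsumD//; last by apply: asumZ; exact: asumD.
rewrite tsumZ; last exact: asumD.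
rewrite tsumD// tTr tsum_beta addr0 mulr0 addr0.
by apply: tsum_ge0 => e _; rewrite mulr_ge0 ?ec2_ge0.
Qed.

End real_part.
End nonneg.

Section form.
Context {R : realType} (N : network R).
Local Notation leb := (@lebesgue_measure R).
Local Notation I01 := (`[0, 1]%classic : set R).

(** Indexing the two real coordinates by a boolean lets one proof treat both
    of them. *)
Definition cpart (b : bool) (x : R[i]) : R :=
  if b then complex.Re x else complex.Im x.

Lemma cpart_sqr b x : cpart b x * cpart b x <= complex.Re x ^+ 2 + complex.Im x ^+ 2.
Proof. by case: b; rewrite /= -expr2 ?lerDl ?lerDr sqr_ge0. Qed.

Lemma cpartN b x : cpart b (- x) = - cpart b x.
Proof. by case: b; case: x. Qed.

Lemma cpartZ b (c : R) x : cpart b (c%:C%C * x) = c * cpart b x.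
Proof. by case: b; case: x => p q /=; ring. Qed.

Lemma has_csum_part b (I : choiceType) (S : set I) (c : I -> R) (a : I -> R[i]) :
  has_csum S (fun i => (c i)%:C%C * a i) 0 -> rsum_to S (fun i => c i * cpart b (a i)) 0.
Proof.
by move=> [hr hi]; case: b; [apply: rsum_eq hr|apply: rsum_eq hi] => i _;
  case: (a i) => p q /=; ring.
Qed.

Lemma L2_sqi b (u : R -> R[i]) : L2 (@Defs.leb R) I01 u -> sqi (fun t => cpart b (u t)).
Proof.
move=> [[mr mi] fin].
have mb : measurable_fun I01 (fun t => cpart b (u t)) by case: b.
split=> //; apply/integrableP; split; first by apply/measurable_EFinP; exact: measurable_funM.
apply: le_lt_trans fin; apply: ge0_le_integral => //.
- by apply/measurable_EFinP; apply: measurableT_comp => //; exact: measurable_funM.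
- apply/measurable_EFinP; apply: measurable_funM => //.
  by apply: measurable_funD; exact: measurable_funX.
- move=> t _; rewrite lee_fin mul1r ger0_norm ?cpart_sqr//.
  by rewrite -expr2 sqr_ge0.
Qed.

Lemma le_norm2_oo b (u : R -> R[i]) : L2 (@Defs.leb R) I01 u ->
  ((\int[leb]_(t in I01) (cpart b (u t) * cpart b (u t)))%:E <=
    norm2 (@Defs.leb R) `]0%R, 1%R[ u)%E.
Proof.
move=> Lu; have sb := L2_sqi b Lu; have [[mr mi] _] := Lu.
have mE : measurable_fun I01 (fun t => (1 * (complex.Re (u t) ^+ 2 + complex.Im (u t) ^+ 2))%:E).
  apply/measurable_EFinP; apply: measurable_funM => //.
  by apply: measurable_funD; exact: measurable_funX.
rewrite -Rint_EFin//; last exact: sb.2.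
rewrite /norm2 /wnorm2 -(@integral_itv_bndoo R 0 1 _ true false); last first.
  by apply: measurable_funS mE => //; exact: subset_itv_oo_cc.
apply: ge0_le_integral => //.
- by move=> t _; rewrite lee_fin -expr2 sqr_ge0.
- by apply/measurable_EFinP; apply: measurable_funM; exact: sb.1.
- by move=> t _; rewrite lee_fin mul1r cpart_sqr.
Qed.

Lemma primitive_prim b (u u' : R -> R[i]) : is_primitive u u' ->
  L2 (@Defs.leb R) I01 u' -> prim (fun t => cpart b (u t)) (fun t => cpart b (u' t)).
Proof.
move=> uu' Lu'; split; first exact: sqi_intg (L2_sqi b Lu').
by move=> t t01; rewrite (uu' t t01); case: b; case: (u 0).
Qed.

Lemma esum_cpart b (u : edge N -> R -> R[i]) :
  (forall e, L2 (@Defs.leb R) I01 (u e)) ->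
  (\esum_(e in [set: edge N]) ((ec e / 2)%:E * norm2 (@Defs.leb R) `]0%R, 1%R[ (u e)) < +oo)%E ->
  (\esum_(e in [set: edge N])
     (ec e / 2 * \int[leb]_(t in I01) (cpart b (u e t) * cpart b (u e t)))%:E < +oo)%E.
Proof.
move=> Lu; apply: le_lt_trans; apply: le_esum => e _.
by rewrite EFinM lee_wpmul2l ?lee_fin ?ec2_ge0// le_norm2_oo.
Qed.

Lemma laplacian_ge0_part b (F G : mgraph N -> R[i]) : laplacian F G ->
  0 <= \int[m1 N]_p (cpart b (G p) * cpart b (F p)).
Proof.
move=> [LF LG [u0 [u1 [u2 [S2 [s1 s2] cont kirch Gu]]]]].
have L1 e : L2 (@Defs.leb R) I01 (u1 e) by have [] := S2 e.
have L2' e : L2 (@Defs.leb R) I01 (u2 e) by have [] := S2 e.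
have H (K : mgraph N -> R[i]) : L2 (m1 N) setT K ->
    measurable_fun setT (fun p => cpart b (K p)) /\
    (\int[m1 N]_p (cpart b (K p) ^+ 2)%:E < +oo)%E.
  move=> /L2_parts[Kr Ki]; have [mK /integrableP[_ iK]] : sq_integrable (m1 N) (fun p => cpart b (K p)) by case: b.
  split=> //; apply: le_lt_trans iK; rewrite le_eqVlt; apply/orP; left; apply/eqP.
  by apply: eq_integral => p _; rewrite /= ger0_norm -expr2// sqr_ge0.
have [mF F2] := H F LF; have [mG G2] := H G LG.
apply: (real_form_ge0 mF mG F2 G2 (u0 := fun e t => cpart b (u0 e t))
  (u1 := fun e t => cpart b (u1 e t)) (u2 := fun e t => cpart b (u2 e t))).
- move=> e; have [h _ _ _ _] := S2 e.
  by apply: ae_mono h => t h t01; rewrite -h.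
- move=> e; apply: ae_mono (Gu e) => t h t01; rewrite [G _]h//.
  exact: cpartN.
- by move=> e; have [_ h _ _ _] := S2 e; exact: primitive_prim.
- by move=> e; have [_ _ h _ _] := S2 e; exact: primitive_prim.
- by move=> e; exact: L2_sqi.
- exact: esum_cpart.
- exact: esum_cpart.
- by move=> e e' ee'; rewrite (cont e e' ee').
- by move=> x; exact: has_csum_part (kirch x).
Qed.

Lemma laplacian_ge0 (F G : mgraph N -> R[i]) : laplacian F G ->
  0 <= \int[m1 N]_p (complex.Re (G p) * complex.Re (F p)) +
       \int[m1 N]_p (complex.Im (G p) * complex.Im (F p)).
Proof.
by move=> FG; apply: addr_ge0;
  [exact: (laplacian_ge0_part true FG)|exact: (laplacian_ge0_part false FG)].
Qed.

End form.

(** * Nonnegativity of the spectrum *)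

Section spectral.
Context {R : realType} {d : measure_display} {T : measurableType d}.
Variable m : {measure set T -> \bar R}.
Local Notation fT := (T -> R[i]).
Local Notation Re := (@complex.Re R).
Local Notation Im := (@complex.Im R).
Local Notation Rmeas := {measure set (measurableTypeR R) -> \bar R}.
Variables (E : set R -> fT -> fT) (nu : fT -> Rmeas).
Hypothesis pvm : is_pvm m E nu.

Lemma ae_pairing (f f' h : fT) : L2 m setT f -> L2 m setT f' -> L2 m setT h ->
  ceq m setT f f' -> pairing m f h = pairing m f' h.
Proof.
move=> Lf Lf' Lh ff'; rewrite !pairingE//.
have /L2_parts[fr fi] := Lf; have /L2_parts[f'r f'i] := Lf'; have /L2_parts[hr hi] := Lh.
have H (u u' v : T -> R) : sq_integrable m u -> sq_integrable m u' -> sq_integrable m v ->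
    {ae m, forall x, u x = u' x} -> \int[m]_x (u x * v x) = \int[m]_x (u' x * v x).
  move=> su su' sv uu'; rewrite /Rintegral; congr fine; apply: ae_eq_integral => //.
  - exact: measurable_int (sq_integrableM su sv).
  - exact: measurable_int (sq_integrableM su' sv).
  - by apply: ae_mono uu' => x hx _; rewrite hx.
have aer : {ae m, forall x, Re (f x) = Re (f' x)} by apply: ae_mono ff' => x hx; rewrite hx.
have aei : {ae m, forall x, Im (f x) = Im (f' x)} by apply: ae_mono ff' => x hx; rewrite hx.
by rewrite (H _ _ _ fr f'r hr aer) (H _ _ _ fi f'i hi aei) (H _ _ _ fi f'i hr aei) (H _ _ _ fr f'r hi aer).
Qed.

Lemma cmeasurable_indic (Om : set R) : measurable Om ->
  @cmeasurable R _ (measurableTypeR R) setT (fun l : R => ((\1_Om l : R)%:C%C : R[i])).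
Proof. by move=> mOm; split; [exact: (measurable_indic mOm)|exact: measurable_cst]. Qed.

(** The functional calculus is defined through the scalar measures nu; by
    polarization it gives back E Om for the indicator of Om. *)
Lemma fun_calc_indic (Om : set R) f : measurable Om -> L2 m setT f ->
  fun_calc m nu (fun l => ((\1_Om l : R)%:C%C : R[i])) f (E Om f).
Proof.
move=> mOm Lf; have LE := pvm_L2 pvm mOm Lf.
split=> //.
  split; first exact: cmeasurable_indic.
  rewrite wnorm2_real; apply: (@le_lt_trans _ _ (\int[nu f]_x (\1_Om x)%:E)%E).
    rewrite le_eqVlt; apply/orP; left; apply/eqP; apply: eq_integral => l _.
    by rewrite mul1r indicE; case: (l \in Om); rewrite ?expr1n ?expr0n.
  by rewrite integral_indic// setIT (pvm_measure pvm)// norm2_fin// ltry.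
move=> h Lh _; have LEh := pvm_L2 pvm mOm Lh.
have LEE := pvm_L2 pvm mOm LE.
have idem : ceq m setT (E Om (E Om f)) (E Om f).
  by have := pvm_setI pvm mOm mOm Lf; rewrite setIid.
rewrite -(ae_pairing LEE LE Lh idem) (pvm_selfadjoint pvm)//.
pose n k := fine (nu (fun x => f x + 'i%C ^+ k * h x) Om).
have nE k : n k = rnorm2 m (fun x => E Om f x + 'i%C ^+ k * E Om h x).
  have Lk : L2 m setT (fun x => f x + 'i%C ^+ k * h x).
    by have := L2_lin ('i%C ^+ k) Lh Lf; congr (L2 _ _ _); apply/funext => x; rewrite addrC.
  have LEk : L2 m setT (fun x => E Om f x + 'i%C ^+ k * E Om h x).
    by have := L2_lin ('i%C ^+ k) LEh LE; congr (L2 _ _ _); apply/funext => x; rewrite addrC.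
  have LE' := pvm_L2 pvm mOm Lk.
  rewrite /n (pvm_measure pvm)//.
  rewrite (_ : norm2 m setT _ = norm2 m setT (fun x => E Om f x + 'i%C ^+ k * E Om h x)).
    by rewrite norm2_fin.
  apply: ae_norm2 => //.
  have := pvm_linear pvm ('i%C ^+ k) mOm Lh Lf.
  rewrite (_ : (fun x => 'i%C ^+ k * h x + f x) = (fun x => f x + 'i%C ^+ k * h x)); last first.
    by apply/funext => x; rewrite addrC.
  by apply: ae_mono => x H _; rewrite H// addrC.
rewrite (polarization LE LEh (fun k _ => nE k)) /pvm_int; congr (_ * _).
apply: eq_bigr => k _; congr (_ * _); rewrite cint_real; congr (_%:C)%C.
by rewrite /n /Rintegral integral_indic// setIT.
Qed.

Variables (mu : Rmeas) (J : option nat) (M : nat -> set R) (U : nat -> fT -> R -> R[i]).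
Hypothesis osr : ordered_spectral_representation m nu mu J M U.
Variable H : fT -> fT -> Prop.
Hypothesis H_calc : forall f g, H f g <-> fun_calc m nu (fun l => l%:C%C) f g.
Hypothesis H_ge0 : forall f g, H f g ->
  0 <= \int[m]_x (Re (g x) * Re (f x)) + \int[m]_x (Im (g x) * Im (f x)).

Let un := osr_unitary osr.

Lemma L2_norm2 (D : set R) (g : R -> R[i]) : L2 mu D g -> (norm2 mu D g < +oo)%E.
Proof. by case. Qed.

Lemma measurable_sqnorm (D : set R) (g : R -> R[i]) : @cmeasurable R _ (measurableTypeR R) D g ->
  measurable_fun (T := measurableTypeR R) D (fun l => (cst 1 l * (Re (g l) ^+ 2 + Im (g l) ^+ 2))%:E).
Proof.
move=> [mr mi]; apply/measurable_EFinP; apply: measurable_funM => //.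
by apply: measurable_funD; exact: measurable_funX.
Qed.

Lemma norm2_le (D : set R) (c : R) (g h : R -> R[i]) : measurable D -> 0 <= c ->
  @cmeasurable R _ (measurableTypeR R) D g -> @cmeasurable R _ (measurableTypeR R) D h ->
  {ae mu, forall l, D l -> Re (g l) ^+ 2 + Im (g l) ^+ 2 <= c * (Re (h l) ^+ 2 + Im (h l) ^+ 2)} ->
  (norm2 mu D g <= c%:E * norm2 mu D h)%E.
Proof.
move=> mD c0 mg mh gh; rewrite /norm2 /wnorm2 -ge0_integralZl//; first last.
- by move=> l _; rewrite lee_fin mul1r addr_ge0 ?sqr_ge0.
- exact: measurable_sqnorm.
apply: ae_ge0_le_integral => //.
- by move=> l _; rewrite lee_fin mul1r addr_ge0 ?sqr_ge0.
- exact: measurable_sqnorm.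
- by move=> l _; rewrite -EFinM lee_fin mulr_ge0// mul1r addr_ge0 ?sqr_ge0.
- by apply: measurable_funeM; exact: measurable_sqnorm.
- by apply: ae_mono gh => l h' Dl; rewrite -EFinM lee_fin !mul1r h'.
Qed.

Lemma norm2_term_eq0 (u : nat -> R -> R[i]) :
  (\sum_(0 <= j <oo | below J j) norm2 mu (M j) (u j) = 0)%E ->
  forall j, below J j -> norm2 mu (M j) (u j) = 0%E.
Proof.
move=> s0 j bj; apply/eqP; rewrite eq_le norm2_ge0 andbT.
rewrite -s0; have h := @nneseries_lim_ge R (fun j => norm2 mu (M j) (u j)) (below J) 0 j.+1 (fun n _ _ => norm2_ge0 _ _ _).
apply: le_trans h; rewrite big_mkcond /= big_nat_recr//= bj leeDr//.
by apply: sume_ge0 => i _; case: ifP => // _; exact: norm2_ge0.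
Qed.

Lemma norm2_eq0_ae (D : set R) (g : R -> R[i]) : measurable D ->
  @cmeasurable R _ (measurableTypeR R) D g -> norm2 mu D g = 0%E -> ceq mu D g (cst 0).
Proof.
move=> mD mg n0; have mE := measurable_sqnorm mg.
have : (\int[mu]_(x in D) `|(cst 1 x * (Re (g x) ^+ 2 + Im (g x) ^+ 2))%:E| = 0)%E.
  rewrite -n0; apply: eq_integral => x _.
  by rewrite /= ger0_norm// mul1r addr_ge0 ?sqr_ge0.
move=> /(ae_eq_integral_abs mu mD mE); apply: ae_mono => x h Dx.
have := h Dx => -[] /=; rewrite mul1r => /eqP.
rewrite paddr_eq0 ?sqr_ge0// !sqrf_eq0 => /andP[/eqP a /eqP b].
by case: (g x) a b => a b /= -> ->.
Qed.

(** For g in the range of E Om put h := H g.  As |s + l| <= s on Om, |s g +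
    h| <= |s g|, and Re <h, g> >= 0 then forces h = 0, hence g = 0.  Below,
    g is E Om f, and h is built in the spectral representation as
    multiplication by w(l) = l 1_Om(l). *)
Lemma negative_spectrum_empty (s : R) f : 0 < s -> L2 m setT f ->
  ceq m setT (E `[- s, 0[%classic f) (cst 0).
Proof.
move=> s0 Lf; pose Om : set R := `[- s, 0[%classic; rewrite -/Om.
have mOm : measurable Om := measurable_itv _.
pose g := E Om f; have Lg : L2 m setT g := pvm_L2 pvm mOm Lf.
have Ug j : below J j -> ceq mu (M j) (U j g) (fun l => ((\1_Om l : R)%:C%C : R[i]) * U j f l).
  exact: (osr_intertwines osr (cmeasurable_indic mOm) Lf Lg).1 (fun_calc_indic mOm Lf) j.
pose w l : R := l * \1_Om l.
have w_s l : - s <= w l <= 0.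
  rewrite /w indicE; case: (boolP (l \in Om)) => [/set_mem|_]; last by rewrite mulr0; lra.
  by rewrite /Om /= in_itv /= mulr1 => /andP[-> /ltW ->].
have mw : measurable_fun (T := measurableTypeR R) setT w.
  have H1 : measurable_fun setT (fun l : R => l * \1_Om l) by apply: measurable_funM => //; exact: measurable_indic.
  exact: H1.
pose ga j l := (w l)%:C%C * U j g l.
have mM j : below J j -> measurable (M j) by exact: (osr_measurable osr).
have LU j u : below J j -> L2 m setT u -> L2 mu (M j) (U j u) by move=> bj Lu; exact: (unitary_L2 un bj Lu).
have gaE j l : Re (ga j l) ^+ 2 + Im (ga j l) ^+ 2 = w l ^+ 2 * (Re (U j g l) ^+ 2 + Im (U j g l) ^+ 2).
  rewrite /ga; case: (U j g l) => a b /=; ring.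
have mga j : below J j -> @cmeasurable R _ (measurableTypeR R) (M j) (ga j).
  move=> bj; have [[mr mi] _] := LU j g bj Lg.
  have mw' : measurable_fun (T := measurableTypeR R) (M j) w by apply: measurable_funTS; exact: mw.
  split.
  - rewrite (_ : (fun _ => _) = (fun l => w l * Re (U j g l))); first exact: measurable_funM.
    by apply/funext => l; rewrite /ga; case: (U j g l) => a b /=; ring.
  - rewrite (_ : (fun _ => _) = (fun l => w l * Im (U j g l))); first exact: measurable_funM.
    by apply/funext => l; rewrite /ga; case: (U j g l) => a b /=; ring.
have ga_le j : below J j -> (norm2 mu (M j) (ga j) <= (s ^+ 2)%:E * norm2 mu (M j) (U j g))%E.
  move=> bj; apply: norm2_le => //; [exact: mM|exact: sqr_ge0|exact: mga|exact: (LU j g bj Lg).1|].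
  apply: aeW => l _; rewrite gaE ler_wpM2r ?addr_ge0 ?sqr_ge0//.
  by have := w_s l; rewrite !expr2; nra.
have sumg := unitary_isometry un Lg.
have sum_ga : (\sum_(0 <= j <oo | below J j) norm2 mu (M j) (ga j) < +oo)%E.
  apply: (@le_lt_trans _ _ (\sum_(0 <= j <oo | below J j) (s ^+ 2)%:E * norm2 mu (M j) (U j g))%E).
    by apply: lee_nneseries => // j _ _; exact: norm2_ge0.
  rewrite nneseriesZl; last by move=> j _; exact: norm2_ge0.
  by rewrite sumg norm2_fin// -EFinM ltry.
have Lga j : below J j -> L2 mu (M j) (ga j).
  move=> bj; split; first exact: mga.
  apply: le_lt_trans (ga_le j bj) _.
  by rewrite lte_mul_pinfty ?lee_fin ?sqr_ge0//; exact: L2_norm2 (LU j g bj Lg).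
have [h Lh Uh] := unitary_surj un Lga sum_ga.
have Hgh : H g h.
  apply/H_calc; apply/(osr_intertwines osr _ Lg Lh).
    by split; [exact: measurable_id|exact: measurable_cst].
  move=> j bj; have := Uh j bj; have := Ug j bj; apply: ae_mono2 => l a b Ml.
  rewrite (b Ml) /ga (a Ml) mulrA [RHS]mulrA -!rmorphM /= /w; congr ((_)%:C%C * _).
  by rewrite indicE; case: (l \in Om); rewrite ?mulr1 ?mulr0// mul0r.
pose q x := s%:C%C * g x + h x.
have Lq : L2 m setT q by exact: L2_lin.
(* On Om, where g lives, |s + l| <= s. *)
have q_le j : below J j -> (norm2 mu (M j) (U j q) <= (s ^+ 2)%:E * norm2 mu (M j) (U j g))%E.
  move=> bj; apply: norm2_le => //; [exact: mM|exact: sqr_ge0|exact: (LU j q bj Lq).1|exact: (LU j g bj Lg).1|].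
  have := unitary_linear un (s%:C%C) bj Lg Lh; have := Uh j bj; apply: ae_mono2 => l a b Ml.
  rewrite (b Ml) (a Ml) /ga.
  have -> : s%:C%C * U j g l + (w l)%:C%C * U j g l = (s + w l)%:C%C * U j g l.
    by rewrite -mulrDl -rmorphD.
  rewrite [leLHS](_ : _ = (s + w l) ^+ 2 * (Re (U j g l) ^+ 2 + Im (U j g l) ^+ 2)); last first.
    by case: (U j g l) => x y /=; ring.
  rewrite ler_wpM2r ?addr_ge0 ?sqr_ge0//.
  by have := w_s l; rewrite !expr2; nra.
have nq : (norm2 m setT q <= (s ^+ 2)%:E * norm2 m setT g)%E.
  rewrite -(unitary_isometry un Lq) -sumg -nneseriesZl; last by move=> j _; exact: norm2_ge0.
  by apply: lee_nneseries => // j _ _; exact: norm2_ge0.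
(* |s g + h|^2 = |h|^2 + s^2 |g|^2 + 2 s Re <h, g> with Re <h, g> >= 0. *)
have h0 : rnorm2 m h = 0.
  have [hr hi] := (L2_parts m h).1 Lh; have [gr gi] := (L2_parts m g).1 Lg.
  have : rnorm2 m q = rnorm2 m h + (s ^+ 2 + 0 ^+ 2) * rnorm2 m g +
    2 * s * (\int[m]_x (Re (h x) * Re (g x)) + \int[m]_x (Im (h x) * Im (g x))) +
    2 * 0 * (\int[m]_x (Im (h x) * Re (g x)) - \int[m]_x (Re (h x) * Im (g x))).
    apply: rnorm2_lin => // x; rewrite /q; case: (g x) (h x) => [a b] [c e] /=; ring.
  have p := H_ge0 Hgh.
  have h_ge0 : 0 <= rnorm2 m h by rewrite /rnorm2 addr_ge0// Rintegral_ge0// => x _; rewrite -expr2 sqr_ge0.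
  move: nq; rewrite !norm2_fin// -EFinM lee_fin => nq E2.
  have p' := mulr_ge0 (ltW s0) p.
  rewrite E2 in nq; apply/eqP; rewrite eq_le h_ge0 andbT.
  rewrite [0 ^+ 2]expr0n addr0 mulr0 mul0r addr0 -mulrA in nq.
  by move: nq p' {E2 p}; set A := _ * (_ + _); lra.
have Uh0 j : below J j -> norm2 mu (M j) (U j h) = 0%E.
  move: j; apply: (norm2_term_eq0 (u := fun j => U j h)).
  by rewrite (unitary_isometry un Lh) norm2_fin// h0.
have Ug0 j : below J j -> norm2 mu (M j) (U j g) = 0%E.
  move=> bj; have aeh := norm2_eq0_ae (mM j bj) (LU j h bj Lh).1 (Uh0 j bj).
  apply/eqP; rewrite eq_le norm2_ge0 andbT.
  rewrite -[leRHS](mul0e (norm2 mu (M j) (U j g))).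
  apply: norm2_le => //; [exact: mM|exact: (LU j g bj Lg).1|exact: (LU j g bj Lg).1|].
  have := Ug j bj; have := Uh j bj; move: aeh; apply: ae_mono3 => l a b c Ml.
  have := c Ml; rewrite indicE; case: (boolP (l \in Om)) => [lO|_]; last first.
    by rewrite mul0r => -> /=; rewrite expr0n /= addr0 mul0r.
  move=> _; have := a Ml; rewrite (b Ml) /ga /w indicE lO mulr1 /cst => /eqP.
  rewrite mulf_eq0 => /orP[/eqP l0|/eqP ->]; last by rewrite /= expr0n /= addr0 mul0r.
  by move/set_mem : lO; rewrite /Om /= in_itv /= -(complexI l0 : l = 0) ltxx andbF.
apply: norm2_eq0 => //; rewrite -sumg.
by apply: eseries0 => j _ bj; exact: Ug0.
Qed.

Lemma ae_spectrum_ge0 : spectral_measure m E mu -> {ae mu, forall l : R, 0 <= l}.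
Proof.
move=> sm; have neg n : mu.-negligible (`[- (n.+1%:R : R), 0[%classic).
  exists `[- (n.+1%:R : R), 0[%classic; split => //.
  have mI : measurable (`[- (n.+1%:R : R), 0[%classic) by exact: measurable_itv.
  by apply/(sm _ mI) => f Lf; apply: negative_spectrum_empty.
apply: negligibleS (negligible_bigcup neg) => l /= /negP; rewrite -ltNge => l0.
exists (Num.bound `|l|) => //=; rewrite in_itv /= l0 andbT lerNl.
have -> : - l = `|l| by rewrite ltr0_norm.
by apply/ltW/(lt_trans (archi_boundP (normr_ge0 l))); rewrite ltr_nat.
Qed.

End spectral.

(** * Complex generalized eigenfunctions *)

Section structure.
Context {R : realType} (N : network R).
Local Notation leb := (@lebesgue_measure R).
Local Notation I01 := (`[0, 1]%classic : set R).
Local Notation edge := (edge N).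

Lemma normc_le (x : R[i]) : Normc.normc x <= `|complex.Re x| + `|complex.Im x|.
Proof.
case: x => x y /=; rewrite -[leRHS]ger0_norm ?addr_ge0// -sqrtr_sqr.
rewrite ler_wsqrtr// sqrrD !real_normK ?num_real//.
by rewrite lerD2r lerDl mulrn_wge0// mulr_ge0.
Qed.

Section eigen.
Variables (rho : mgraph N -> R) (rho_gt0 : forall p, 0 < rho p)
  (mrho : measurable_fun setT rho)
  (rho_bd : forall e : edge, exists B : R, forall t, 0 < t < 1 -> rho (pt e t) <= B).
Variables (z : R) (Q : mgraph N -> R[i]).
Hypothesis Q_L2 : L2w (m1 N) setT (fun p => (rho p)^-1) Q.
Hypothesis Q_eigen : forall f h : mgraph N -> R[i],
  L2w (m1 N) setT rho f -> L2w (m1 N) setT rho h -> laplacian f h ->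
  pairing (m1 N) h Q = (z ^+ 2)%:C%C * pairing (m1 N) f Q.
Variable (W : edge -> R).
Hypothesis rhoW : forall (e : edge) t, 0 < t -> t <= 3^-1 -> rho (pt e t) <= W e.
Hypothesis star_c : forall x, (\esum_(e in [set e : edge | src e = x]) (ec e)%:E < +oo)%E.
Hypothesis star_W : forall x, (\esum_(e in [set e : edge | src e = x]) (ec e * W e)%:E < +oo)%E.

Let P b p := cpart b (conjc (Q p)).

Let mP b : measurable_fun setT (P b).
Proof.
have [[mr mi] _] := Q_L2; case: b.
  by rewrite (_ : P true = fun p => complex.Re (Q p))//; apply/funext => p; rewrite /P; case: (Q p).
rewrite (_ : P false = fun p => - complex.Im (Q p)); first exact: measurable_funN.
by apply/funext => p; rewrite /P; case: (Q p).
Qed.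

Let mrhoi : measurable_fun setT (fun p => (rho p)^-1).
Proof. exact: measurable_funV_gt0. Qed.

Let P_L2 b : (\int[m1 N]_p ((rho p)^-1 * P b p ^+ 2)%:E < +oo)%E.
Proof.
have [[mr mi]] := Q_L2; apply: le_lt_trans; apply: ge0_le_integral => //.
- by move=> p _; rewrite lee_fin mulr_ge0 ?sqr_ge0// invr_ge0 ltW.
- by apply/measurable_EFinP; apply: measurable_funM => //; apply: measurable_funX; exact: mP.
- apply/measurable_EFinP; apply: measurable_funM => //.
  by apply: measurable_funD; exact: measurable_funX.
- move=> p _; rewrite lee_fin; apply: ler_wpM2l; first by rewrite invr_ge0 ltW.
  apply: le_trans (_ : complex.Re (conjc (Q p)) ^+ 2 + complex.Im (conjc (Q p)) ^+ 2 <= _).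
    by rewrite expr2 cpart_sqr.
  by case: (Q p) => x y /=; rewrite sqrrN.
Qed.

Lemma cpart_pairing b (f : mgraph N -> R) :
  cpart b (pairing (m1 N) (fun p => (f p)%:C%C) Q) = \int[m1 N]_p (f p * P b p).
Proof.
by rewrite /pairing /cint; case: b => /=; apply: eq_Rintegral => p _;
  rewrite /P; case: (Q p) => x y /=; ring.
Qed.

Let P_eigen b : forall f h : mgraph N -> R,
  L2w (m1 N) setT rho (fun p => (f p)%:C%C) -> L2w (m1 N) setT rho (fun p => (h p)%:C%C) ->
  @laplacian R N (fun p => (f p)%:C%C) (fun p => (h p)%:C%C) ->
  \int[m1 N]_p (h p * P b p) = z ^+ 2 * \int[m1 N]_p (f p * P b p).
Proof.
move=> f h Lf Lh fh.
by rewrite -!cpart_pairing (Q_eigen Lf Lh fh) cpartZ.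
Qed.

(** The pairing is conjugate linear in Q, so the real results apply to the
    two parts of the conjugate of Q.  At x the value b(x) is the common
    value of the coefficients b(e) over the edges that start at x. *)
Lemma eigenfunction_structure : exists (b : vert N -> R[i]) (a : edge -> R[i]),
  [/\ {ae m1 N, forall p : mgraph N, forall (e : edge) t,
         0 <= t <= 1 -> p = pt e t ->
         Q p = b (src e) * (cos (z * t))%:C%C + a e * (Phi z t)%:C%C},
      forall x,
        (\esum_(e in [set e : edge | src e = x]) (ec e * Normc.normc (a e))%:E < +oo)%E &
      forall x, has_csum [set e : edge | src e = x] (fun e => (ec e)%:C%C * a e) 0].
Proof.
have ef b := edge_form rho_gt0 mrho rho_bd (mP b) (P_L2 b) (@P_eigen b).
have /choice[r rE] := ef true; have /choice[s sE] := ef false.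
have rK := kirchhoff rho_gt0 mrho rho_bd (mP true) (P_L2 true) (@P_eigen true) rhoW star_c star_W rE.
have sK := kirchhoff rho_gt0 mrho rho_bd (mP false) (P_L2 false) (@P_eigen false) rhoW star_c star_W sE.
have rC := vertex_continuity rho_gt0 mrho rho_bd (mP true) (P_L2 true) (@P_eigen true) rE.
have sC := vertex_continuity rho_gt0 mrho rho_bd (mP false) (P_L2 false) (@P_eigen false) sE.
have /choice[b bE] : forall x, exists b : R[i], forall e : edge, src e = x ->
    b = ((r e).1 +i* - (s e).1)%C.
  move=> x; have [[e0 e0x]|nx] := pselect (exists e : edge, src e = x).
    exists ((r e0).1 +i* - (s e0).1)%C => e ex.
    by rewrite (rC e e0) ?ex// (sC e e0) ?ex.
  by exists 0 => e ex; case: nx; exists e.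
exists b, (fun e => (r e).2 +i* - (s e).2)%C; split.
- have := ae_m1 sE; have := ae_m1 rE; apply: ae_mono2 => p hr hs e t t01 pe.
  have := hr e t t01 pe; have := hs e t t01 pe; rewrite -pe (bE _ e erefl) /P /cosz.
  by case: (Q p) => x y /= ys ->; apply/eqP; rewrite eq_complex /= -(opprK y) ys;
    apply/andP; split; apply/eqP; ring.
- move=> x; have [ra _] := rK x; have [sa _] := sK x.
  apply: le_lt_trans (lte_add_pinfty ra sa); rewrite -esumD//.
  apply: le_esum => e _; rewrite -EFinD lee_fin !normrM -mulrDr gtr0_norm ?ec_gt0//.
  by rewrite ler_wpM2l ?(ltW (ec_gt0 _))//; apply: le_trans (normc_le _) _; rewrite /= normrN.
- move=> x; have [_ rk] := rK x; have [_ sk] := sK x; split.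
    by apply: rsum_eq rk => e _ /=; ring.
  by have := rsumZ (c := -1) sk; rewrite mulr0; apply: rsum_eq => e _ /=; ring.
Qed.

End eigen.
End structure.

(** * The weight *)

Section weight.
Context {R : realType} (N : network R).
Local Notation edge := (edge N).
Variables (v : vert N -> R).
Variables (w : mgraph N -> R) (w_gt0 : forall p, 0 < w p).
Hypothesis w_left : forall (e : edge) t, 0 < t < 2^-1 ->
     w (pt e t) = v (src e) * ec e `^ 4^-1.
Hypothesis w_right : forall (e : edge) t, 2^-1 < t < 1 ->
     w (pt e t) = v (tgt e) * ec e `^ 4^-1.
Hypothesis alpha_fin : forall x : vert N, (alpha N x < +oo)%E.

Let rho p := w p ^+ 2 / c1 N p.
Let W (e : edge) x := v x ^+ 2 * Num.sqrt (ec e) / ec e.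

Lemma weight_gt0 p : 0 < rho p.
Proof. by rewrite divr_gt0 ?exprn_gt0 ?w_gt0// ec_gt0. Qed.

Lemma sqr_root4 (c : R) : 0 < c -> (c `^ 4^-1) ^+ 2 = Num.sqrt c.
Proof.
move=> c0; rewrite -powR_mulrn ?powR_ge0// -powRrM -powR12_sqrt ?ltW//.
by congr (_ `^ _); field.
Qed.

Lemma weight_left (e : edge) t : 0 < t < 2^-1 -> rho (pt e t) = W e (src e).
Proof.
move=> t0; rewrite /rho c1_pt; last by lra.
by rewrite w_left// exprMn sqr_root4// ec_gt0.
Qed.

Lemma weight_right (e : edge) t : 2^-1 < t < 1 -> rho (pt e t) = W e (tgt e).
Proof.
move=> t0; rewrite /rho c1_pt; last by lra.
by rewrite w_right// exprMn sqr_root4// ec_gt0.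
Qed.

Let rho_step (e : edge) t : 0 < t < 1 -> rho (pt e t) =
  if t < 2^-1 then W e (src e) else if t <= 2^-1 then rho (pt e 2^-1) else W e (tgt e).
Proof.
move=> /andP[t0 t1]; case: ifPn => [h|]; first by rewrite weight_left ?t0.
rewrite -leNgt => h; case: ifPn => [h'|].
  by congr (rho (pt e _)); apply/eqP; rewrite eq_le h h'.
by rewrite -ltNge => h'; rewrite weight_right ?h'.
Qed.

Lemma measurable_weight : measurable_fun setT rho.
Proof.
apply: measurable_graph => e.
pose g (t : R) : R := if t < 2^-1 then W e (src e)
  else if t <= 2^-1 then rho (pt e 2^-1) else W e (tgt e).
suff mg : measurable_fun (`]0, 1[%classic : set R) g.
  by apply: eq_measurable_fun mg => t; rewrite inE /= in_itv /= => t01; rewrite rho_step.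
apply: measurable_funTS; apply: measurable_fun_ifT => //.
  exact: measurable_fun_ltr.
apply: measurable_fun_ifT => //.
exact: measurable_fun_ler.
Qed.

Lemma weight_bounded (e : edge) : exists B : R, forall t, 0 < t < 1 -> rho (pt e t) <= B.
Proof.
have W0 x : 0 <= W e x.
  by apply: divr_ge0; [rewrite mulr_ge0 ?sqr_ge0 ?sqrtr_ge0|exact/ltW/ec_gt0].
exists (W e (src e) + rho (pt e 2^-1) + W e (tgt e)) => t t01; rewrite rho_step//.
have := W0 (src e); have := W0 (tgt e); have := ltW (weight_gt0 (pt e 2^-1)).
by case: ifP => _; [|case: ifP => _]; lra.
Qed.

Lemma weight_near_src (e : edge) t : 0 < t -> t <= 3^-1 -> rho (pt e t) <= W e (src e).
Proof. by move=> t0 t1; rewrite weight_left//; lra. Qed.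

Lemma esum_star x (F : R -> R) :
  (\esum_(e in [set e : edge | src e = x]) (F (ec e))%:E =
   \esum_(y in [set y | adj x y]) (F (cond x y))%:E)%E.
Proof.
rewrite (@reindex_esum _ _ _ [set e : edge | src e = x] _ (@tgt R N)); last first.
  split.
  - by move=> e /= <-; exact: (valP e).
  - move=> e e'; rewrite !inE /= => ex e'x ee'; apply: val_inj.
    move: ex e'x ee'; rewrite /src /tgt; case: (val e) (val e') => [p q] [p' q'] /=.
    by move=> -> -> ->.
  - by move=> y /= xy; exists (exist _ (x, y) xy).
by apply: eq_esum => e /= <-.
Qed.

Lemma star_conductance x : (\esum_(e in [set e : edge | src e = x]) (ec e)%:E < +oo)%E.
Proof. by rewrite (esum_star x id); exact: cond_sum. Qed.

(** Here c W = v(x)^2 sqrt c, whose sum over the edges at x is v(x)^2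
    alpha(x). *)
Lemma star_weight x :
  (\esum_(e in [set e : edge | src e = x]) (ec e * W e (src e))%:E < +oo)%E.
Proof.
have a : asum [set e : edge | src e = x] (fun e => Num.sqrt (ec e)).
  apply: le_lt_trans (alpha_fin x); rewrite /alpha -(esum_star x Num.sqrt).
  by apply: le_esum => e _; rewrite ger0_norm ?sqrtr_ge0.
apply: le_lt_trans (asumZ (v x ^+ 2) a); apply: le_esum => e /= <-.
rewrite lee_fin /W mulrC divfK ?lt0r_neq0 ?ec_gt0//; exact: ler_norm.
Qed.

End weight.

(** * Fourier-type expansions of the Laplacian *)

Local Open Scope complex_scope.
Theorem theorem19 (R : realType) (N : network R)
  (alpha_fin : forall x : vert N, (alpha N x < +oo)%E)
  (v : vert N -> R) (v_gt0 : forall x, 0 < v x)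
  (v_ge : forall x, m0 N x `^ 4^-1 <= v x)
  (v_sum : (\esum_(x in [set: vert N]) (fine (alpha N x) / v x ^+ 2)%:E < +oo)%E)
  (w : mgraph N -> R) (w_gt0 : forall p, 0 < w p)
  (w_left : forall (e : edge N) t, 0 < t < 2^-1 ->
     w (pt e t) = v (src e) * ec e `^ 4^-1)
  (w_right : forall (e : edge N) t, 2^-1 < t < 1 ->
     w (pt e t) = v (tgt e) * ec e `^ 4^-1)
  (E : set R -> (mgraph N -> R[i]) -> (mgraph N -> R[i]))
  (nu : (mgraph N -> R[i]) -> {measure set (measurableTypeR R) -> \bar R})
  (E_L : spectral_resolution (m1 N) (@laplacian R N) E nu)
  (mu : {measure set (measurableTypeR R) -> \bar R})
  (mu_L : spectral_measure (m1 N) E mu)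
  (J : option nat) (M : nat -> set R)
  (U : nat -> (mgraph N -> R[i]) -> R -> R[i])
  (U_L : ordered_spectral_representation (m1 N) nu mu J M U)
  (Psi : nat -> R -> mgraph N -> R[i])
  (Psi_L : fourier_expansion (m1 N)
     (fun p => w p ^+ 2 / c1 N p) (fun p => c1 N p / w p ^+ 2)
     (@laplacian R N) mu J M U Psi) :
  forall j, below J j ->
  {ae mu, forall lambda, M j lambda ->
    exists (b : vert N -> R[i]) (a : edge N -> R[i]),
    [/\ {ae m1 N, forall p : mgraph N, forall (e : edge N) t,
           0 <= t <= 1 -> p = pt e t ->
           Psi j lambda p =
             b (src e) * (cos (Num.sqrt lambda * t))%:C
             + a e * (Phi (Num.sqrt lambda) t)%:C},
        forall x,
          (\esum_(e in [set e : edge N | src e = x])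
             (ec e * Normc.normc (a e))%:E < +oo)%E &
        forall x, has_csum [set e : edge N | src e = x]
          (fun e => (ec e)%:C * a e) 0]}.
Proof.
pose rho p := w p ^+ 2 / c1 N p.
have HpE : (fun p => w p ^+ 2 / c1 N p) = rho by [].
have HmE : (fun p => c1 N p / w p ^+ 2) = fun p => (rho p)^-1.
  by apply/funext => p; rewrite /rho invf_div.
rewrite HpE HmE in Psi_L.
have [pvm L_calc] := E_L => j bj.
have spec := ae_spectrum_ge0 pvm U_L L_calc (@laplacian_ge0 R N) mu_L.
have := fe_eigen Psi_L bj; move: spec; apply: ae_mono2 => l l0 eig Ml.
have zz : Num.sqrt l ^+ 2 = l by rewrite sqr_sqrtr.
pose W (e : edge N) := v (src e) ^+ 2 * Num.sqrt (ec e) / ec e.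
have rho_gt0 : forall p, 0 < rho p := weight_gt0 w_gt0.
have mrho : measurable_fun setT rho := measurable_weight w_left w_right.
have rho_bd := weight_bounded w_gt0 w_left w_right.
have rhoW : forall (e : edge N) t, 0 < t -> t <= 3^-1 -> rho (pt e t) <= W e.
  exact: weight_near_src w_left.
apply: (eigenfunction_structure rho_gt0 mrho rho_bd (fe_Hm Psi_L bj Ml) _ rhoW).
- by move=> f h Lf Lh fh; rewrite zz; exact: eig.
- exact: star_conductance.
- exact: star_weight alpha_fin.
Qed.
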